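(* Let $d>1$ be odd, $0\le r_0<r_1\le\infty$, and let $f:A(r_0,r_1)\to\mathbb{C}$ be polyharmonic of infinite order and type $\tau$ with $\tau<1/(2r_0)$. Fix $k\in\mathbb{N}_0$, $l\in\{1,\dots,a_k\}$. Then for every $v_0$ with $r_0<e^{v_0}<\min\{r_1,1/(2\tau)\}$ the double series $$F_{k,l}(z)=\sum_{n=0}^\infty\sum_{j=0}^n D^{(n)}\widetilde f_{k,l}(v_0)\,\frac{e^{-\lambda_j(k)v_0}}{q_n'(\lambda_j(k))}\,z^{\lambda_j(k)}$$ converges absolutely and uniformly on compact subsets of $\{z\in\mathbb{C}:0<|z|<1/(2\tau)\}$, and $F_{k,l}(r)=f_{k,l}(r)$ for all $r\in(r_0,\min\{r_1,1/(2\tau)\})$.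
   Context: Conventions: $1/(2\tau)=\infty$ if $\tau=0$, $1/(2r_0)=\infty$ if $r_0=0$. $A(r_0,r_1)=\{x\in\mathbb{R}^d: r_0<|x|<r_1\}$. A function $f:G\to\mathbb{C}$ on a domain $G\subset\mathbb{R}^d$ is polyharmonic of infinite order and type $\tau\ge0$ if $f\in C^\infty(G)$ and for every compact $K\subset G$ and every $\varepsilon>0$ there is $C_{K,\varepsilon}>0$ with $\max_{x\in K}|\Delta^p f(x)|\le C_{K,\varepsilon}(2p)!(\tau+\varepsilon)^{2p}$ for all $p\in\mathbb{N}_0$. $Y_{k,l}$, $l=1,\dots,a_k$, is an orthonormal basis (in $L^2(\mathbb{S}^{d-1},d\theta)$) of harmonic homogeneous polynomials of degree $k$; $f_{k,l}(r)=\int_{\mathbb{S}^{d-1}}f(r\theta)\overline{Y_{k,l}(\theta)}d\theta$, $\widetilde f_{k,l}(v)=f_{k,l}(e^v)$. Exponents $\lambda_{2j}(k)=k+2j$, $\lambda_{2j+1}(k)=-k-d+2+2j$ (integers, pairwise distinct since $d$ is odd), so $z^{\lambda_j(k)}$ are integer powers. $q_n(\lambda)=\prod_{j=0}^n(\lambda-\lambda_j(k))$. $D^{(n)}g=(\frac{d}{dv}-\lambda_0(k))\cdots(\frac{d}{dv}-\lambda_{n-1}(k))g$, $D^{(0)}g=g$. *)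

(* Defs.v *)
From mathcomp Require Import all_boot all_order all_algebra.
From mathcomp Require Import all_classical all_reals all_analysis.
From mathcomp Require Import complex.
Set Implicit Arguments. Unset Strict Implicit. Unset Printing Implicit Defensive.
Import Order.TTheory GRing.Theory Num.Theory.
Import numFieldNormedType.Exports.
Local Open Scope classical_set_scope.
Local Open Scope ring_scope.


Definition cabs {R : realType} (z : R[i]) : R := Num.sqrt (complex.Re z ^+ 2 + complex.Im z ^+ 2).

(* Euclidean norm on R^d (the library norm on 'rV is the max norm) *)
Definition enorm {R : realType} (d : nat) (x : 'rV[R]_d) : R := Num.sqrt (\sum_(i < d) x 0 i ^+ 2).

Definition evec {R : realType} (d : nat) (i : 'I_d) : 'rV[R]_d := delta_mx 0 i.

Definition pdC {R : realType} (d : nat) (i : 'I_d) (g : 'rV[R]_d -> R[i]) : 'rV[R]_d -> R[i] :=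
  fun x => Complex ('D_(evec i) (fun y => complex.Re (g y)) x)
                   ('D_(evec i) (fun y => complex.Im (g y)) x).

Definition pdsC {R : realType} (d : nat) (s : seq 'I_d) (g : 'rV[R]_d -> R[i]) : 'rV[R]_d -> R[i] :=
  foldr (fun i h => pdC i h) g s.

Definition laplC {R : realType} (d : nat) (g : 'rV[R]_d -> R[i]) : 'rV[R]_d -> R[i] :=
  fun x => \sum_(i < d) pdC i (pdC i g) x.

Definition smooth_on {R : realType} (d : nat) (G : set 'rV[R]_d) (g : 'rV[R]_d -> R[i]) : Prop :=
  forall (s : seq 'I_d) (x : 'rV[R]_d), G x ->
    differentiable (fun y => complex.Re (pdsC s g y)) x /\
    differentiable (fun y => complex.Im (pdsC s g y)) x.

Definition polyharmonic_inf {R : realType} (d : nat) (G : set 'rV[R]_d) (tau : R)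
    (g : 'rV[R]_d -> R[i]) : Prop :=
  smooth_on G g /\
  forall K : set 'rV[R]_d, compact K -> K `<=` G ->
  forall eps : R, 0 < eps ->
  exists CK : R, 0 < CK /\
    forall (p : nat) (x : 'rV[R]_d), K x ->
      cabs (iter p (@laplC R d) g x) <= CK * ((p.*2)`!)%:R * (tau + eps) ^+ (p.*2).

Definition annulus {R : realType} (d : nat) (r0 : R) (r1 : \bar R) : set 'rV[R]_d :=
  [set x | r0 < enorm x /\ ((enorm x)%:E < r1)%E].

Fixpoint cube_int {R : realType} (n : nat) : ('rV[R]_n -> R) -> R :=
  match n as n0 return ('rV[R]_n0 -> R) -> R with
  | 0 => fun h => h 0
  | n'.+1 => fun h =>
      Rintegral (@lebesgue_measure R) [set t : R | -1 <= t <= 1]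
        (fun t : R => cube_int (fun y : 'rV[R]_n' => h (row_mx (const_mx t : 'rV[R]_1) y)))
  end.

(* integral over the unit sphere S^{d-1} w.r.t. the surface measure dtheta,
   via polar coordinates: int_{S^{d-1}} h dtheta = d * int_{|x|<1} h(x/|x|) dx *)
Definition sphere_int {R : realType} (d : nat) (h : 'rV[R]_d -> R) : R :=
  d%:R * cube_int (fun x : 'rV[R]_d =>
                     if enorm x < 1 then h ((enorm x)^-1 *: x) else 0).

Definition sphere_intC {R : realType} (d : nat) (h : 'rV[R]_d -> R[i]) : R[i] :=
  Complex (sphere_int (fun x => complex.Re (h x))) (sphere_int (fun x => complex.Im (h x))).

Definition homog_poly {R : realType} (d k : nat) (Y : 'rV[R]_d -> R[i]) : Prop :=
  exists c : {ffun 'I_d -> 'I_k.+1} -> R[i],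
    forall x : 'rV[R]_d,
      Y x = \sum_(m : {ffun 'I_d -> 'I_k.+1} | (\sum_(i < d) (m i : nat))%N == k)
               c m * \prod_(i < d) ((x 0 i)%:C%C ^+ (m i : nat)).

Definition harm_homog_poly {R : realType} (d k : nat) (Y : 'rV[R]_d -> R[i]) : Prop :=
  homog_poly k Y /\ forall x, laplC Y x = 0.

Definition fcoef {R : realType} (d : nat) (f Y : 'rV[R]_d -> R[i]) (r : R) : R[i] :=
  sphere_intC (fun th => f (r *: th) * conjc (Y th)).

Definition dC {R : realType} (g : R -> R[i]) : R -> R[i] :=
  fun v => Complex (derive1 (fun w => complex.Re (g w)) v) (derive1 (fun w => complex.Im (g w)) v).

(* exponents lambda_j(k): lambda_{2i} = k+2i, lambda_{2i+1} = -k-d+2+2i *)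
Definition lam (d k j : nat) : int :=
  if odd j then (j%:Z - k%:Z - d%:Z + 1)%R else (k + j)%:Z.

Definition Dop {R : realType} (d k n : nat) (g : R -> R[i]) : R -> R[i] :=
  foldr (fun j h => fun v => dC h v - ((lam d k j)%:~R)%:C%C * h v) g (iota 0 n).

Definition qpoly {R : realType} (d k n : nat) : {poly R} :=
  \prod_(j < n.+1) ('X - ((lam d k j)%:~R)%:P).

Definition Fterm {R : realType} (d k : nat) (f Y : 'rV[R]_d -> R[i]) (v0 : R) (n j : nat) (z : R[i]) : R[i] :=
  Dop d k n (fun v => fcoef f Y (expR v)) v0
  * ((expR (- (lam d k j)%:~R * v0) / (deriv (qpoly d k n)).[(lam d k j)%:~R])%:C%C)
  * z ^ (lam d k j).

Definition Fpartial {R : realType} (d k : nat) (f Y : 'rV[R]_d -> R[i]) (v0 : R) (N : nat) (z : R[i]) : R[i] :=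
  \sum_(n < N) \sum_(j < n.+1) Fterm k f Y v0 n j z.

Definition Fpartial_abs {R : realType} (d k : nat) (f Y : 'rV[R]_d -> R[i]) (v0 : R) (N : nat) (z : R[i]) : R :=
  \sum_(n < N) \sum_(j < n.+1) cabs (Fterm k f Y v0 n j z).

Definition unif_cvgC {R : realType} (K : set R[i]) (u : nat -> R[i] -> R[i]) (F : R[i] -> R[i]) : Prop :=
  forall e : R, 0 < e -> exists N : nat, forall n : nat, (N <= n)%N ->
    forall z, K z -> cabs (u n z - F z) < e.

Definition unif_cvgR {R : realType} (K : set R[i]) (u : nat -> R[i] -> R) (F : R[i] -> R) : Prop :=
  forall e : R, 0 < e -> exists N : nat, forall n : nat, (N <= n)%N ->
    forall z, K z -> `|u n z - F z| < e.


Definition compactC {R : realType} (K : set R[i]) : Prop :=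
  compact [set (complex.Re z, complex.Im z) | z in K].

(* Main.v *)
Require Import Defs.
From mathcomp Require Import all_boot all_order all_algebra.
From mathcomp Require Import all_classical all_reals all_analysis.
From mathcomp Require Import complex.
From mathcomp Require Import measurable_realfun.
From mathcomp Require Import ring lra zify.
Set Implicit Arguments. Unset Strict Implicit. Unset Printing Implicit Defensive.
Import Order.TTheory GRing.Theory Num.Theory.
Import numFieldNormedType.Exports.
Local Open Scope classical_set_scope.
Local Open Scope ring_scope.

(** Write G_p(v) for the integral over the unit sphere of (Delta^p f)(e^v theta) times the conjugate
    of Y(theta). The rotation fields x_i d_j - x_j d_i integrate to zero over the sphere
    ([sphere_int_rot]); summed over i and j this becomes Green's identity on the sphere
    ([sphere_ode]), that is, G_p'' + (d-2) G_p' - k(k+d-2) G_p = e^{2v} G_{p+1}. The left side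
    factors as (d/dv - k)(d/dv + k+d-2) G_p, and conjugating by e^{2pv} moves the two roots to
    lambda_{2p} and lambda_{2p+1}. So D^(n) of the coefficient is e^{2pv} G_p for n = 2p and e^{2pv}
    (G_p' - k G_p) for n = 2p+1 ([Eseq], [Eseq_deriv], [DopR_seq]). The growth hypothesis bounds
    G_p, interpolation between G_p and G_{p+1} bounds G_p', and together |D^(n)(v)| <= C n! sigma^n
    e^{nv} for every sigma > tau, locally uniformly in v ([Eseq_bound]).

    At z = e^v the inner sum of the series is D^(n)(v0) Phi_n(v - v0), where Phi_n is the divided
    difference of lambda -> e^{lambda t} at lambda_0, ..., lambda_n. Since Phi_n' = lambda_n Phi_n +
    Phi_{n-1} and Phi_n(0) is 1 for n = 0 and 0 otherwise, the series is a Taylor expansion adapted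
    to the operators D^(n). Differentiating its partial sum in the base point w telescopes to
    D^(N+1)(w) Phi_N(v - w) ([taylor_deriv]), which controls the remainder ([taylor_cvg]).

    All convergence rests on one estimate. The lambda_j are distinct integers within k+d of j, so
    |q_n'(lambda_j)| is at least m! (n-m)! with m the rank of lambda_j among the nodes, and
    x^{lambda_j} / |q_n'(lambda_j)| <= (x + 1/x)^{k+d} (1+x)^n / n! ([wden_term_bound]). With x =
    |z| e^{-v0} the n-th block of the double series is at most a constant times (n+1) (sigma (e^{v0}
    + |z|))^n. As e^{v0} and |z| both lie below 1/(2 tau), sigma can be taken so close to tau that
    the base stays below 1. *)

(** * Splitting off the first coordinate of a vector *)

(** Literally the vector built in the recursion of [cube_int], so that [cube_intS] holds by
    computation. *)
Definition vcons (R : realType) (n : nat) (t : R) (y : 'rV[R]_n) : 'rV[R]_n.+1 :=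
  row_mx (const_mx t : 'rV_1) y.

Lemma vcons0 (R : realType) n (t : R) (y : 'rV[R]_n) : vcons t y 0 ord0 = t.
Proof.
by rewrite /vcons /row_mx mxE; case: (@splitP 1 n _) => [j _|j //]; rewrite mxE.
Qed.

Lemma vconsS (R : realType) n (t : R) (y : 'rV[R]_n) i :
  vcons t y 0 (lift ord0 i) = y 0 i.
Proof.
rewrite /vcons /row_mx mxE; case: (@splitP 1 n _) => [j|j /= /eqP].
  by case: j => -[].
by rewrite /bump /= eqSS => /eqP ij; congr (y 0 _); apply/val_inj.
Qed.

Lemma addZevecE (R : realType) n (s : R) (x : 'rV[R]_n) i j :
  (s *: evec j + x) 0 i = s * (i == j)%:R + x 0 i.
Proof. by rewrite [LHS]mxE [X in X + _]mxE [X in s * X]mxE. Qed.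

Lemma vcons_evec0 (R : realType) n (s t : R) (y : 'rV[R]_n) :
  s *: evec ord0 + vcons t y = vcons (s + t) y.
Proof.
apply/rowP => i; rewrite addZevecE.
case: (unliftP ord0 i) => [j|] ->; last by rewrite !vcons0 eqxx mulr1.
by rewrite !vconsS /= mulr0 add0r.
Qed.

Lemma vcons_evecS (R : realType) n (s t : R) (y : 'rV[R]_n) j :
  s *: evec (lift ord0 j) + vcons t y = vcons t (s *: evec j + y).
Proof.
apply/rowP => i; rewrite addZevecE.
case: (unliftP ord0 i) => [l|] ->; last by rewrite !vcons0 /= mulr0 add0r.
by rewrite !vconsS addZevecE (inj_eq lift_inj).
Qed.

Lemma norm_vcons_lt (R : realType) n (t e : R) (y : 'rV[R]_n) :
  0 < e -> `|t| < e -> `|y| < e -> `|vcons t y| < e.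
Proof.
move=> e0 te; rewrite /Num.norm /= !mx_normrE => ye.
apply/bigmax_ltP; split=> // -[i j] _ /=; rewrite (ord1 i).
case: (unliftP ord0 j) => [l|] ->; last by rewrite vcons0.
rewrite vconsS; move/bigmax_ltP : ye => [_ ye].
by have /= := ye (0, l) isT.
Qed.

Lemma vconsB (R : realType) n (s t : R) (x y : 'rV[R]_n) :
  vcons s x - vcons t y = vcons (s - t) (x - y).
Proof.
apply/rowP => i; rewrite [LHS]mxE [X in _ + X]mxE.
by case: (unliftP ord0 i) => [l|] ->; rewrite ?vcons0 // !vconsS !mxE.
Qed.

Lemma cvg_vcons (R : realType) (n : nat) (I : Type) (F : set_system I) {FF : Filter F}
  (f : I -> R) (g : I -> 'rV[R]_n) t y :
  f @ F --> t -> g @ F --> y -> (fun i => vcons (f i) (g i)) @ F --> vcons t y.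
Proof.
move=> /cvgrPdist_lt ft /cvgrPdist_lt gy; apply/cvgrPdist_lt => e e0.
near=> i; rewrite vconsB; apply: norm_vcons_lt => //; near: i; [exact: ft|exact: gy].
Unshelve. all: by end_near. Qed.

Lemma continuous_vcons (R : realType) n (t : R) (h : 'rV[R]_n.+1 -> R) :
  continuous h -> continuous (fun y => h (vcons t y)).
Proof.
move=> ch y; apply: continuous_comp; last exact: ch.
apply: (@cvg_vcons _ _ _ (nbhs y) _ (cst t) id); first exact: cvg_cst.
exact: cvg_id.
Qed.

(** * One-variable integrals over [-1, 1] *)

Notation II_ R := [set t : R | -1 <= t <= 1].
Notation Rint_ R := (Rintegral (@lebesgue_measure R) (II_ R)).

Lemma II_itv (R : realType) : (II_ R) = `[-1, 1]%classic :> set R.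
Proof. by apply/seteqP; split => x /=; rewrite in_itv. Qed.

Lemma measurable_II (R : realType) : measurable (II_ R : set (measurableTypeR R)).
Proof. rewrite II_itv; exact: measurable_itv. Qed.

Lemma mu_II (R : realType) : (@lebesgue_measure R) (II_ R) = 2%:E.
Proof.
rewrite II_itv lebesgue_measure_itv /= lte_fin ifT; last lra.
by rewrite -EFinB opprK.
Qed.

Lemma integrable_II (R : realType) (U : R -> R) (M : R) :
  measurable_fun (II_ R) U -> (forall t, `|U t| <= M) ->
  (@lebesgue_measure R).-integrable (II_ R) (EFin \o U).
Proof.
move=> mU UM; apply: measurable_bounded_integrable => //.
- exact: measurable_II.
- by rewrite [X in (X < _)%E]mu_II ltry.
- exists M; split; first by rewrite num_real.
  by move=> x Mx y _; apply: le_trans (UM y) (ltW Mx).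
Qed.

Lemma Rint_bound (R : realType) (U : R -> R) (M : R) :
  measurable_fun (II_ R) U -> (forall t, `|U t| <= M) -> `|Rint_ R U| <= M * 2.
Proof.
move=> mU UM; have iU := integrable_II mU UM.
apply: (le_trans (le_normr_Rintegral (@measurable_II R) iU)).
have -> : M * 2 = Rint_ R (cst M : R -> R).
  rewrite Rintegral_cst; last exact: measurable_II.
  by rewrite [X in fine X]mu_II.
apply: le_Rintegral => //; first exact: measurable_II.
- by have := integrable_norm iU.
- by apply: (@integrable_II _ _ `|M|) => [|t]; [exact: measurable_cst|].
Qed.

Lemma Rint_lin (R : realType) (U V : R -> R) (M a b : R) :
  measurable_fun (II_ R) U -> measurable_fun (II_ R) V ->
  (forall t, `|U t| <= M) -> (forall t, `|V t| <= M) ->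
  Rint_ R (fun t => a * U t + b * V t) = a * Rint_ R U + b * Rint_ R V.
Proof.
move=> mU mV UM VM.
have aux c (W : R -> R) : measurable_fun (II_ R) W -> (forall t, `|W t| <= M) ->
    (@lebesgue_measure R).-integrable (II_ R) (EFin \o (fun t => c * W t)).
  move=> mW WM; apply: (@integrable_II _ _ (`|c| * M)) => [|t].
    by apply: measurable_funM => //; exact: measurable_cst.
  by rewrite normrM ler_wpM2l.
rewrite RintegralD; [|exact: measurable_II|exact: aux|exact: aux].
rewrite !RintegralZl //; try exact: measurable_II.
  exact: (integrable_II mV VM).
exact: (integrable_II mU UM).
Qed.

Lemma Rint_dct (R : realType) (U_ : nat -> R -> R) (U : R -> R) (M : R) :
  (forall m, measurable_fun (II_ R) (U_ m)) -> (forall m t, `|U_ m t| <= M) ->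
  (forall t, U_ m t @[m --> \oo] --> U t) ->
  Rint_ R (U_ m) @[m --> \oo] --> Rint_ R U.
Proof.
move=> mU UM cU.
have mUl : measurable_fun (II_ R) U by apply: (measurable_fun_cvg mU) => t _; exact: cU.
have UMl t : `|U t| <= M.
  by apply: (cvgr_to_le (cvg_norm (cU t))); exact: nearW.
have := @dominated_cvg _ _ _ (@lebesgue_measure R) (II_ R) (@measurable_II R)
  (fun m => EFin \o U_ m) (EFin \o U) (cst M%:E).
move=> /(_ _ _ _ _ _) H.
have fl : (\int[@lebesgue_measure R]_(x in (II_ R)) (U x)%:E)%E \is a fin_num.
  by apply: integrable_fin_num; [exact: measurable_II|exact: integrable_II mUl UMl].
rewrite /Rintegral; apply: fine_cvg; rewrite fineK //; apply: H => //.
- by move=> m; apply/measurable_EFinP; exact: mU.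
- by move=> x _; apply: cvg_EFin; [apply: nearW|exact: cU].
- by apply: (@integrable_II _ (cst M) `|M|) => [|t]; [exact: measurable_cst|].
- by move=> m x _; rewrite lee_fin.
Unshelve. all: by end_near. Qed.

(** * Iterated integrals over the cube *)

(** Measurability is asked slice by slice rather than jointly: this is exactly what an iterated
    integral consumes, it holds for bounded continuous functions, and it survives bounded pointwise
    limits. *)
Fixpoint meas_cube (R : realType) (n : nat) : ('rV[R]_n -> R) -> Prop :=
  match n as n0 return ('rV[R]_n0 -> R) -> Prop with
  | 0 => fun _ => True
  | n'.+1 => fun h => (forall t, meas_cube (fun y => h (vcons t y))) /\
      measurable_fun (II_ R) (fun t => cube_int (fun y => h (vcons t y)))
  end.

Definition bnd_by (R : realType) (T : Type) (M : R) (h : T -> R) := forall x, `|h x| <= M.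

Lemma cube_intS (R : realType) n (h : 'rV[R]_n.+1 -> R) :
  cube_int h = Rint_ R (fun t => cube_int (fun y => h (vcons t y))).
Proof. by []. Qed.

Lemma cube_int_bound (R : realType) n (h : 'rV[R]_n -> R) (M : R) :
  meas_cube h -> bnd_by M h -> `|cube_int h| <= M * 2 ^+ n.
Proof.
elim: n h M => [|n IH] h M mh hM; first by rewrite mulr1; exact: hM.
case: mh => mh1 mh2; rewrite cube_intS exprS mulrCA [2 * _]mulrC.
by apply: Rint_bound => // t; exact: (IH _ _ (mh1 t) (fun y => hM (vcons t y))).
Qed.

Lemma cube_int_lin (R : realType) n (f g : 'rV[R]_n -> R) (a b M : R) :
  meas_cube f -> meas_cube g -> bnd_by M f -> bnd_by M g ->
  meas_cube (fun x => a * f x + b * g x) /\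
  cube_int (fun x => a * f x + b * g x) = a * cube_int f + b * cube_int g.
Proof.
elim: n f g => [|n IH] f g mf mg fM gM //.
case: mf mg => mf1 mf2 [mg1 mg2].
have H t := IH _ _ (mf1 t) (mg1 t) (fun y => fM (vcons t y)) (fun y => gM (vcons t y)).
have E : (fun t => cube_int (fun y => a * f (vcons t y) + b * g (vcons t y))) =
    (fun t => a * cube_int (fun y => f (vcons t y)) + b * cube_int (fun y => g (vcons t y))).
  by apply/funext => t; have [_ ->] := H t.
split.
  split; first by move=> t; have [] := H t.
  rewrite E; apply: measurable_funD; apply: measurable_funM => //; exact: measurable_cst.
rewrite !cube_intS E (@Rint_lin _ _ _ (M * 2 ^+ n)) // => t.
  exact: (cube_int_bound (mf1 t) (fun y => fM (vcons t y))).
exact: (cube_int_bound (mg1 t) (fun y => gM (vcons t y))).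
Qed.

(** Dominated convergence, by induction on the dimension: on each slice the inner integrals
    converge, they are bounded by M 2^n, and the one-variable theorem finishes. Measurability of the
    limit belongs to the conclusion because the induction needs it for the inner integrals. *)
Lemma cube_int_dct (R : realType) n (f_ : nat -> 'rV[R]_n -> R) (f : 'rV[R]_n -> R) (M : R) :
  (forall m, meas_cube (f_ m)) -> (forall m, bnd_by M (f_ m)) ->
  (forall x, f_ m x @[m --> \oo] --> f x) ->
  meas_cube f /\ cube_int (f_ m) @[m --> \oo] --> cube_int f.
Proof.
elim: n f_ f => [|n IH] f_ f mf fM cf; first by split=> //; exact: cf.
have H t := IH _ _ (fun m => (mf m).1 t) (fun m y => fM m (vcons t y)) (fun y => cf (vcons t y)).
split.
  split; first by move=> t; have [] := H t.
  apply: (measurable_fun_cvg (fun m => (mf m).2)) => t _.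
  by have [_] := H t.
rewrite cube_intS; apply: (@Rint_dct _ _ _ (M * 2 ^+ n)).
- by move=> m; exact: (mf m).2.
- by move=> m t; exact: (cube_int_bound ((mf m).1 t) (fun y => fM m (vcons t y))).
- by move=> t; have [_] := H t.
Qed.

(** Reduces continuity to sequences, the form in which dominated convergence is available. *)
Lemma continuous_seqP (R : realType) (f : R -> R) :
  (forall t (u : nat -> R), u @ \oo --> t -> f (u m) @[m --> \oo] --> f t) -> continuous f.
Proof.
by move=> H t; apply/continuous_withinNx/cvgr_dnbhsP => u [_ ut]; exact: H.
Qed.

Lemma cvg_vconsl (R : realType) n (h : 'rV[R]_n.+1 -> R) (u : nat -> R) t y :
  continuous h -> u @ \oo --> t -> h (vcons (u m) y) @[m --> \oo] --> h (vcons t y).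
Proof.
move=> ch ut; apply: (cvg_comp (fun m => vcons (u m) y) h _ (ch _)).
exact: (@cvg_vcons _ _ _ \oo _ u (cst y) t y ut (cvg_cst _)).
Qed.

Lemma continuous_meas_cube (R : realType) n (h : 'rV[R]_n -> R) (M : R) :
  continuous h -> bnd_by M h -> meas_cube h.
Proof.
elim: n h => [|n IH] h ch hM //.
have mh t : meas_cube (fun y => h (vcons t y)).
  by apply: IH; [exact: continuous_vcons|move=> y; exact: hM].
split=> //.
apply: measurable_funTS; apply: continuous_measurable_fun.
apply: continuous_seqP => t u ut.
apply: (proj2 (@cube_int_dct _ _ (fun m y => h (vcons (u m) y)) _ M _ _ _)) => //.
- by move=> m y; exact: hM.
- by move=> y; exact: cvg_vconsl.
Qed.

Lemma continuous_cube_int_vcons (R : realType) n (h : 'rV[R]_n.+1 -> R) (M : R) :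
  continuous h -> bnd_by M h -> continuous (fun t => cube_int (fun y => h (vcons t y))).
Proof.
move=> ch hM; apply: continuous_seqP => t u ut.
have mh s : meas_cube (fun y => h (vcons s y)).
  by apply: (@continuous_meas_cube _ _ _ M); [exact: continuous_vcons|move=> y; exact: hM].
apply: (proj2 (@cube_int_dct _ _ (fun m y => h (vcons (u m) y)) _ M _ _ _)) => //.
- by move=> m y; exact: hM.
- by move=> y; exact: cvg_vconsl.
Qed.

(** * Derivatives and cube integrals *)

Lemma lip_of_deriv (R : realType) (f f' : R -> R) (a b M : R) :
  (forall x, Num.min a b <= x <= Num.max a b -> is_derive x 1 f (f' x)) ->
  (forall x, Num.min a b <= x <= Num.max a b -> `|f' x| <= M) ->
  `|f b - f a| <= M * `|b - a|.
Proof.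
wlog ab : a b / a <= b => [H|].
  have /orP[/H//|ba df fM] := le_total a b.
  rewrite (distrC (f b)) (distrC b); apply: (H b a ba) => x; rewrite minC maxC.
    exact: df.
  exact: fM.
rewrite min_l // max_r // => df fM.
have [||c cab ->] := @MVT_segment R f f' a b ab.
- by move=> x; rewrite in_itv /= => /andP[ax xb]; apply: df; rewrite !ltW.
- apply: derivable_within_continuous => x; rewrite in_itv /= => xab.
  by have [] := df x xab.
- rewrite normrM ler_wpM2r //; apply: fM; by rewrite in_itv /= in cab.
Qed.

Lemma cvg_is_derive (R : realType) (f : R -> R) (t d : R) :
  (h^-1 *: (f (h + t) - f t)) @[h --> 0^'] --> d -> is_derive t 1 f d.
Proof.
move=> H.
have E : (fun h : R => h^-1 *: ((f \o shift t) (h *: 1) - f t)) =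
         (fun h : R => h^-1 *: (f (h + t) - f t)).
  by apply/funext => h /=; rewrite /GRing.scale /= mulr1.
by apply: DeriveDef; rewrite /derivable /derive E; [apply/cvg_ex; exists d|exact: cvg_lim].
Qed.

Lemma is_derive_cvg (R : realType) (f : R -> R) (t d : R) :
  is_derive t 1 f d -> (h^-1 *: (f (h + t) - f t)) @[h --> 0^'] --> d.
Proof.
move=> [df <-]; move: df; rewrite /derivable /derive.
suff -> : (fun h : R => h^-1 *: ((f \o shift t) (h *: 1) - f t)) =
         (fun h : R => h^-1 *: (f (h + t) - f t)) by [].
by apply/funext => h /=; rewrite /GRing.scale /= mulr1.
Qed.

(** Difference quotients along any sequence tending to 0 are bounded by M, by the mean value
    inequality, so dominated convergence passes to the limit under the integral. *)
Lemma is_derive_cube_int (R : realType) n (g g' : R -> 'rV[R]_n -> R) (t delta M : R) :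
  0 < delta -> (forall s, meas_cube (g s)) -> (forall s, exists Ms, bnd_by Ms (g s)) ->
  (forall s y, `|s - t| < delta -> is_derive s 1 (g ^~ y) (g' s y)) ->
  (forall s, `|s - t| < delta -> bnd_by M (g' s)) ->
  is_derive t 1 (fun s => cube_int (g s)) (cube_int (g' t)).
Proof.
move=> d0 mg gb dg g'M; apply: cvg_is_derive; apply/cvgr_dnbhsP => u [u0 ucv].
have [N _ HN] : \forall m \near \oo, `|u m| < delta.
  by move/cvgrPdist_lt : ucv => /(_ _ d0); under eq_near do rewrite sub0r normrN.
(* The sequence is shifted so that every increment, not only those far out, lies within delta. *)
pose v m := u (m + N)%N.
have vd m : `|v m| < delta by apply: HN => /=; rewrite leq_addl.
have v0 m : v m != 0 by exact: u0.
have vcv : v @ \oo --> (0 : R).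
  by rewrite -(cvg_shiftn N) in ucv.
pose q m y := (v m)^-1 * g (v m + t) y + (- (v m)^-1) * g t y.
have qE m : (v m)^-1 *: (cube_int (g (v m + t)) - cube_int (g t)) = cube_int (q m) /\ meas_cube (q m).
  have [M1 H1] := gb (v m + t); have [M2 H2] := gb t.
  have [] := @cube_int_lin R n (g (v m + t)) (g t) (v m)^-1 (- (v m)^-1) (Num.max M1 M2).
  - exact: mg.
  - exact: mg.
  - by move=> y; rewrite le_max H1.
  - by move=> y; rewrite le_max H2 orbT.
  by move=> mq ->; split=> //; rewrite /GRing.scale /= mulrBr mulNr.
rewrite -(cvg_shiftn N) /=.
under eq_fun do rewrite (qE _).1.
apply: (proj2 (@cube_int_dct _ _ q _ M _ _ _)).
- by move=> m; exact: (qE m).2.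
- move=> m y; rewrite /q mulNr -mulrBr normrM normfV ler_pdivrMl ?normr_gt0 // mulrC.
  have -> : `|v m| = `|v m + t - t| by rewrite addrK.
  have H x : Num.min t (v m + t) <= x <= Num.max t (v m + t) -> `|x - t| < delta.
    have := vd m; rewrite ltr_norml => /andP[? ?].
    rewrite ge_min le_max => /andP[/orP[?|?] /orP[?|?]]; rewrite ltr_norml; apply/andP; split; lra.
  apply: (@lip_of_deriv R (g ^~ y) (g' ^~ y)) => x /H xd; first exact: dg.
  exact: g'M.
- move=> y; have := is_derive_cvg (dg t y _); rewrite subrr normr0 => /(_ d0).
  move/cvgr_dnbhsP => /(_ v); move=> /(_ (conj v0 vcv)) H.
  by under eq_fun do rewrite /q mulNr -mulrBr.
Qed.

Lemma cube_int_cst0 (R : realType) n : cube_int (fun _ : 'rV[R]_n => 0) = 0.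
Proof.
elim: n => [//|n IH]; rewrite cube_intS IH.
by rewrite Rintegral_cst ?mul0r //; exact: measurable_II.
Qed.

Lemma Rint_FTC (R : realType) (U U' : R -> R) :
  (forall t : R, is_derive t 1 U (U' t)) -> continuous U' -> Rint_ R U' = U 1 - U (-1).
Proof.
move=> dU cU'; rewrite /Rintegral II_itv.
have cU : continuous U.
  by move=> t; apply: differentiable_continuous; apply/derivable1_diffP; have [] := dU t.
have lt11 : (-1 : R) < 1 by lra.
rewrite (@continuous_FTC2 R U' U _ _ lt11) //.
- exact: continuous_subspaceT.
- split; first by move=> t _; have [] := dU t.
  + by apply: cvg_at_right_filter; exact: cU.
  + by apply: cvg_at_left_filter; exact: cU.
- by move=> t _; rewrite derive1E; have [_ ->] := dU t.
Qed.

(** Induction on the dimension. When j is a later coordinate, each inner integral already vanishes;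
    when j is the first one, differentiation under the integral and the fundamental theorem leave
    boundary values at 1 and -1, where G is zero. *)
Lemma cube_int_deriv (R : realType) n (G : 'rV[R]_n -> R) (j : 'I_n) (M : R) :
  continuous G -> bnd_by M G -> (forall x, derivable G x (evec j)) ->
  continuous (fun x => 'D_(evec j) G x) -> bnd_by M (fun x => 'D_(evec j) G x) ->
  (forall x : 'rV[R]_n, 1 <= `|x 0 j| -> G x = 0) ->
  cube_int (fun x => 'D_(evec j) G x) = 0.
Proof.
elim: n G j => [G [] //|n IH] G j cG GM dG cDG DGM G0.
rewrite cube_intS.
case: (unliftP ord0 j) => [l|] jE; rewrite jE in dG cDG DGM G0 *.
  have sE t y : (fun h : R => h^-1 *: ((G \o shift (vcons t y)) (h *: evec (lift ord0 l)) - G (vcons t y)))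
      = (fun h : R => h^-1 *: (((fun y => G (vcons t y)) \o shift y) (h *: evec l) - G (vcons t y))).
    by apply/funext => h /=; rewrite vcons_evecS.
  have E t : (fun y => 'D_(evec (lift ord0 l)) G (vcons t y)) =
             (fun y => 'D_(evec l) (fun y => G (vcons t y)) y).
    by apply/funext => y; rewrite /derive sE.
  under eq_Rintegral => t _.
    rewrite E IH; first over.
    - exact: continuous_vcons.
    - by move=> y; exact: GM.
    - by move=> y; have := dG (vcons t y); rewrite /derivable sE.
    - by rewrite -E; exact: (@continuous_vcons R n t (fun x => 'D_(evec (lift ord0 l)) G x) cDG).
    - by move=> y; have := DGM (vcons t y); rewrite (congr1 (fun f => f y) (E t)).
    - by move=> y Hy; apply: G0; rewrite vconsS.
  by rewrite Rintegral_cst ?mul0r //; exact: measurable_II.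
(* The derivative is in the outermost variable: the inner integral is a primitive. *)
pose U t := cube_int (fun y => G (vcons t y)).
have dU (t : R) : is_derive t 1 U (cube_int (fun y => 'D_(evec ord0) G (vcons t y))).
  apply: (@is_derive_cube_int _ _ (fun s y => G (vcons s y))
    (fun s y => 'D_(evec ord0) G (vcons s y)) t 1 M) => //.
  + by move=> s; apply: (@continuous_meas_cube _ _ _ M); [exact: continuous_vcons|move=> y; exact: GM].
  + by move=> s; exists M => y; exact: GM.
  + move=> s y _; have := dG (vcons s y); rewrite /derivable /derive => H.
    apply: cvg_is_derive; suff <- : (fun h : R => h^-1 *: ((G \o shift (vcons s y)) (h *: evec ord0) - G (vcons s y)))
      = (fun h : R => h^-1 *: (G (vcons (h + s) y) - G (vcons s y))) by [].
    by apply/funext => h /=; rewrite vcons_evec0.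
  + by move=> s _ y; exact: DGM.
rewrite (Rint_FTC dU); last exact: (@continuous_cube_int_vcons _ _ (fun x => 'D_(evec ord0) G x) M).
rewrite /U; have H s : `|s| = 1 -> cube_int (fun y => G (vcons s y)) = 0.
  move=> s1; rewrite -[RHS](cube_int_cst0 R n); congr cube_int; apply/funext => y.
  by apply: G0; rewrite vcons0 s1.
by rewrite !H ?subrr // ?normrN normr1.
Qed.

(** * Calculus of explicit gradients *)

(** Differentiability comes bundled with the values of the partial derivatives, so that sums,
    products and compositions yield their gradients by rewriting. *)
Definition has_grad (R : realType) n (f : 'rV[R]_n -> R) (x : 'rV[R]_n) (g : 'I_n -> R) :=
  differentiable f x /\ forall l, 'D_(evec l) f x = g l.

Lemma row_sum_evec (R : realType) n (v : 'rV[R]_n) : v = \sum_l v 0 l *: evec l.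
Proof. by rewrite [LHS]row_sum_delta. Qed.

Lemma has_grad_dir (R : realType) n (f : 'rV[R]_n -> R) x g v :
  has_grad f x g -> 'D_v f x = \sum_l v 0 l * g l.
Proof.
move=> [df fg]; rewrite deriveE // {1}(row_sum_evec v) linear_sum.
by apply: eq_bigr => l _; rewrite linearZ -fg deriveE.
Qed.

Lemma has_grad_derivable (R : realType) n (f : 'rV[R]_n -> R) x g v :
  has_grad f x g -> derivable f x v.
Proof. by move=> [df _]; exact: diff_derivable. Qed.

Lemma has_grad_continuous (R : realType) n (f : 'rV[R]_n -> R) x g :
  has_grad f x g -> {for x, continuous f}.
Proof. by move=> [df _]; exact: differentiable_continuous. Qed.

Lemma has_grad_cst (R : realType) n (x : 'rV[R]_n) (c : R) : has_grad (fun=> c) x (fun=> 0).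
Proof. by split=> [|l]; [exact: differentiable_cst|exact: derive_cst]. Qed.

Lemma has_grad_coord (R : realType) n (x : 'rV[R]_n) i :
  has_grad (fun y : 'rV[R]_n => y 0 i) x (fun l => (l == i)%:R).
Proof.
split=> [|l]; first exact: differentiable_coord.
apply/cvg_lim => //; apply/cvgrPdist_lt => e e0.
have : \forall h \near (0 : R)^', h != 0 by exact: nbhs_dnbhs_neq.
apply: filterS => h h0.
rewrite /= addZevecE addrK /GRing.scale /= mulrA mulVf // mul1r eq_sym subrr normr0 //.
Qed.

Lemma has_gradD (R : realType) n (f h : 'rV[R]_n -> R) x g k :
  has_grad f x g -> has_grad h x k -> has_grad (fun y => f y + h y) x (fun l => g l + k l).
Proof.
move=> [df fg] [dh hk]; split=> [|l]; first exact: differentiableD.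
by rewrite -fg -hk deriveD //; exact: diff_derivable.
Qed.

Lemma has_gradM (R : realType) n (f h : 'rV[R]_n -> R) x g k :
  has_grad f x g -> has_grad h x k ->
  has_grad (fun y => f y * h y) x (fun l => f x * k l + h x * g l).
Proof.
move=> [df fg] [dh hk]; split=> [|l]; first exact: differentiableM.
by rewrite -fg -hk deriveM //; exact: diff_derivable.
Qed.

Lemma eq_has_grad (R : realType) n (f h : 'rV[R]_n -> R) x g k :
  has_grad f x g -> f =1 h -> g =1 k -> has_grad h x k.
Proof. by move=> H /funext <- /funext <-. Qed.

Lemma has_gradN (R : realType) n (f : 'rV[R]_n -> R) x g :
  has_grad f x g -> has_grad (fun y => - f y) x (fun l => - g l).
Proof.
move=> H; apply: (eq_has_grad (has_gradM (has_grad_cst x (-1)) H)) => y; first by rewrite mulN1r.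
by rewrite mulN1r mulr0 addr0.
Qed.

Lemma has_grad_sum (R : realType) n (I : Type) (s : seq I) (f : I -> 'rV[R]_n -> R) x g :
  (forall i, has_grad (f i) x (g i)) ->
  has_grad (fun y => \sum_(i <- s) f i y) x (fun l => \sum_(i <- s) g i l).
Proof.
move=> H; elim: s => [|i s IH].
  by apply: (eq_has_grad (has_grad_cst x 0)) => y; rewrite big_nil.
by apply: (eq_has_grad (has_gradD (H i) IH)) => y; rewrite big_cons.
Qed.

Lemma has_grad_comp1 (R : realType) n (f : 'rV[R]_n -> R) (phi : R -> R) x g (c : R) :
  has_grad f x g -> is_derive (f x) 1 phi c -> has_grad (fun y => phi (f y)) x (fun l => c * g l).
Proof.
move=> [df fg] [dphi phic].
have dp : differentiable phi (f x) by apply/derivable1_diffP.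
have dc : differentiable (phi \o f) x by exact: differentiable_comp.
split=> // l.
rewrite deriveE // diff_comp //= -(deriveE (evec l) df) fg.
have -> : g l = g l *: (1 : R) by rewrite /GRing.scale /= mulr1.
by rewrite linearZ /= -deriveE // phic /GRing.scale /= mulr1 mulrC.
Qed.

(** * Euclidean norm and radial projection *)

Definition sqn (R : realType) n (x : 'rV[R]_n) : R := \sum_(i < n) x 0 i ^+ 2.

Lemma sqn_ge0 (R : realType) n (x : 'rV[R]_n) : 0 <= sqn x.
Proof. by apply: sumr_ge0 => i _; exact: sqr_ge0. Qed.

Lemma coord_sqn (R : realType) n (x : 'rV[R]_n) i : x 0 i ^+ 2 <= sqn x.
Proof.
rewrite /sqn (bigD1 i) //= lerDl; apply: sumr_ge0 => j _; exact: sqr_ge0.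
Qed.

Lemma sqn_eq0 (R : realType) n (x : 'rV[R]_n) : (sqn x == 0) = (x == 0).
Proof.
apply/idP/eqP => [/eqP H|->]; last by rewrite /sqn big1 // => i _; rewrite mxE expr0n.
apply/rowP => i; rewrite mxE; apply/eqP; rewrite -sqrf_eq0 -[_ == _]andTb.
by rewrite eq_le sqr_ge0 andbT -H coord_sqn.
Qed.

Lemma sqnZ (R : realType) n (x : 'rV[R]_n) a : sqn (a *: x) = a ^+ 2 * sqn x.
Proof. by rewrite /sqn mulr_sumr; apply: eq_bigr => i _; rewrite mxE exprMn. Qed.

Lemma sqn_gt0 (R : realType) n (x : 'rV[R]_n) : (0 < sqn x) = (x != 0).
Proof. by rewrite lt_def sqn_ge0 andbT sqn_eq0. Qed.

Lemma has_grad_sqn (R : realType) n (x : 'rV[R]_n) :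
  has_grad (@sqn R n) x (fun l => 2 * x 0 l).
Proof.
have H i := has_gradM (has_grad_coord x i) (has_grad_coord x i).
apply: (eq_has_grad (has_grad_sum (index_enum 'I_n) H)) => y.
  by apply: eq_bigr => i _; rewrite expr2.
rewrite (bigD1 y) //= eqxx mulr1 big1 ?addr0 ?mulr2n ?mulrDl ?mul1r //.
by move=> i iy; rewrite eq_sym (negPf iy) mulr0 addr0.
Qed.

Lemma continuous_sqn (R : realType) n : continuous (@sqn R n).
Proof. by move=> x; exact: has_grad_continuous (has_grad_sqn x). Qed.

Lemma enormE (R : realType) n (x : 'rV[R]_n) : enorm x = Num.sqrt (sqn x).
Proof. by []. Qed.

Lemma enorm_ge0 (R : realType) n (x : 'rV[R]_n) : 0 <= enorm x.
Proof. exact: sqrtr_ge0. Qed.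

Lemma enorm_gt0 (R : realType) n (x : 'rV[R]_n) : (0 < enorm x) = (x != 0).
Proof. by rewrite enormE sqrtr_gt0 sqn_gt0. Qed.

Lemma enorm_sqr (R : realType) n (x : 'rV[R]_n) : enorm x ^+ 2 = sqn x.
Proof. by rewrite sqr_sqrtr // sqn_ge0. Qed.

Lemma enormZ (R : realType) n (x : 'rV[R]_n) a : enorm (a *: x) = `|a| * enorm x.
Proof. by rewrite !enormE sqnZ sqrtrM ?sqr_ge0 // sqrtr_sqr. Qed.

Lemma continuous_enorm (R : realType) n : continuous (@enorm R n).
Proof.
move=> x; apply: (@continuous_comp _ _ _ (@sqn R n) Num.sqrt); first exact: continuous_sqn.
exact: sqrt_continuous.
Qed.

Definition sproj (R : realType) n (x : 'rV[R]_n) : 'rV[R]_n := (enorm x)^-1 *: x.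

Lemma enorm_sproj (R : realType) n (x : 'rV[R]_n) : x != 0 -> enorm (sproj x) = 1.
Proof.
rewrite -enorm_gt0 => x0; rewrite enormZ ger0_norm ?mulVf ?gt_eqF //.
by rewrite invr_ge0 ltW.
Qed.

Lemma sproj_id (R : realType) n (x : 'rV[R]_n) : enorm x = 1 -> sproj x = x.
Proof. by rewrite /sproj => ->; rewrite invr1 scale1r. Qed.

Lemma nbhs_neq0 (R : realType) n (x : 'rV[R]_n) : x != 0 -> \forall y \near x, y != 0.
Proof.
rewrite -enorm_gt0 => x0.
have : \forall y \near x, 0 < enorm y.
  by apply: (cvgr_gt _ (@continuous_enorm R n x)).
by apply: filterS => y; rewrite enorm_gt0.
Qed.

Lemma is_derive_invsqrt (R : realType) (s : R) : 0 < s ->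
  is_derive s 1 (fun s => (Num.sqrt s)^-1) (- (2 * Num.sqrt s ^+ 3)^-1).
Proof.
move=> s0; have s0' : 0 < Num.sqrt s by rewrite sqrtr_gt0.
apply: (is_derive_eq (@is_deriveV R Num.sqrt s _ 1 (lt0r_neq0 s0') (is_derive1_sqrt s0))).
by rewrite /GRing.scale /=; field; exact: lt0r_neq0.
Qed.

Lemma has_grad_invnorm (R : realType) n (x : 'rV[R]_n) : x != 0 ->
  has_grad (fun y : 'rV[R]_n => (enorm y)^-1) x (fun l => - (x 0 l / enorm x ^+ 3)).
Proof.
move=> x0; have s0 : 0 < sqn x by rewrite sqn_gt0.
apply: (eq_has_grad (has_grad_comp1 (has_grad_sqn x) (is_derive_invsqrt s0))) => // l.
rewrite -enormE; have : enorm x != 0 by rewrite gt_eqF // enorm_gt0.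
by move=> ?; field.
Qed.

Lemma has_grad_chain (R : realType) m n (P : 'rV[R]_m -> 'rV[R]_n) (H : 'rV[R]_n -> R) x
    (J : 'I_n -> 'I_m -> R) g :
  (forall i, has_grad (fun y => P y 0 i) x (J i)) -> has_grad H (P x) g ->
  has_grad (fun y => H (P y)) x (fun l => \sum_i J i l * g i).
Proof.
move=> HJ HH.
have dP : differentiable P x.
  have -> : P = (fun y => \sum_i P y 0 i *: evec i) by apply/funext => y; exact: row_sum_evec.
  have -> : (fun y => \sum_i P y 0 i *: evec i) = \sum_i (fun y => P y 0 i *: evec i).
    by apply/funext => y; rewrite fct_sumE.
  by apply: differentiable_sum => i; apply: differentiableZl; have [] := HJ i.
have [dH _] := HH.
split=> [|l]; first exact: differentiable_comp.
have dc : differentiable (H \o P) x by exact: differentiable_comp.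
rewrite deriveE // diff_comp //= -(deriveE _ dH) (has_grad_dir _ HH).
apply: eq_bigr => i _; congr (_ * _).
have [dPi <-] := HJ i; rewrite deriveE //.
have -> : (fun y => P y 0 i) = (fun N : 'rV[R]_n => N 0 i) \o P by [].
have dC : differentiable (fun N : 'rV[R]_n => N 0 i) (P x) by exact: differentiable_coord.
rewrite (diff_comp dP dC) /= -(deriveE _ dC).
rewrite (has_grad_dir _ (has_grad_coord _ i)) (bigD1 i) //= eqxx mulr1.
by rewrite big1 ?addr0 // => a ai; rewrite (negPf ai) mulr0.
Qed.

(** The Jacobian of x/|x| is |x|^{-1} (Id - x x^T / |x|^2). The second term is a multiple of x,
    hence disappears under the rotation fields x_i d_j - x_j d_i. *)
Lemma has_grad_sproj (R : realType) n (H : 'rV[R]_n -> R) (x : 'rV[R]_n) g : x != 0 ->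
  has_grad H (sproj x) g ->
  has_grad (fun y => H (sproj y)) x
    (fun l => (enorm x)^-1 * g l - x 0 l / enorm x ^+ 3 * \sum_i x 0 i * g i).
Proof.
move=> x0 HH.
have HJ i : has_grad (fun y => (sproj y) 0 i) x
    (fun l => (enorm x)^-1 * (l == i)%:R + x 0 i * - (x 0 l / enorm x ^+ 3)).
  apply: (eq_has_grad (has_gradM (has_grad_invnorm x0) (has_grad_coord x i))) => // y.
  by rewrite mxE.
apply: (eq_has_grad (has_grad_chain HJ HH)) => // l.
rewrite (eq_bigr (fun i => (enorm x)^-1 * ((l == i)%:R * g i) - x 0 l / enorm x ^+ 3 * (x 0 i * g i))).
  rewrite sumrB -!mulr_sumr; congr (_ * _ - _).
  by rewrite (bigD1 l) //= eqxx mul1r big1 ?addr0 // => i il; rewrite eq_sym (negPf il) mul0r.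
by move=> i _; ring.
Qed.

(** * Continuity and compactness on the sphere *)

Lemma contM (R : realType) (T : topologicalType) (f g : T -> R) x :
  {for x, continuous f} -> {for x, continuous g} -> {for x, continuous (fun y => f y * g y)}.
Proof. by move=> cf cg; apply: cvgM; [exact: cf|exact: cg]. Qed.

Lemma contD (R : realType) (T : topologicalType) (f g : T -> R) x :
  {for x, continuous f} -> {for x, continuous g} -> {for x, continuous (fun y => f y + g y)}.
Proof. by move=> cf cg; apply: cvgD; [exact: cf|exact: cg]. Qed.

Lemma contN (R : realType) (T : topologicalType) (f : T -> R) x :
  {for x, continuous f} -> {for x, continuous (fun y => - f y)}.
Proof. by move=> cf; apply: cvgN; exact: cf. Qed.

Lemma contc (R : realType) (T : topologicalType) (c : R) (x : T) : {for x, continuous (fun=> c : R)}.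
Proof. exact: cst_continuous. Qed.

Lemma cont_sum (R : realType) (T : topologicalType) (I : Type) (s : seq I) (f : I -> T -> R) x :
  (forall i, {for x, continuous (f i)}) -> {for x, continuous (fun y => \sum_(i <- s) f i y)}.
Proof.
move=> H; elim: s => [|i s IH].
  have -> : (fun y => \sum_(i <- [::]) f i y) = (fun=> 0) by apply/funext => y; rewrite big_nil.
  exact: contc.
have -> : (fun y => \sum_(i <- i :: s) f i y) = (fun y => f i y + \sum_(i <- s) f i y).
  by apply/funext => y; rewrite big_cons.
exact: contD.
Qed.

Lemma sphere_compact (R : realType) n : compact [set x : 'rV[R]_n | enorm x = 1].
Proof.
apply: (@subclosed_compact _ _ [set x : 'rV[R]_n | forall i, `[-1, 1]%classic (x 0 i)]).
- have -> : [set x : 'rV[R]_n | enorm x = 1] = @enorm R n @^-1` [set 1] by [].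
  apply: closed_comp; last exact: closed_eq.
  by move=> x _; exact: continuous_enorm.
- exact: (@rV_compact R n (fun=> `[-1, 1]%classic) (fun=> @segment_compact R (-1) 1)).
- move=> x /= x1 i; rewrite in_itv /= -ler_norml -(@expr_le1 _ 2) //.
  by rewrite real_normK ?num_real //; apply: (le_trans (coord_sqn x i)); rewrite -enorm_sqr x1 expr1n.
Qed.

Lemma compact_fun_bounded (R : realType) (T : topologicalType) (K : set T) (f : T -> R) :
  compact K -> (forall x, K x -> {for x, continuous f}) ->
  exists M, 0 <= M /\ forall x, K x -> `|f x| <= M.
Proof.
move=> cK cf.
have : compact (f @` K).
  apply: continuous_compact => //; apply: continuous_in_subspaceT => x; rewrite inE.
  exact: cf.
move=> /compact_bounded [M [_ HM]].
exists (`|M| + 1); split; first by rewrite addr_ge0.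
move=> x Kx; apply: (HM (`|M| + 1)); last by exists x.
by apply: (le_lt_trans (ler_norm M)); rewrite ltrDl.
Qed.

(** Continuity is in the ambient space at the points of the sphere, not continuity of the
    restriction; this makes composition with [sproj] immediate. *)
Definition sphC (R : realType) n (H : 'rV[R]_n -> R) :=
  forall th, enorm th = 1 -> {for th, continuous H}.

Definition sph_bnd (R : realType) n (M : R) (H : 'rV[R]_n -> R) :=
  forall th, enorm th = 1 -> `|H th| <= M.

Lemma sphC_bnd (R : realType) n (H : 'rV[R]_n -> R) : sphC H -> exists M, 0 <= M /\ sph_bnd M H.
Proof. by move=> cH; apply: compact_fun_bounded; [exact: sphere_compact|]. Qed.

Lemma continuous_sproj (R : realType) n (x : 'rV[R]_n) : x != 0 -> {for x, continuous (@sproj R n)}.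
Proof.
move=> x0; have c1 := has_grad_continuous (has_grad_invnorm x0).
exact: (@cvgZ _ _ _ (nbhs x) _ (fun y : 'rV[R]_n => (enorm y)^-1) id _ _ c1 cvg_id).
Qed.

Lemma sphC_sproj (R : realType) n (H : 'rV[R]_n -> R) (x : 'rV[R]_n) :
  sphC H -> x != 0 -> {for x, continuous (fun y => H (sproj y))}.
Proof.
move=> cH x0; apply: (@continuous_comp _ _ _ (@sproj R n) H); first exact: continuous_sproj.
by apply: cH; rewrite enorm_sproj.
Qed.

(** * A radial cutoff of class C^1 *)

Definition posp (R : realType) (u : R) : R := Num.max 0 u ^+ 2.

Lemma posp_ge0 (R : realType) (u : R) : 0 <= posp u.
Proof. exact: sqr_ge0. Qed.

Lemma posp0 (R : realType) (u : R) : u <= 0 -> posp u = 0.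
Proof. by move=> u0; rewrite /posp max_l // expr0n. Qed.

Lemma is_derive_posp (R : realType) (u : R) : is_derive u 1 (@posp R) (2 * Num.max 0 u).
Proof.
have [u0|u0|<-] := ltrgtP 0 u.
- have H : is_derive u 1 (fun x : R => x ^+ 2) (2 * u).
    by apply: (is_derive_eq (is_deriveX 2 (is_derive_id u 1))); rewrite /GRing.scale /= expr1 mulr1.
  apply: near_eq_is_derive H.
  by near=> x; rewrite /posp max_r //; apply: ltW; near: x; exact: lt_nbhsr.
- rewrite mulr0; apply: near_eq_is_derive (is_derive_cst (0 : R) u 1).
  by near=> x; rewrite posp0 //; apply: ltW; near: x; exact: lt_nbhsl.
- rewrite mulr0; apply: cvg_is_derive; apply/cvgrPdist_lt => e e0.
  near=> h; rewrite (posp0 (lexx 0)) addr0 subr0 sub0r normrN /GRing.scale /= normrM normfV.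
  have h0 : h != 0 by near: h; exact: nbhs_dnbhs_neq.
  rewrite ltr_pdivrMl ?normr_gt0 // /posp normrX.
  have : `|Num.max 0 h| <= `|h|.
    by have [hp|hn] := leP 0 h; rewrite ?normr0.
  have he : `|h| < e.
    near: h; apply: dnbhs0_lt; exact: e0.
  have hp : 0 < `|h| by rewrite normr_gt0.
  have := normr_ge0 (Num.max 0 h); nra.
Unshelve. all: by end_near. Qed.

(** A C^1 step: zero for u <= 0, values in [0, 1], tending to 1 at infinity. *)
Definition cutk (R : realType) (u : R) : R := posp u / (1 + posp u).

Lemma is_derive_cutk (R : realType) (u : R) :
  is_derive u 1 (@cutk R) (2 * Num.max 0 u / (1 + posp u) ^+ 2).
Proof.
have p1 : 1 + posp u != 0 by rewrite gt_eqF // ltr_wpDr // posp_ge0.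
have H1 : is_derive u 1 (fun v : R => 1 + posp v) (0 + 2 * Num.max 0 u).
  exact: (is_deriveD (is_derive_cst (1 : R) u 1) (is_derive_posp u)).
have H2 := @is_deriveV R (fun v => 1 + posp v) u _ 1 p1 H1.
apply: (is_derive_eq (is_deriveM (is_derive_posp u) H2)).
by rewrite /GRing.scale /=; field.
Qed.

Lemma cutk_ge0_le1 (R : realType) (u : R) : 0 <= cutk u <= 1.
Proof.
have p0 := posp_ge0 u; rewrite /cutk divr_ge0 /= ?addr_ge0 //.
by rewrite ler_pdivrMr ?mul1r ?lerDr // ltr_wpDr.
Qed.

Lemma cutk0 (R : realType) (u : R) : u <= 0 -> cutk u = 0.
Proof. by move=> u0; rewrite /cutk posp0 // mul0r. Qed.

(** The quantity |x|^2 (1 - |x|^2) is positive exactly in the punctured open unit ball. So the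
    cutoff vanishes near the origin and off the ball, and tends to 1 in between as m grows. *)
Definition chi (R : realType) n (m : nat) (x : 'rV[R]_n) : R :=
  cutk (m%:R * (sqn x * (1 - sqn x)) - 1).

(** The cutoff is radial, so its gradient is a multiple of x and multiplication by it commutes with
    the rotation fields. *)
Lemma has_grad_chi (R : realType) n m (x : 'rV[R]_n) : exists c : 'rV[R]_n -> R,
  continuous c /\ forall x, has_grad (@chi R n m) x (fun l => c x * x 0 l).
Proof.
pose p (x : 'rV[R]_n) := m%:R * (sqn x * (1 - sqn x)) - 1.
pose k (u : R) := 2 * Num.max 0 u / (1 + posp u) ^+ 2.
exists (fun x => k (p x) * (m%:R * (1 - 2 * sqn x)) * 2); split.
  have cs y : {for y, continuous (fun z : 'rV[R]_n => 1 - 2 * sqn z)}.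
    apply: contD; first exact: contc.
    by apply: contN; apply: contM; [exact: contc|exact: continuous_sqn].
  have cp : continuous p.
    move=> y; apply: (@contD R _ (fun x => m%:R * (sqn x * (1 - sqn x))) (fun=> -1)); last exact: contc.
    apply: contM; first exact: contc.
    apply: contM; first exact: continuous_sqn.
    by apply: contD; [exact: contc|apply: contN; exact: continuous_sqn].
  have ck : continuous k.
    move=> u; apply: (@contM R R (fun u => 2 * Num.max 0 u) (fun u => ((1 + posp u) ^+ 2)^-1)).
      have -> : (fun v : R => 2 * Num.max 0 v) = (fun v => v + `|v|).
        by apply/funext => v; have [v0|v0] := leP 0 v; [rewrite ger0_norm|rewrite ltr0_norm]; lra.
      by apply: (@contD R R id Num.norm); [move=> ?; exact: cvg_id|exact: norm_continuous].
    apply: cvgV; first by rewrite expf_neq0 // gt_eqF // ltr_wpDr // posp_ge0.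
    apply: (@continuous_comp _ _ _ (fun v : R => 1 + posp v) (fun v => v ^+ 2)); last exact: exprn_continuous.
    apply: contD; first exact: contc.
    apply: differentiable_continuous; apply/derivable1_diffP.
    by have [] := is_derive_posp u.
  move=> y; apply: (@contM R _ (fun x => k (p x) * (m%:R * (1 - 2 * sqn x))) (fun=> 2)); last exact: contc.
  apply: (@contM R _ (fun x => k (p x)) (fun x => m%:R * (1 - 2 * sqn x))).
    by apply: (@continuous_comp _ _ _ p k); [exact: cp|exact: ck].
  by apply: (@contM R _ (fun=> m%:R) (fun x => 1 - 2 * sqn x)); [exact: contc|exact: cs].
move=> y.
have H0 : has_grad p y (fun l => m%:R * (1 - 2 * sqn y) * 2 * y 0 l).
  have h1 := has_gradD (has_grad_cst y 1) (has_gradN (has_grad_sqn y)).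
  have h2 := has_gradM (has_grad_cst y m%:R) (has_gradM (has_grad_sqn y) h1).
  apply: (eq_has_grad (has_gradD h2 (has_grad_cst y (-1)))) => // l.
  by ring.
apply: (eq_has_grad (has_grad_comp1 H0 (is_derive_cutk _))) => // l.
by rewrite /k; ring.
Qed.

Lemma cont_near (R : realType) (T : topologicalType) (f g : T -> R) x :
  (\forall y \near x, f y = g y) -> {for x, continuous f} -> {for x, continuous g}.
Proof.
move=> fg cf; rewrite /prop_for /continuous_at -(nbhs_singleton fg).
by apply: cvg_trans cf; apply: near_eq_cvg; apply: filterS fg => y ->.
Qed.

Lemma chi_small (R : realType) n m (x : 'rV[R]_n) :
  m%:R * (sqn x * (1 - sqn x)) <= 1 -> chi m x = 0.
Proof. by move=> H; rewrite /chi cutk0 // subr_le0. Qed.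

Lemma chi_big (R : realType) n m (x : 'rV[R]_n) : 1 <= sqn x -> chi m x = 0.
Proof.
move=> H; apply: chi_small; apply: (@le_trans _ _ 0) => //.
by rewrite mulr_ge0_le0 // mulr_ge0_le0 ?sqn_ge0 // subr_le0.
Qed.

Lemma chi_0 (R : realType) n m : chi m (0 : 'rV[R]_n) = 0.
Proof.
have s0 : sqn (0 : 'rV[R]_n) = 0 by apply/eqP; rewrite sqn_eq0.
by apply: chi_small; rewrite s0 mul0r mulr0.
Qed.

Lemma chi_near0 (R : realType) n m : \forall y \near (0 : 'rV[R]_n), chi m y = 0.
Proof.
have s0 : sqn (0 : 'rV[R]_n) = 0 by apply/eqP; rewrite sqn_eq0.
have c : {for (0 : 'rV[R]_n), continuous (fun y : 'rV[R]_n => m%:R * (sqn y * (1 - sqn y)))}.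
  apply: (@contM R _ (fun=> m%:R) (fun y => sqn y * (1 - sqn y))); first exact: contc.
  apply: (@contM R _ (@sqn R n) (fun y => 1 - sqn y)); first exact: continuous_sqn.
  apply: (@contD R _ (fun=> 1) (fun y => - sqn y)); first exact: contc.
  by apply: contN; exact: continuous_sqn.
have := cvgr_lt _ c 1; rewrite /= s0 mul0r mulr0 => /(_ _ ltr01).
by apply: filterS => y /ltW; exact: chi_small.
Qed.

Lemma continuous_chi (R : realType) n m : continuous (@chi R n m).
Proof.
move=> x; have [c [_ H]] := has_grad_chi m x.
exact: has_grad_continuous (H x).
Qed.

Lemma chi_le1 (R : realType) n m (x : 'rV[R]_n) : `|chi m x| <= 1.
Proof.
have /andP[h0 h1] := cutk_ge0_le1 (m%:R * (sqn x * (1 - sqn x)) - 1).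
by rewrite ger0_norm.
Qed.

Lemma chi_cvg (R : realType) n (x : 'rV[R]_n) : 0 < sqn x < 1 ->
  chi m x @[m --> \oo] --> (1 : R).
Proof.
move=> /andP[x0 x1]; set a := sqn x * (1 - sqn x).
have a0 : 0 < a by rewrite mulr_gt0 // subr_gt0.
apply/cvgrPdist_lt => e e0.
near=> m.
have Hm : (1 + e^-1 + 1) / a < m%:R by near: m; exact: nbhs_infty_gtr.
set u := m%:R * a - 1.
have ei : 0 < e^-1 by rewrite invr_gt0.
have u1 : 1 + e^-1 < u by rewrite /u ltrBrDr -ltr_pdivrMr.
rewrite /chi -/a -/u /cutk /posp max_r; last lra.
have d0 : 0 < 1 + u ^+ 2 by rewrite ltr_wpDr // sqr_ge0.
have -> : 1 - u ^+ 2 / (1 + u ^+ 2) = (1 + u ^+ 2)^-1 by field; exact: lt0r_neq0.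
rewrite ger0_norm ?invr_ge0 ?ltW // invf_plt ?posrE //.
nra.
Unshelve. all: by end_near. Qed.

Lemma sqn_lt1 (R : realType) n (x : 'rV[R]_n) : (sqn x < 1) = (enorm x < 1).
Proof. by rewrite -enorm_sqr expr_lt1 // enorm_ge0. Qed.

(** * The sphere integral as a limit of smooth cube integrals *)

(** Differs from the integrand of [sphere_int] only at the origin, where that one takes the value H
    0. With the value 0 there it becomes the pointwise limit of the functions [cutH]. *)
Definition sint0 (R : realType) n (H : 'rV[R]_n -> R) (x : 'rV[R]_n) : R :=
  if 0 < enorm x < 1 then H (sproj x) else 0.

Definition cutH (R : realType) n (m : nat) (H : 'rV[R]_n -> R) (x : 'rV[R]_n) : R :=
  chi m x * H (sproj x).

Lemma enorm0 (R : realType) n : enorm (0 : 'rV[R]_n) = 0.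
Proof. by apply/eqP; rewrite eq_le enorm_ge0 andbT leNgt enorm_gt0 eqxx. Qed.

Lemma cutH_cvg (R : realType) n (H : 'rV[R]_n -> R) x : cutH m H x @[m --> \oo] --> sint0 H x.
Proof.
rewrite /sint0; case: ifPn => [/andP[x0 x1]|].
  rewrite -[X in _ --> X]mul1r; apply: cvgM; last exact: cvg_cst.
  by apply: chi_cvg; rewrite sqn_gt0 -enorm_gt0 x0 sqn_lt1.
rewrite negb_and -!leNgt => Hx.
have -> : (fun m => cutH m H x) = (fun=> 0); last exact: cvg_cst.
apply/funext => m; rewrite /cutH; case/orP: Hx => Hx.
  have -> : x = 0 by apply/eqP; rewrite -[_ == _]negbK -enorm_gt0 -leNgt.
  by rewrite chi_0 mul0r.
by rewrite chi_big ?mul0r // leNgt sqn_lt1 -leNgt.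
Qed.

Lemma cutH_bnd (R : realType) n m (H : 'rV[R]_n -> R) M : 0 <= M -> sph_bnd M H -> bnd_by M (cutH m H).
Proof.
move=> M0 HM x; rewrite /cutH; have [->|x0] := eqVneq x 0; first by rewrite chi_0 mul0r normr0.
by rewrite normrM -[M]mul1r ler_pM // ?chi_le1 // HM // enorm_sproj.
Qed.

Lemma continuous_cutH (R : realType) n m (H : 'rV[R]_n -> R) : sphC H -> continuous (cutH m H).
Proof.
move=> cH x; have [->|x0] := eqVneq x 0.
  apply: (@cont_near R _ (fun=> 0)); last exact: contc.
  by apply: filterS (@chi_near0 R n m) => y cy; rewrite /cutH cy mul0r.
apply: contM; first exact: continuous_chi.
exact: sphC_sproj.
Qed.

Lemma sint0_props (R : realType) n (H : 'rV[R]_n -> R) M : 0 <= M -> sphC H -> sph_bnd M H ->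
  [/\ meas_cube (sint0 H), bnd_by M (sint0 H) &
      cube_int (cutH m H) @[m --> \oo] --> cube_int (sint0 H)].
Proof.
move=> M0 cH HM.
have [h1 h2] : meas_cube (sint0 H) /\ cube_int (cutH m H) @[m --> \oo] --> cube_int (sint0 H).
  apply: (@cube_int_dct _ _ _ _ M) => [m|m|x].
  - by apply: (@continuous_meas_cube _ _ _ M); [exact: continuous_cutH|exact: cutH_bnd].
  - exact: cutH_bnd.
  - exact: cutH_cvg.
split=> // x; rewrite /sint0; case: ifPn => [/andP[x0 _]|]; last by rewrite normr0.
by apply: HM; rewrite enorm_sproj // -enorm_gt0.
Qed.

Lemma Rint_eq_off0 (R : realType) (U V : R -> R) :
  measurable_fun (II_ R) U -> measurable_fun (II_ R) V ->
  (forall t, t != 0 -> U t = V t) -> Rint_ R U = Rint_ R V.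
Proof.
move=> mU mV UV; rewrite /Rintegral; congr fine.
have mD : measurable ((II_ R) `\ 0 : set (measurableTypeR R)).
  apply: measurableD; first exact: measurable_II.
  exact: measurable_set1.
have sD : ((II_ R) `\ 0) `<=` (II_ R) by move=> t [].
rewrite -(@integral_setD1 R (fun t => (U t)%:E) 0) //; last first.
  by apply/measurable_EFinP; apply: measurable_funS mU => //; exact: measurable_II.
rewrite -(@integral_setD1 R (fun t => (V t)%:E) 0) //; last first.
  by apply/measurable_EFinP; apply: measurable_funS mV => //; exact: measurable_II.
apply: eq_integral => t; rewrite inE => -[_ /eqP t0]; by rewrite UV.
Qed.

(** A change at the origin touches only the slice where the first coordinate is 0, a null set. The
    dimension must be positive: in dimension 0 the integral is the value at the origin. *)
Lemma cube_int_eq_off0 (R : realType) n (f g : 'rV[R]_n.+1 -> R) :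
  meas_cube f -> meas_cube g -> (forall x, x != 0 -> f x = g x) -> cube_int f = cube_int g.
Proof.
move=> [_ mf] [_ mg] fg; rewrite !cube_intS; apply: Rint_eq_off0 => // t t0.
congr cube_int; apply/funext => y; apply: fg.
by apply: contra_neq t0 => /(congr1 (fun z : 'rV[R]_n.+1 => z 0 ord0)); rewrite vcons0 mxE.
Qed.

(** A spike at the origin is the bounded limit of the continuous bumps c max(0, 1 - m |x|^2). *)
Lemma meas_cube_pt0 (R : realType) n (c : R) : meas_cube (fun x : 'rV[R]_n => if x == 0 then c else 0).
Proof.
apply: (proj1 (@cube_int_dct R n (fun m x => c * Num.max 0 (1 - m%:R * sqn x)) _ `|c| _ _ _)).
- move=> m; apply: (@continuous_meas_cube _ _ _ `|c|).
    move=> x; apply: (@contM R _ (fun=> c) (fun x => Num.max 0 (1 - m%:R * sqn x))); first exact: contc.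
    have -> : (fun x : 'rV[R]_n => Num.max 0 (1 - m%:R * sqn x)) =
       (fun x => 2^-1 * ((1 - m%:R * sqn x) + `|1 - m%:R * sqn x|)).
      apply/funext => v; have [v0|v0] := leP 0 (1 - m%:R * sqn v).
        by rewrite ger0_norm //; lra.
      by rewrite ltr0_norm //; lra.
    have c1 : {for x, continuous (fun x : 'rV[R]_n => 1 - m%:R * sqn x)}.
      apply: (@contD R _ (fun=> 1) (fun y => - (m%:R * sqn y))); first exact: contc.
      by apply: contN; apply: contM; [exact: contc|exact: continuous_sqn].
    apply: contM; first exact: contc.
    apply: contD => //.
    by apply: (@continuous_comp _ _ _ (fun x : 'rV[R]_n => 1 - m%:R * sqn x) Num.norm) => //; exact: norm_continuous.
  move=> x; rewrite normrM -[leRHS]mulr1 ler_wpM2l // ger0_norm ?le_max ?lexx //.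
  by rewrite ge_max ler01 /= gerBl mulr_ge0 // sqn_ge0.
- move=> m x; rewrite normrM -[leRHS]mulr1 ler_wpM2l // ger0_norm ?le_max ?lexx //.
  by rewrite ge_max ler01 /= gerBl mulr_ge0 // sqn_ge0.
- move=> x; have [->|x0] := eqVneq x 0.
    have s0 : sqn (0 : 'rV[R]_n) = 0 by apply/eqP; rewrite sqn_eq0.
    under eq_fun do rewrite s0 mulr0 subr0 max_r // mulr1.
    exact: cvg_cst.
  apply: cvg_near_cst; near=> m.
  have Hm : (sqn x)^-1 < m%:R by near: m; exact: nbhs_infty_gtr.
  rewrite max_l ?mulr0 // subr_le0 -ler_pdivrMr ?sqn_gt0 //.
  by rewrite mul1r ltW.
Unshelve. all: by end_near. Qed.

Lemma sphere_intE (R : realType) d (H : 'rV[R]_d -> R) : (0 < d)%N -> sphC H ->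
  sphere_int H = d%:R * cube_int (sint0 H).
Proof.
case: d H => [//|n] H _ cH; rewrite /sphere_int; congr (_ * _).
have [M [M0 HM]] := sphC_bnd cH.
have [m0 b0 _] := sint0_props M0 cH HM.
apply: cube_int_eq_off0 => //; last first.
  by move=> x x0; rewrite /sint0 enorm_gt0 x0.
have E : (fun x => if enorm x < 1 then H ((enorm x)^-1 *: x) else 0) =
    (fun x => 1 * sint0 H x + 1 * (if x == 0 then H 0 else 0)).
  apply/funext => x; rewrite !mul1r /sint0 /sproj enorm_gt0.
  by have [->|x0] /= := eqVneq x 0; rewrite ?enorm0 ?ltr01 ?scaler0 ?add0r ?addr0.
rewrite E; apply: (proj1 (@cube_int_lin _ _ _ _ 1 1 (Num.max M `|H 0|) _ _ _ _)) => //.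
- exact: meas_cube_pt0.
- by move=> x; rewrite le_max b0.
- by move=> x; rewrite le_max; case: ifP => _; rewrite ?lexx ?orbT // normr0 M0.
Qed.

Lemma eq_sphere_int (R : realType) d (H K : 'rV[R]_d -> R) : (0 < d)%N -> sphC H -> sphC K ->
  (forall th, enorm th = 1 -> H th = K th) -> sphere_int H = sphere_int K.
Proof.
move=> d0 cH cK HK; rewrite !sphere_intE //; congr (_ * cube_int _); apply/funext => x.
rewrite /sint0; case: ifPn => // /andP[x0 _].
by apply: HK; rewrite enorm_sproj // -enorm_gt0.
Qed.

Lemma sphCM (R : realType) d (H K : 'rV[R]_d -> R) : sphC H -> sphC K -> sphC (fun x => H x * K x).
Proof. by move=> cH cK th th1; apply: contM; [exact: cH|exact: cK]. Qed.

Lemma sphCD (R : realType) d (H K : 'rV[R]_d -> R) : sphC H -> sphC K -> sphC (fun x => H x + K x).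
Proof. by move=> cH cK th th1; apply: contD; [exact: cH|exact: cK]. Qed.

Lemma sphCN (R : realType) d (H : 'rV[R]_d -> R) : sphC H -> sphC (fun x => - H x).
Proof. by move=> cH th th1; apply: contN; exact: cH. Qed.

Lemma sphCc (R : realType) d (c : R) : sphC (fun _ : 'rV[R]_d => c).
Proof. by move=> th th1; exact: contc. Qed.

Lemma sphere_int_lin (R : realType) d (H K : 'rV[R]_d -> R) a b : (0 < d)%N -> sphC H -> sphC K ->
  sphere_int (fun x => a * H x + b * K x) = a * sphere_int H + b * sphere_int K.
Proof.
move=> d0 cH cK; rewrite !sphere_intE //; last first.
  by apply: sphCD; apply: sphCM => //; exact: sphCc.
have [M [M0 HM]] := sphC_bnd cH; have [N [N0 KN]] := sphC_bnd cK.
have [mH bH _] := sint0_props M0 cH HM; have [mK bK _] := sint0_props N0 cK KN.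
rewrite mulrCA [b * _]mulrCA -mulrDr; congr (_ * _).
rewrite -(proj2 (@cube_int_lin _ _ (sint0 H) (sint0 K) a b (Num.max M N) mH mK _ _)).
- congr cube_int; apply/funext => x; rewrite /sint0; case: ifP => // _.
  by rewrite !mulr0 addr0.
- by move=> x; rewrite le_max bH.
- by move=> x; rewrite le_max bK orbT.
Qed.

Lemma sphere_intD (R : realType) d (H K : 'rV[R]_d -> R) : (0 < d)%N -> sphC H -> sphC K ->
  sphere_int (fun x => H x + K x) = sphere_int H + sphere_int K.
Proof.
move=> d0 cH cK; have := @sphere_int_lin R d H K 1 1 d0 cH cK; rewrite !mul1r => <-.
by congr sphere_int; apply/funext => x; rewrite !mul1r.
Qed.

Lemma sphere_intZ (R : realType) d (H : 'rV[R]_d -> R) a : (0 < d)%N -> sphC H ->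
  sphere_int (fun x => a * H x) = a * sphere_int H.
Proof.
move=> d0 cH; have := @sphere_int_lin R d H H a 0 d0 cH cH; rewrite mul0r addr0 => <-.
by congr sphere_int; apply/funext => x; rewrite mul0r addr0.
Qed.

Lemma sphere_int_sum0 (R : realType) d (I : Type) (s : seq I) (H : I -> 'rV[R]_d -> R) :
  (0 < d)%N -> (forall i, sphC (H i)) -> (forall i, sphere_int (H i) = 0) ->
  sphC (fun x => \sum_(i <- s) H i x) /\ sphere_int (fun x => \sum_(i <- s) H i x) = 0.
Proof.
move=> d0 cH H0; elim: s => [|i s [IHc IH]].
  have -> : (fun x : 'rV[R]_d => \sum_(i <- [::]) H i x) = (fun=> 0 * 0) :> ('rV[R]_d -> R).
    by apply/funext => x; rewrite big_nil mul0r.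
  split; first exact: sphCc.
  by rewrite sphere_intZ ?mul0r //; exact: sphCc.
have -> : (fun x => \sum_(j <- i :: s) H j x) = (fun x => H i x + \sum_(j <- s) H j x).
  by apply/funext => x; rewrite big_cons.
by split; [exact: sphCD|rewrite sphere_intD // IH H0 addr0].
Qed.

Lemma sphere_int_bound (R : realType) d (H : 'rV[R]_d -> R) M : (0 < d)%N -> sphC H -> 0 <= M ->
  sph_bnd M H -> `|sphere_int H| <= d%:R * 2 ^+ d * M.
Proof.
move=> d0 cH M0 HM; have [mH bH _] := sint0_props M0 cH HM.
rewrite sphere_intE // normrM normr_nat -mulrA ler_wpM2l // mulrC.
exact: cube_int_bound.
Qed.

(** Differentiation under the sphere integral, transported from [is_derive_cube_int] through
    [sint0]. *)
Lemma is_derive_sphere_int (R : realType) d (g g' : R -> 'rV[R]_d -> R) (t delta M : R) :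
  (0 < d)%N -> 0 < delta -> 0 <= M ->
  (forall s, `|s - t| < delta -> sphC (g s)) -> sphC (g' t) ->
  (forall s th, `|s - t| < delta -> enorm th = 1 -> is_derive s 1 (g ^~ th) (g' s th)) ->
  (forall s, `|s - t| < delta -> sph_bnd M (g' s)) ->
  is_derive t 1 (fun s => sphere_int (g s)) (sphere_int (g' t)).
Proof.
move=> d0 dl0 M0 cg cg' dg g'M.
have near_t : \forall s \near t, `|s - t| < delta.
  by near=> s; rewrite distrC; near: s; exact: nbhsx_ballx.
(* The cube version asks for measurability at every parameter, while the integrand is controlled
   only near t; it is replaced by 0 elsewhere. *)
pose G s := if `|s - t| < delta then sint0 (g s) else (fun=> 0).
have Gs s : meas_cube (G s) /\ exists Ms, bnd_by Ms (G s).
  rewrite /G; case: ifPn => sd; last first.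
    split; last by exists 0 => x; rewrite normr0.
    by apply: (@continuous_meas_cube _ _ _ 0) => x; [exact: contc|rewrite normr0].
  have [N [N0 HN]] := sphC_bnd (cg s sd).
  by have [h1 h2 _] := sint0_props N0 (cg s sd) HN; split=> //; exists N.
have H : is_derive t 1 (fun s => cube_int (G s)) (cube_int (sint0 (g' t))).
  apply: (@is_derive_cube_int _ _ G (fun s => sint0 (g' s)) t delta M) => //.
  - by move=> s; have [] := Gs s.
  - by move=> s; have [] := Gs s.
  - move=> s y sd.
    have near_s : \forall u \near s, G u y = sint0 (g u) y.
      near=> u; rewrite /G ifT //.
      near: u; apply: (@open_nbhs_nbhs _ s [set u | `|u - t| < delta]); split => //.
      have -> : [set u : R | `|u - t| < delta] = ball t delta.
        by apply/seteqP; split => u; rewrite /ball /= distrC.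
      exact: ball_open.
    apply: (@near_eq_is_derive _ _ _ (fun u => sint0 (g u) y)).
      by apply: filterS near_s => u ->.
    rewrite /sint0; case: ifPn => [/andP[y0 _]|_]; last exact: is_derive_cst.
    by apply: dg => //; rewrite enorm_sproj // -enorm_gt0.
  - move=> s sd x; rewrite /sint0; case: ifPn => [/andP[x0 _]|]; last by rewrite normr0.
    by apply: g'M => //; rewrite enorm_sproj // -enorm_gt0.
rewrite (sphere_intE d0 cg').
apply: (@near_eq_is_derive _ _ _ (fun s => d%:R * cube_int (G s))).
  by apply: filterS near_t => s sd; rewrite /G sd sphere_intE //; exact: cg.
Unshelve. all: by end_near. Qed.

(** * Rotation fields integrate to zero *)

(** Off the origin the product and chain rules apply; near the origin the function is identically 0.
    In the last clause the radial parts of the gradient cancel, so rotating [cutH] amounts to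
    rotating H on the sphere and multiplying by the cutoff. *)
Lemma cutH_deriv (R : realType) n m (H : 'rV[R]_n -> R) (g : 'rV[R]_n -> 'I_n -> R) :
  (forall th, enorm th = 1 -> has_grad H th (g th) /\ forall l, {for th, continuous (g ^~ l)}) ->
  (forall x l, derivable (cutH m H) x (evec l)) /\
  [/\ forall l, continuous (fun x => 'D_(evec l) (cutH m H) x),
      forall l, exists M, 0 <= M /\ bnd_by M (fun x => 'D_(evec l) (cutH m H) x),
      forall (x : 'rV[R]_n) l, (exists i, 1 < `|x 0 i|) -> 'D_(evec l) (cutH m H) x = 0 &
      forall x i j, chi m x * (sproj x 0 i * g (sproj x) j - sproj x 0 j * g (sproj x) i) =
        x 0 i * 'D_(evec j) (cutH m H) x - x 0 j * 'D_(evec i) (cutH m H) x].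
Proof.
move=> Hg; set G := cutH m H.
have [c [cc cchi]] := has_grad_chi m (0 : 'rV[R]_n).
pose Wg (x : 'rV[R]_n) l := (enorm x)^-1 * g (sproj x) l - x 0 l / enorm x ^+ 3 * \sum_i x 0 i * g (sproj x) i.
pose Gg x l := chi m x * Wg x l + H (sproj x) * (c x * x 0 l).
have gG (x : 'rV[R]_n) : x != 0 -> has_grad G x (Gg x).
  move=> x0; apply: has_gradM; first exact: cchi.
  by apply: has_grad_sproj => //; apply: (Hg _ _).1; rewrite enorm_sproj.
have near0 (x : 'rV[R]_n) : (\forall y \near x, G y = 0) -> forall l, is_derive x (evec l) G 0.
  move=> G0 l; apply: (@near_eq_is_derive _ _ _ (cst 0)).
  by apply: filterS G0 => y ->.
have G0 : \forall y \near (0 : 'rV[R]_n), G y = 0.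
  by apply: filterS (@chi_near0 R n m) => y cy; rewrite /G /cutH cy mul0r.
have DG0 l : \forall y \near (0 : 'rV[R]_n), 'D_(evec l) G y = 0.
  by apply: filterS (nbhs_interior G0) => y Gy; have [_ ->] := near0 y Gy l.
have out (x : 'rV[R]_n) l : (exists i, 1 < `|x 0 i|) -> 'D_(evec l) G x = 0.
  move=> [i xi].
  have s1 : 1 < sqn x.
    apply: lt_le_trans (coord_sqn x i); rewrite -real_normK ?num_real //.
    by rewrite exprn_egt1.
  have Gx : \forall y \near x, G y = 0.
    apply: filterS (cvgr_gt _ (@continuous_sqn R n x) 1 s1) => y /ltW y1.
    by rewrite /G /cutH chi_big ?mul0r.
  by have [_ ->] := near0 x Gx l.
have cDG l : continuous (fun x => 'D_(evec l) G x).
  move=> x; have [->|x0] := eqVneq x 0.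
    apply: (@cont_near R _ (fun=> 0)); last exact: contc.
    by apply: filterS (DG0 l) => y ->.
  apply: (@cont_near R _ (fun x => Gg x l)).
    by apply: filterS (nbhs_neq0 x0) => y y0; have [_ ->] := gG y y0.
  have cgl a : {for x, continuous (fun y => g (sproj y) a)}.
    apply: (@continuous_comp _ _ _ (@sproj R n) (g ^~ a)); first exact: continuous_sproj.
    by apply: (Hg _ _).2; rewrite enorm_sproj.
  have cnu := has_grad_continuous (has_grad_invnorm x0).
  have cco a : {for x, continuous (fun y : 'rV[R]_n => y 0 a)} := has_grad_continuous (has_grad_coord x a).
  have cH := has_grad_continuous (has_grad_sproj x0 (Hg _ (enorm_sproj x0)).1).
  have cW : {for x, continuous (fun y => Wg y l)}.
    apply: contD; first by apply: contM.
    apply: contN; apply: contM; last by apply: cont_sum => a; apply: contM.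
    apply: contM => //.
    have -> : (fun y : 'rV[R]_n => (enorm y ^+ 3)^-1) = (fun y => (enorm y)^-1 * ((enorm y)^-1 * (enorm y)^-1)).
      by apply/funext => y; rewrite !exprS expr0 mulr1 !invfM.
    by do 2 (apply: contM => //).
  apply: contD; apply: contM => //; first exact: continuous_chi.
  by apply: contM => //; exact: cc.
split.
  move=> x l; have [->|x0] := eqVneq x 0; last exact: has_grad_derivable (gG x x0).
  by have [] := near0 _ G0 l.
split=> //.
- move=> l.
  (* On the closed cube the bound comes from compactness; outside it the derivative is 0. *)
  have [M [M0 HM]] := @compact_fun_bounded R _ [set x : 'rV[R]_n | forall i, `[-1, 1]%classic (x 0 i)]
     (fun x => 'D_(evec l) G x) (@rV_compact R n (fun=> `[-1, 1]%classic) (fun=> @segment_compact R (-1) 1))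
     (fun x _ => cDG l x).
  exists M; split=> // x.
  have [Hx|/forallNP Hx] := pselect (exists i, 1 < `|x 0 i|); first by rewrite out // normr0.
  apply: HM => i /=; rewrite in_itv /= -ler_norml leNgt; apply/negP; exact: Hx.
- move=> x i j; have [->|x0] := eqVneq x 0.
    by rewrite chi_0 !mxE !mul0r subrr.
  have [_ ->] := gG x x0; have [_ ->] := gG x x0.
  rewrite /Gg /Wg /sproj !mxE; ring.
Qed.

(** Infinitesimal rotation invariance of the surface measure. For the cutoff function and a <> b,
    x_a d_b equals d_b applied after multiplying by x_a, whose cube integral vanishes by
    [cube_int_deriv]; then m goes to infinity. *)
Lemma sphere_int_rot (R : realType) d (H : 'rV[R]_d -> R) (g : 'rV[R]_d -> 'I_d -> R) i j :
  (forall th, enorm th = 1 -> has_grad H th (g th) /\ forall l, {for th, continuous (g ^~ l)}) ->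
  sphC (fun x => x 0 i * g x j - x 0 j * g x i) /\
  sphere_int (fun x => x 0 i * g x j - x 0 j * g x i) = 0.
Proof.
move=> Hg; have d0 : (0 < d)%N by apply: leq_trans (ltn_ord i).
have cco a x : {for x, continuous (fun y : 'rV[R]_d => y 0 a)} := has_grad_continuous (has_grad_coord x a).
set K := fun x => _.
have cK : sphC K.
  move=> th th1; have [_ cg] := Hg th th1.
  by apply: contD; [|apply: contN]; apply: contM.
split=> //.
have cH : sphC H by move=> th th1; exact: has_grad_continuous (Hg th th1).1.
have [M [M0 HM]] := sphC_bnd cH; have [N [N0 KN]] := sphC_bnd cK.
rewrite sphere_intE //.
have [_ _ Kcv] := sint0_props N0 cK KN.
suff E : (fun m => cube_int (cutH m K)) = (fun=> 0).
  rewrite E in Kcv; rewrite -(cvg_lim (@Rhausdorff R) Kcv) lim_cst ?mulr0 //.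
apply/funext => m.
have [dG [cDG DGM out rot]] := cutH_deriv m Hg.
have [ij|ij] := eqVneq i j.
  rewrite -[RHS](cube_int_cst0 R d); congr cube_int; apply/funext => x.
  by rewrite /cutH rot ij subrr.
have Z a b : a != b -> exists B, [/\ 0 <= B,
   meas_cube (fun x : 'rV[R]_d => x 0 a * 'D_(evec b) (cutH m H) x),
   bnd_by B (fun x : 'rV[R]_d => x 0 a * 'D_(evec b) (cutH m H) x) &
   cube_int (fun x : 'rV[R]_d => x 0 a * 'D_(evec b) (cutH m H) x) = 0].
  move=> ab; have [B [B0 HB]] := DGM b.
  have cD : continuous (fun x : 'rV[R]_d => x 0 a * 'D_(evec b) (cutH m H) x).
    move=> x; apply: (@contM R _ (fun x : 'rV[R]_d => x 0 a) (fun x => 'D_(evec b) (cutH m H) x)).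
      exact: cco.
    exact: cDG.
  have bD : bnd_by B (fun x : 'rV[R]_d => x 0 a * 'D_(evec b) (cutH m H) x).
    move=> x; have [xa|xa] := leP `|x 0 a| 1; last by rewrite out ?mulr0 ?normr0 //; exists a.
    by rewrite normrM -[B]mul1r ler_pM //; exact: HB.
  exists B; split=> //; first exact: (@continuous_meas_cube _ _ _ B).
  (* As a and b differ, the factor x_a moves inside the derivative d_b. *)
  have DE : (fun x : 'rV[R]_d => x 0 a * 'D_(evec b) (cutH m H) x) =
            (fun x => 'D_(evec b) (fun y : 'rV[R]_d => y 0 a * cutH m H y) x).
    apply/funext => x.
    rewrite (@deriveM _ _ (fun y : 'rV[R]_d => y 0 a) (cutH m H)) //; last first.
      exact: has_grad_derivable (has_grad_coord x a).
    have [_ ->] := has_grad_coord x a.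
    by rewrite /GRing.scale /= eq_sym (negPf ab) mulr0 addr0.
  rewrite DE; apply: (@cube_int_deriv _ _ _ b (Num.max M B)).
  - move=> x; apply: (@contM R _ (fun x : 'rV[R]_d => x 0 a) (cutH m H)); first exact: cco.
    exact: continuous_cutH.
  - move=> x; rewrite le_max; apply/orP; left.
    have [xa|xa] := leP `|x 0 a| 1.
      by rewrite normrM -[M]mul1r ler_pM //; exact: cutH_bnd.
    rewrite /cutH chi_big ?mul0r ?mulr0 ?normr0 //.
    apply: le_trans (coord_sqn x a); rewrite -real_normK ?num_real //.
    by rewrite exprn_ege1 // ltW.
  - move=> x; apply: (@derivableM _ _ (fun y : 'rV[R]_d => y 0 a) (cutH m H)) => //.
    exact: has_grad_derivable (has_grad_coord x a).
  - by rewrite -DE.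
  - by rewrite -DE => x; rewrite le_max bD orbT.
  - move=> x xb; rewrite /cutH chi_big ?mul0r ?mulr0 //.
    apply: le_trans (coord_sqn x b); rewrite -real_normK ?num_real //.
    by rewrite exprn_ege1.
have [B1 [B10 m1 b1 e1]] := Z i j ij.
have [B2 [B20 m2 b2 e2]] := Z j i (negbT (etrans (eq_sym _ _) (negPf ij))).
have b1' : bnd_by (Num.max B1 B2) (fun x : 'rV[R]_d => x 0 i * 'D_(evec j) (cutH m H) x).
  by move=> x; rewrite le_max b1.
have b2' : bnd_by (Num.max B1 B2) (fun x : 'rV[R]_d => x 0 j * 'D_(evec i) (cutH m H) x).
  by move=> x; rewrite le_max b2 orbT.
have [_] := @cube_int_lin _ _ _ _ 1 (-1) _ m1 m2 b1' b2'.
rewrite e1 e2 !mulr0 addr0 => <-; congr cube_int; apply/funext => x.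
by rewrite /cutH rot mul1r mulN1r.
Qed.

(** * Rays, polynomials and Euler identities *)

Lemma has_grad_scale (R : realType) d (f : 'rV[R]_d -> R) (r : R) (x : 'rV[R]_d) g :
  has_grad f (r *: x) g -> has_grad (fun y => f (r *: y)) x (fun l => r * g l).
Proof.
move=> Hf.
have HJ i : has_grad (fun y : 'rV[R]_d => (r *: y) 0 i) x (fun l => r * (l == i)%:R).
  apply: (eq_has_grad (has_gradM (has_grad_cst x r) (has_grad_coord x i))) => [y|l].
    by rewrite mxE.
  by rewrite mulr0 addr0.
apply: (eq_has_grad (has_grad_chain HJ Hf)) => // l.
rewrite (bigD1 l) //= eqxx mulr1 big1 ?addr0 // => i il.
by rewrite eq_sym (negPf il) mulr0 mul0r.
Qed.

(** In the logarithmic radius the radial derivative is the Euler operator x . grad. *)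
Lemma is_derive_ray (R : realType) d (f : 'rV[R]_d -> R) (s : R) (x : 'rV[R]_d) g :
  has_grad f (expR s *: x) g ->
  is_derive s 1 (fun u => f (expR u *: x)) (\sum_l (expR s *: x) 0 l * g l).
Proof.
move=> Hf; have [df _] := Hf.
have de : differentiable (@expR R) s by apply/derivable1_diffP; exact: derivable_expR.
have dc : differentiable (fun u : R => expR u *: x) s by exact: differentiableZl.
have dfc : differentiable (f \o (fun u : R => expR u *: x)) s by exact: differentiable_comp.
split; first exact: diff_derivable.
rewrite deriveE // diff_comp //= (diffZl _ de) -(deriveE _ de) -(deriveE _ df) (has_grad_dir _ Hf).
have [_ ->] := is_derive_expR s.
by [].
Qed.

(** Generated inductively so that smoothness and closure under partial derivatives follow by
    induction. *)
Inductive polyf (R : realType) (d : nat) : ('rV[R]_d -> R) -> Prop :=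
| polyf_cst c : polyf (fun=> c)
| polyf_coord i : polyf (fun x => x 0 i)
| polyf_add f g : polyf f -> polyf g -> polyf (fun x => f x + g x)
| polyf_mul f g : polyf f -> polyf g -> polyf (fun x => f x * g x).

Lemma polyf_grad_ex (R : realType) d (f : 'rV[R]_d -> R) : polyf f ->
  exists g : 'I_d -> 'rV[R]_d -> R, (forall l, polyf (g l)) /\
    forall x, has_grad f x (fun l => g l x).
Proof.
elim=> {f} [c|i|f h _ [g [pg Hg]] _ [k [pk Hk]]|f h pf [g [pg Hg]] ph [k [pk Hk]]].
- by exists (fun _ _ => 0); split=> [l|x]; [exact: polyf_cst|exact: has_grad_cst].
- exists (fun l _ => (l == i)%:R); split=> [l|x]; [exact: polyf_cst|exact: has_grad_coord].
- by exists (fun l x => g l x + k l x); split=> [l|x]; [exact: polyf_add|exact: has_gradD].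
- exists (fun l x => f x * k l x + h x * g l x); split=> [l|x]; last exact: has_gradM.
  by apply: polyf_add; exact: polyf_mul.
Qed.

Lemma polyf_grad (R : realType) d (f : 'rV[R]_d -> R) : polyf f ->
  (forall l, polyf (fun x => 'D_(evec l) f x)) /\
  forall x, has_grad f x (fun l => 'D_(evec l) f x).
Proof.
move=> /polyf_grad_ex[g [pg Hg]]; split=> [l|x]; last by have [df _] := Hg x.
have -> : (fun x => 'D_(evec l) f x) = g l by apply/funext => x; have [_ ->] := Hg x.
exact: pg.
Qed.

Lemma polyf_sum (R : realType) d (I : Type) (s : seq I) (P : pred I) (f : I -> 'rV[R]_d -> R) :
  (forall i, polyf (f i)) -> polyf (fun x => \sum_(i <- s | P i) f i x).
Proof.
move=> H; elim: s => [|i s IH].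
  have -> : (fun x : 'rV[R]_d => \sum_(i <- [::] | P i) f i x) = (fun=> 0) :> (_ -> R).
    by apply/funext => x; rewrite big_nil.
  exact: polyf_cst.
have -> : (fun x => \sum_(i <- i :: s | P i) f i x) =
    (fun x => (P i)%:R * f i x + \sum_(i <- s | P i) f i x).
  by apply/funext => x; rewrite big_cons; case: (P i); rewrite ?mul1r ?mul0r ?add0r.
by apply: polyf_add => //; apply: polyf_mul => //; exact: polyf_cst.
Qed.

Lemma polyf_prod (R : realType) d (I : Type) (s : seq I) (f : I -> 'rV[R]_d -> R) :
  (forall i, polyf (f i)) -> polyf (fun x => \prod_(i <- s) f i x).
Proof.
move=> H; elim: s => [|i s IH].
  have -> : (fun x : 'rV[R]_d => \prod_(i <- [::]) f i x) = (fun=> 1) :> (_ -> R).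
    by apply/funext => x; rewrite big_nil.
  exact: polyf_cst.
have -> : (fun x => \prod_(i <- i :: s) f i x) = (fun x => f i x * \prod_(i <- s) f i x).
  by apply/funext => x; rewrite big_cons.
exact: polyf_mul.
Qed.

Lemma polyf_exp (R : realType) d (f : 'rV[R]_d -> R) n : polyf f -> polyf (fun x => f x ^+ n).
Proof.
move=> pf; elim: n => [|n IH].
  have -> : (fun x => f x ^+ 0) = (fun=> 1) by apply/funext => x; rewrite expr0.
  exact: polyf_cst.
have -> : (fun x => f x ^+ n.+1) = (fun x => f x * f x ^+ n) by apply/funext => x; rewrite exprS.
exact: polyf_mul.
Qed.

Definition laplR (R : realType) d (g : 'rV[R]_d -> R) : 'rV[R]_d -> R :=
  fun x => \sum_(i < d) 'D_(evec i) (fun y => 'D_(evec i) g y) x.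

Definition harm_homogR (R : realType) d k (y : 'rV[R]_d -> R) :=
  [/\ polyf y, forall c x, y (c *: x) = c ^+ k * y x & forall x, laplR y x = 0].

Lemma Re_sum (R : realType) (I : Type) (s : seq I) (P : pred I) (f : I -> R[i]) :
  complex.Re (\sum_(i <- s | P i) f i) = \sum_(i <- s | P i) complex.Re (f i).
Proof. by rewrite raddf_sum. Qed.

Lemma Im_sum (R : realType) (I : Type) (s : seq I) (P : pred I) (f : I -> R[i]) :
  complex.Im (\sum_(i <- s | P i) f i) = \sum_(i <- s | P i) complex.Im (f i).
Proof. by rewrite raddf_sum. Qed.

Lemma Re_mulr_real (R : realType) (z : R[i]) (t : R) : complex.Re (z * t%:C%C) = complex.Re z * t.
Proof. by case: z => a b /=; rewrite mulr0 subr0. Qed.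

Lemma Im_mulr_real (R : realType) (z : R[i]) (t : R) : complex.Im (z * t%:C%C) = complex.Im z * t.
Proof. by case: z => a b /=; rewrite mulr0 add0r. Qed.

(** Monomials and the Laplacian are real, so homogeneity and harmonicity pass to the real and
    imaginary parts. *)
Lemma harm_homog_ReIm (R : realType) d k (Y : 'rV[R]_d -> R[i]) : harm_homog_poly k Y ->
  harm_homogR k (fun x => complex.Re (Y x)) /\ harm_homogR k (fun x => complex.Im (Y x)).
Proof.
move=> [[c Yc] HY].
have prodE (x : 'rV[R]_d) (m : {ffun 'I_d -> 'I_k.+1}) :
    \prod_(i < d) (((x 0 i)%:C%C : R[i]) ^+ (m i : nat)) = (\prod_(i < d) x 0 i ^+ (m i : nat))%:C%C.
  by rewrite rmorph_prod; apply: eq_bigr => i _; rewrite rmorphXn.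
have key (T : R[i] -> R) : (forall x, T (Y x) =
      \sum_(m : {ffun 'I_d -> 'I_k.+1} | (\sum_(i < d) (m i : nat))%N == k)
        T (c m) * \prod_(i < d) x 0 i ^+ (m i : nat)) ->
    (forall x, laplR (fun x => T (Y x)) x = 0) -> harm_homogR k (fun x => T (Y x)).
  move=> TE TL; split=> //.
    have -> : (fun x => T (Y x)) = fun x => \sum_(m : {ffun 'I_d -> 'I_k.+1} | (\sum_(i < d) (m i : nat))%N == k)
        T (c m) * \prod_(i < d) x 0 i ^+ (m i : nat) by apply/funext.
    apply: polyf_sum => m; apply: polyf_mul; first exact: polyf_cst.
    by apply: polyf_prod => i; apply: polyf_exp; exact: polyf_coord.
  move=> a x; rewrite !TE mulr_sumr; apply: eq_bigr => m /eqP mk.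
  rewrite mulrCA; congr (_ * _).
  under eq_bigr do rewrite mxE exprMn.
  by rewrite big_split /= -expr_sum mk.
split; apply: key => x.
- by rewrite Yc Re_sum; apply: eq_bigr => m _; rewrite prodE Re_mulr_real.
- have := congr1 (@complex.Re R) (HY x); rewrite /laplC Re_sum /=; exact.
- by rewrite Yc Im_sum; apply: eq_bigr => m _; rewrite prodE Im_mulr_real.
- have := congr1 (@complex.Im R) (HY x); rewrite /laplC Im_sum /=; exact.
Qed.

(** Both sides are the derivative at u = 0 of y(e^u x) = e^{ku} y(x). *)
Lemma euler1 (R : realType) d k (y : 'rV[R]_d -> R) (x : 'rV[R]_d) : harm_homogR k y ->
  \sum_l x 0 l * 'D_(evec l) y x = k%:R * y x.
Proof.
move=> [/polyf_grad[_ Hy] yk _].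
have H := @is_derive_ray R d y 0 x _ (Hy (expR 0 *: x)).
rewrite expR0 scale1r in H.
have E : (fun u => y (expR u *: x)) = (fun u => expR (k%:R * u) * y x).
  by apply/funext => u; rewrite yk expRM_natl.
rewrite E in H; have [_ <-] := H; have [_] : is_derive (0 : R) 1 (fun u : R => expR (k%:R * u) * y x) (k%:R * y x).
  have h0 : is_derive (0 : R) 1 (fun u => k%:R * u) k%:R.
    by apply: (is_derive_eq (is_deriveZ k%:R (is_derive_id (0 : R) 1))); rewrite /GRing.scale /= mulr1.
  have h1 := @is_derive1_comp R (@expR R) (fun u => k%:R * u) 0 _ _ (is_derive_expR _) h0.
  have -> : (fun u : R => expR (k%:R * u) * y x) = y x \*: (@expR R \o (fun u => k%:R * u)).
    by apply/funext => u /=; rewrite mulrC.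
  by apply: (is_derive_eq (is_deriveZ (y x) h1)); rewrite /GRing.scale /= mulr0 expR0 mul1r mulrC.
by [].
Qed.

(** Obtained by differentiating the identity of [euler1] in each direction and contracting with
    x. *)
Lemma euler2 (R : realType) d k (y : 'rV[R]_d -> R) (x : 'rV[R]_d) : harm_homogR k y ->
  \sum_i \sum_j x 0 i * x 0 j * 'D_(evec i) (fun z => 'D_(evec j) y z) x =
  (k%:R ^+ 2 - k%:R) * y x.
Proof.
move=> Hy; have [/polyf_grad[pb gy] _ _] := Hy.
have gb j := (polyf_grad (pb j)).2 x.
have g1 := has_grad_sum (index_enum 'I_d) (fun j => has_gradM (has_grad_coord x j) (gb j)).
have g2 : has_grad (fun z => \sum_j z 0 j * 'D_(evec j) y z) x (fun l => k%:R * 'D_(evec l) y x).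
  apply: (eq_has_grad (has_gradM (has_grad_cst x k%:R) (gy x))) => [z|l].
    by rewrite (euler1 z Hy).
  by rewrite mulr0 addr0.
have E l : \sum_j (x 0 j * 'D_(evec l) (fun z => 'D_(evec j) y z) x + 'D_(evec j) y x * (l == j)%:R) =
    k%:R * 'D_(evec l) y x.
  by have [_ <-] := g2; have [_ ->] := g1.
have -> : (k%:R ^+ 2 - k%:R) * y x = k%:R * (k%:R * y x) - k%:R * y x by ring.
rewrite -(euler1 x Hy) mulr_sumr -sumrB; apply: eq_bigr => i _.
have S : \sum_j 'D_(evec j) y x * (i == j)%:R = 'D_(evec i) y x.
  by rewrite (bigD1 i) //= eqxx mulr1 big1 ?addr0 // => j ji; rewrite eq_sym (negPf ji) mulr0.
rewrite mulrCA -E big_split /= S mulrDr addrK mulr_sumr.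
by apply: eq_bigr => j _; rewrite mulrA.
Qed.

(** * The radial differential equation *)

(** D s plays the iterated partial derivative along the word s, the head being the outermost
    derivative. The abstraction lets one argument serve f and all its iterated Laplacians. *)
Definition jet (R : realType) d (A : set 'rV[R]_d) (D : seq 'I_d -> 'rV[R]_d -> R) :=
  forall s x, A x -> has_grad (D s) x (fun l => D (l :: s) x).

Definition jE (R : realType) d (D : seq 'I_d -> 'rV[R]_d -> R) (x : 'rV[R]_d) : R :=
  \sum_i x 0 i * D [:: i] x.
(** The square of the Euler operator: (x . grad)^2 = x . grad + sum x_i x_j d_i d_j. *)
Definition jE2 (R : realType) d (D : seq 'I_d -> 'rV[R]_d -> R) (x : 'rV[R]_d) : R :=
  jE D x + \sum_i \sum_j x 0 i * x 0 j * D [:: i; j] x.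
(** The derivatives of the Laplacian. The pair i, i sits at the innermost end of the word, so
    prepending a derivative commutes with this by computation. *)
Definition jL (R : realType) d (D : seq 'I_d -> 'rV[R]_d -> R) (s : seq 'I_d) (x : 'rV[R]_d) : R :=
  \sum_i D (s ++ [:: i; i]) x.

(** Here w = y grad h - h grad y, with a, b the gradients and A, B the Hessians of h, y. The left
    side applies x_i d_j - x_j d_i to x_i w_j and sums; it equals |x|^2 div w - (d-1) x . w - sum
    x_i x_j d_i w_j, in which the products of gradients cancel by symmetry in i and j. *)
Lemma rot_sum_identity (R : realType) d (x a b : 'I_d -> R) (h y : R) (A B : 'I_d -> 'I_d -> R) :
  let w j := a j * y - h * b j in
  let Dw l j := a j * b l + y * A l j - (h * B l j + b j * a l) in
  \sum_i \sum_j (x i * (x i * Dw j j + w j * (j == i)%:R) - x j * (x i * Dw i j + w j * (i == i)%:R)) =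
  (\sum_i x i ^+ 2) * (y * \sum_i A i i - h * \sum_i B i i) - (d%:R - 1) * \sum_j x j * w j
  - (y * \sum_i \sum_j x i * x j * A i j - h * \sum_i \sum_j x i * x j * B i j).
Proof.
move=> w Dw.
pose W := \sum_j x j * w j.
have T1 : \sum_i \sum_j x i ^+ 2 * Dw j j = (\sum_i x i ^+ 2) * (y * \sum_i A i i - h * \sum_i B i i).
  rewrite !mulr_sumr -sumrB big_distrl /=; apply: eq_bigr => i _.
  by rewrite mulr_sumr; apply: eq_bigr => j _; rewrite /Dw; ring.
have T2 : \sum_i \sum_j x i * (w j * (j == i)%:R) = W.
  apply: eq_bigr => i _; rewrite (bigD1 i) //= eqxx mulr1 big1 ?addr0 // => j ji.
  by rewrite (negPf ji) !mulr0.
have T4 : \sum_(i < d) \sum_j x j * w j = d%:R * W.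
  by rewrite sumr_const card_ord mulr_natl.
have T3 : \sum_i \sum_j x j * (x i * Dw i j) =
    y * \sum_i \sum_j x i * x j * A i j - h * \sum_i \sum_j x i * x j * B i j.
  have C : \sum_i \sum_j x i * x j * (a j * b i) = \sum_i \sum_j x i * x j * (b j * a i).
    by rewrite exchange_big /=; apply: eq_bigr => i _; apply: eq_bigr => j _; ring.
  have Z : \sum_i \sum_j x i * x j * (a j * b i) - \sum_i \sum_j x i * x j * (b j * a i) = 0.
    by rewrite C subrr.
  have RI (xi xj ai aj bi bj Aij Bij : R) : xj * (xi * (aj * bi + y * Aij - (h * Bij + bj * ai))) =
      y * (xi * xj * Aij) - h * (xi * xj * Bij) + (xi * xj * (aj * bi) - xi * xj * (bj * ai)) by ring.
  rewrite !mulr_sumr -sumrB -[RHS]addr0 -[X in _ + X]Z -sumrB -big_split /=; apply: eq_bigr => i _.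
  rewrite !mulr_sumr -!sumrB -big_split /=; apply: eq_bigr => j _; rewrite /Dw.
  exact: RI.
rewrite -T1 -T3 -/W; transitivity (\sum_i \sum_j x i ^+ 2 * Dw j j + \sum_i \sum_j x i * (w j * (j == i)%:R)
   - \sum_i \sum_j x j * (x i * Dw i j) - \sum_(i < d) \sum_j x j * w j); last by rewrite T2 T4; ring.
rewrite -big_split -!sumrB /=; apply: eq_bigr => i _.
rewrite -big_split -!sumrB /=; apply: eq_bigr => j _; rewrite eqxx mulr1; ring.
Qed.

(** Green's identity on the sphere of radius r. Each x_i w_j, with w = y grad h - h grad y, has
    vanishing rotation integral; in the sum, harmonicity and the two Euler identities eliminate the
    derivatives of y. *)
Lemma sphere_ode (R : realType) d (A : set 'rV[R]_d) (D : seq 'I_d -> 'rV[R]_d -> R) k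
    (y : 'rV[R]_d -> R) (r : R) :
  (0 < d)%N -> jet A D -> harm_homogR k y -> r != 0 -> (forall th, enorm th = 1 -> A (r *: th)) ->
  r ^+ 2 * sphere_int (fun th => jL D [::] (r *: th) * y th) =
  sphere_int (fun th => jE2 D (r *: th) * y th)
  + (d%:R - 2) * sphere_int (fun th => jE D (r *: th) * y th)
  - k%:R * (k%:R + d%:R - 2) * sphere_int (fun th => D [::] (r *: th) * y th).
Proof.
move=> d0 jD Hy r0 Ar; have [/polyf_grad[pb gy] yk yL] := Hy.
pose b l (x : 'rV[R]_d) := 'D_(evec l) y x.
pose B l j (x : 'rV[R]_d) := 'D_(evec l) (b j) x.
have gb j x : has_grad (b j) x (fun l => B l j x) by exact: (polyf_grad (pb j)).2.
have cB l j x : {for x, continuous (B l j)}.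
  exact: has_grad_continuous ((polyf_grad ((polyf_grad (pb j)).1 l)).2 x).
have cb j x : {for x, continuous (b j)} := has_grad_continuous (gb j x).
have cy x : {for x, continuous y} := has_grad_continuous (gy x).
have cD s x (Ax : A x) : {for x, continuous (D s)} := has_grad_continuous (jD s x Ax).
have cco a (x : 'rV[R]_d) : {for x, continuous (fun y : 'rV[R]_d => y 0 a)} := has_grad_continuous (has_grad_coord x a).
have csc (f : 'rV[R]_d -> R) (th : 'rV[R]_d) : {for r *: th, continuous f} ->
      {for th, continuous (fun z : 'rV[R]_d => f (r *: z))}.
  move=> cf; apply: (@continuous_comp _ _ _ (fun z : 'rV[R]_d => r *: z) f) => //.
  exact: scaler_continuous.
pose w j (x : 'rV[R]_d) := D [:: j] x * y x - D [::] x * b j x.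
pose Dw l j (x : 'rV[R]_d) := D [:: j] x * b l x + y x * D [:: l; j] x - (D [::] x * B l j x + b j x * D [:: l] x).
pose gH i j (x : 'rV[R]_d) l := x 0 i * Dw l j x + w j x * (l == i)%:R.
have HgH i j x : A x -> has_grad (fun z : 'rV[R]_d => z 0 i * w j z) x (gH i j x).
  move=> Ax; apply: has_gradM; first exact: has_grad_coord.
  apply: has_gradD; first exact: has_gradM (jD _ _ Ax) (gy x).
  by apply: has_gradN; exact: has_gradM (jD _ _ Ax) (gb j x).
have cw j x : A x -> {for x, continuous (w j)}.
  move=> Ax; apply: contD; first by apply: contM => //; exact: cD.
  by apply: contN; apply: contM => //; exact: cD.
have cDw l j x : A x -> {for x, continuous (Dw l j)}.
  move=> Ax; apply: contD; [|apply: contN]; apply: contD; apply: contM => //; exact: cD.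
have cgH i j l x : A x -> {for x, continuous (fun z => gH i j z l)}.
  move=> Ax; apply: contD; apply: contM => //; [exact: cDw|exact: cw|exact: contc].
pose g i j (th : 'rV[R]_d) l := r * gH i j (r *: th) l.
have rot i j := @sphere_int_rot R d (fun th : 'rV[R]_d => (r *: th) 0 i * w j (r *: th)) (g i j) i j.
have rot' i j : sphC (fun x : 'rV[R]_d => x 0 i * g i j x j - x 0 j * g i j x i) /\
   sphere_int (fun x : 'rV[R]_d => x 0 i * g i j x j - x 0 j * g i j x i) = 0.
  apply: rot => th th1; split; first exact: (has_grad_scale (HgH i j _ (Ar _ th1))).
  move=> l; have cg : {for th, continuous (fun th : 'rV[R]_d => gH i j (r *: th) l)}.
    by apply: (csc (fun z => gH i j z l)); apply: cgH; exact: Ar.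
  exact: (contM (@contc R _ r th) cg).
have rotj i := @sphere_int_sum0 R d _ (index_enum 'I_d) _ d0 (fun j => (rot' i j).1) (fun j => (rot' i j).2).
have [_] := @sphere_int_sum0 R d _ (index_enum 'I_d) _ d0 (fun i => (rotj i).1) (fun i => (rotj i).2).
pose P (th : 'rV[R]_d) := r ^+ 2 * jL D [::] (r *: th) - jE2 D (r *: th) - (d%:R - 2) * jE D (r *: th)
     + k%:R * (k%:R + d%:R - 2) * D [::] (r *: th).
(* On the unit sphere the sum of rotation terms is r^k P y, the factor r^k coming from the
   homogeneity of y. *)
have ptw (th : 'rV[R]_d) : enorm th = 1 ->
    \sum_i \sum_j (th 0 i * g i j th j - th 0 j * g i j th i) = r ^+ k * (P th * y th).
  move=> th1; set x := r *: th.
  have := @rot_sum_identity R d (fun i => x 0 i) (fun i => D [:: i] x) (fun i => b i x)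
     (D [::] x) (y x) (fun l j => D [:: l; j] x) (fun l j => B l j x).
  rewrite /= => H; match type of H with ?T = _ => transitivity T end.
    apply: eq_bigr => i _; apply: eq_bigr => j _.
    rewrite /g /gH -/x [_ * (r * _)]mulrA [th 0 j * (r * _)]mulrA ![th 0 _ * r]mulrC.
    have xE l : r * th 0 l = x 0 l by rewrite mxE.
    by rewrite !xE.
  rewrite H.
  have -> : \sum_i B i i x = 0 by exact: yL.
  rewrite [\sum_i \sum_j x 0 i * x 0 j * B i j x](euler2 x Hy).
  have -> : \sum_j x 0 j * (D [:: j] x * y x - D [::] x * b j x) =
       (jE D x - k%:R * D [::] x) * y x.
    rewrite mulrBl -mulrA [D [::] x * y x]mulrC mulrA -(euler1 x Hy) mulrC /jE mulr_sumr.
    by rewrite mulr_suml -sumrB; apply: eq_bigr => j _; rewrite /b; ring.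
  have -> : \sum_i x 0 i ^+ 2 = r ^+ 2.
    by rewrite -/(sqn x) sqnZ -enorm_sqr th1 expr1n mulr1.
  have -> : y x = r ^+ k * y th by exact: yk.
  by rewrite /P -/x /jE2 /jL /=; ring.
have cE : sphC (fun th : 'rV[R]_d => jE D (r *: th)).
  move=> th th1; apply: csc; apply: cont_sum => i; apply: contM => //; exact/cD/Ar.
have cE2 : sphC (fun th : 'rV[R]_d => jE2 D (r *: th)).
  move=> th th1; apply: csc; apply: contD.
    by apply: cont_sum => i; apply: contM => //; exact/cD/Ar.
  apply: cont_sum => i; apply: cont_sum => j; apply: contM; last exact/cD/Ar.
  by apply: contM.
have cL : sphC (fun th : 'rV[R]_d => jL D [::] (r *: th)).
  by move=> th th1; apply: csc; apply: cont_sum => i; exact/cD/Ar.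
have c0 : sphC (fun th : 'rV[R]_d => D [::] (r *: th)).
  by move=> th th1; apply: csc; exact/cD/Ar.
have cys : sphC y by move=> th _.
have cPy : sphC (fun th : 'rV[R]_d => P th * y th).
  apply: sphCM => //; apply: sphCD; last by apply: sphCM => //; exact: sphCc.
  apply: sphCD; last by apply: sphCN; apply: sphCM => //; exact: sphCc.
  by apply: sphCD; [apply: sphCM => //; exact: sphCc|exact: sphCN].
have [csum _] := @sphere_int_sum0 R d _ (index_enum 'I_d) _ d0 (fun i => (rotj i).1) (fun i => (rotj i).2).
rewrite (@eq_sphere_int R d _ (fun th : 'rV[R]_d => r ^+ k * (P th * y th)) d0 csum); last first.
- exact: ptw.
- by apply: sphCM => //; exact: sphCc.
(* As r is nonzero, the factor r^k cancels. *)
rewrite sphere_intZ // => /eqP; rewrite mulf_eq0 expf_eq0 (negPf r0) andbF /= => /eqP P0.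
have := P0.
have -> : (fun th => P th * y th) = (fun th =>
   1 * (r ^+ 2 * (jL D [::] (r *: th) * y th) + (-1) * (jE2 D (r *: th) * y th)) +
   1 * (- (d%:R - 2) * (jE D (r *: th) * y th) +
         k%:R * (k%:R + d%:R - 2) * (D [::] (r *: th) * y th))).
  by apply/funext => th; rewrite /P; ring.
rewrite sphere_int_lin //; last 2 first.
- by apply: sphCD; apply: sphCM; try exact: sphCc; exact: sphCM.
- by apply: sphCD; apply: sphCM; try exact: sphCc; exact: sphCM.
rewrite !sphere_int_lin //; try exact: sphCM.
by move=> H; lra.
Qed.

(** * Logarithmic radius and differentiation along rays *)

Definition logI (R : realType) (r0 : R) (r1 : \bar R) : set R :=
  [set v | r0 < expR v /\ ((expR v)%:E < r1)%E].

Lemma logI_interval (R : realType) (r0 : R) (r1 : \bar R) a b v :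
  logI r0 r1 a -> logI r0 r1 b -> a <= v <= b -> logI r0 r1 v.
Proof.
move=> [a0 _] [_ b1] /andP[av vb]; split; first by apply: lt_le_trans a0 _; rewrite ler_expR.
by apply: le_lt_trans b1; rewrite lee_fin ler_expR.
Qed.

Lemma nbhs_logI (R : realType) (r0 : R) (r1 : \bar R) v : logI r0 r1 v -> \forall s \near v, logI r0 r1 s.
Proof.
move=> [v0 v1].
have h0 : \forall s \near v, r0 < expR s by apply: (cvgr_gt _ (@continuous_expR R v)).
case: r1 v1 => [r1| |//] v1; last by apply: filterS h0 => s s0; split=> //; rewrite ltry.
rewrite lte_fin in v1.
have h1 : \forall s \near v, expR s < r1 by apply: (cvgr_lt _ (@continuous_expR R v)).
by apply: filterS2 h0 h1 => s s0 s1; split=> //; rewrite lte_fin.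
Qed.

Lemma logI_delta (R : realType) (r0 : R) (r1 : \bar R) v : logI r0 r1 v ->
  exists delta, [/\ 0 < delta, logI r0 r1 (v - delta) & logI r0 r1 (v + delta)].
Proof.
move=> /nbhs_logI /nbhs_ballP[e /= e0 He].
exists (e / 2); split; first by rewrite divr_gt0.
  by apply: He; rewrite /ball /= opprB addrC subrK gtr0_norm ?divr_gt0 // ltr_pdivrMr // ltr_pMr // ltr1n.
apply: He; rewrite /ball /= opprD addrA subrr sub0r normrN gtr0_norm ?divr_gt0 //.
by rewrite ltr_pdivrMr // ltr_pMr // ltr1n.
Qed.

Lemma annulus_ray (R : realType) d (r0 : R) (r1 : \bar R) v (th : 'rV[R]_d) :
  logI r0 r1 v -> enorm th = 1 -> annulus r0 r1 (expR v *: th).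
Proof. by move=> [v0 v1] th1; rewrite /annulus /= enormZ th1 mulr1 ger0_norm ?expR_ge0. Qed.

(** These closed shells are the compact sets to which the growth hypothesis gets applied. *)
Definition shell (R : realType) d (a b : R) : set 'rV[R]_d := [set x | expR a <= enorm x <= expR b].

Lemma shell_ray (R : realType) d a b v (th : 'rV[R]_d) :
  a <= v <= b -> enorm th = 1 -> shell a b (expR v *: th).
Proof.
by move=> /andP[av vb] th1; rewrite /shell /= enormZ th1 mulr1 ger0_norm ?expR_ge0 // !ler_expR av.
Qed.

Lemma shell_annulus (R : realType) d (r0 : R) (r1 : \bar R) a b :
  logI r0 r1 a -> logI r0 r1 b -> @shell R d a b `<=` annulus r0 r1.
Proof.
move=> [a0 _] [_ b1] x /andP[xa xb]; split; first exact: lt_le_trans a0 xa.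
by apply: le_lt_trans b1; rewrite lee_fin.
Qed.

Lemma compact_shell (R : realType) d a b : compact (@shell R d a b).
Proof.
apply: (@subclosed_compact _ _ [set x : 'rV[R]_d | forall i, `[- expR b, expR b]%classic (x 0 i)]).
- have -> : @shell R d a b = @enorm R d @^-1` `[expR a, expR b]%classic.
    by apply/seteqP; split => x /=; rewrite /shell /= in_itv.
  apply: closed_comp; last exact: itv_closed.
  by move=> x _; exact: continuous_enorm.
- exact: (@rV_compact R d (fun=> `[- expR b, expR b]%classic) (fun=> @segment_compact R _ _)).
- move=> x /andP[_ xb] i /=; rewrite in_itv /= -ler_norml; apply: le_trans xb.
  rewrite -(@ler_pXn2r _ 2) ?nnegrE ?enorm_ge0 // enorm_sqr real_normK ?num_real //.
  exact: coord_sqn.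
Qed.

Lemma open_annulus (R : realType) d (r0 : R) (r1 : \bar R) (x : 'rV[R]_d) :
  annulus r0 r1 x -> \forall y \near x, annulus r0 r1 y.
Proof.
move=> [x0 x1].
have h0 : \forall s \near x, r0 < enorm s by apply: (cvgr_gt _ (@continuous_enorm R d x)).
case: r1 x1 => [r1| |//] x1; last by apply: filterS h0 => s s0; split=> //; rewrite ltry.
rewrite lte_fin in x1.
have h1 : \forall s \near x, enorm s < r1 by apply: (cvgr_lt _ (@continuous_enorm R d x)).
by apply: filterS2 h0 h1 => s s0 s1; split=> //; rewrite lte_fin.
Qed.

Definition Sint (R : realType) d (F y : 'rV[R]_d -> R) (v : R) : R :=
  sphere_int (fun th => F (expR v *: th) * y th).

Lemma sphC_ray (R : realType) d (r0 : R) (r1 : \bar R) (F y : 'rV[R]_d -> R) v :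
  (forall x, annulus r0 r1 x -> {for x, continuous F}) -> continuous y -> logI r0 r1 v ->
  sphC (fun th => F (expR v *: th) * y th).
Proof.
move=> cF cy Jv th th1; apply: contM; last exact: cy.
apply: (@continuous_comp _ _ _ (fun z : 'rV[R]_d => expR v *: z) F); first exact: scaler_continuous.
by apply: cF; exact: annulus_ray.
Qed.

(** Differentiation in v replaces F by x . grad F; compactness of a shell around the radius e^v
    supplies the uniform bound. *)
Lemma is_derive_Sint (R : realType) d (r0 : R) (r1 : \bar R) (F y : 'rV[R]_d -> R) (gF : 'rV[R]_d -> 'I_d -> R) v :
  (0 < d)%N -> continuous y ->
  (forall x, annulus r0 r1 x -> has_grad F x (gF x)) ->
  (forall x, annulus r0 r1 x -> {for x, continuous (fun x : 'rV[R]_d => \sum_l x 0 l * gF x l)}) ->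
  logI r0 r1 v ->
  is_derive v 1 (Sint F y) (Sint (fun x : 'rV[R]_d => \sum_l x 0 l * gF x l) y v).
Proof.
move=> d0 cy HF cE Jv; set EF := fun x : 'rV[R]_d => _.
have [delta [dl0 Ja Jb]] := logI_delta Jv.
have [M [M0 HM]] := @compact_fun_bounded R _ _ EF (@compact_shell R d (v - delta) (v + delta))
  (fun x Kx => cE x (shell_annulus Ja Jb Kx)).
have [N [N0 HN]] := @compact_fun_bounded R _ _ y (@sphere_compact R d) (fun x _ => cy x).
have near_v s : `|s - v| < delta -> v - delta <= s <= v + delta.
  by rewrite ltr_norml => /andP[? ?]; apply/andP; split; lra.
have Js s : `|s - v| < delta -> logI r0 r1 s by move=> /near_v; exact: logI_interval.
have cF x : annulus r0 r1 x -> {for x, continuous F}.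
  by move=> Ax; exact: has_grad_continuous (HF x Ax).
apply: (@is_derive_sphere_int R d (fun s th => F (expR s *: th) * y th)
   (fun s th => EF (expR s *: th) * y th) v delta (M * N)) => //.
- by rewrite mulr_ge0.
- by move=> s /Js; exact: sphC_ray.
- exact: (sphC_ray cE).
- move=> s th sd th1.
  have H := is_derive_ray (HF _ (annulus_ray (Js s sd) th1)).
  have -> : (fun u => F (expR u *: th) * y th) = y th \*: (fun u => F (expR u *: th)).
    by apply/funext => u /=; rewrite mulrC.
  by apply: (is_derive_eq (is_deriveZ (y th) H)); rewrite /GRing.scale /= mulrC.
- move=> s sd th th1; rewrite normrM ler_pM //; last exact: HN.
  by apply: HM; apply: shell_ray => //; exact: near_v.
Qed.

(** * The hierarchy of sphere integrals of iterated Laplacians *)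

Section RadialSystem.
Variables (R : realType) (d : nat) (r0 : R) (r1 : \bar R).
Let A : set 'rV[R]_d := annulus r0 r1.

Fixpoint pdsR (s : seq 'I_d) (h : 'rV[R]_d -> R) : 'rV[R]_d -> R :=
  if s is i :: s' then (fun x => 'D_(evec i) (pdsR s' h) x) else h.

Fixpoint jtower (h : 'rV[R]_d -> R) (p : nat) : seq 'I_d -> 'rV[R]_d -> R :=
  if p is p'.+1 then jL (jtower h p') else (fun s => pdsR s h).

Lemma jet_tower h p : (forall s x, A x -> differentiable (pdsR s h) x) -> jet A (jtower h p).
Proof.
move=> sm; elim: p => [|p IH] s x Ax /=; first by split=> //; exact: sm.
rewrite /jL; exact: (has_grad_sum (index_enum 'I_d) (fun i => IH (s ++ [:: i; i]) x Ax)).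
Qed.

(** The two agree on the annulus only; that suffices for the induction because the annulus is open
    and derivatives are local. *)
Lemma iter_laplR h p : (forall s x, A x -> differentiable (pdsR s h) x) ->
  forall x, A x -> iter p (@laplR R d) h x = jtower h p [::] x.
Proof.
move=> sm; elim: p => [//|p IH] x Ax.
have jD := jet_tower p sm.
have near_eq (f g : 'rV[R]_d -> R) : (forall z, A z -> f z = g z) ->
    forall z i, A z -> 'D_(evec i) f z = 'D_(evec i) g z.
  move=> fg z i Az; apply: near_eq_derive.
  by apply: filterS (open_annulus Az) => u; exact: fg.
rewrite iterS /= /laplR /jL /=; apply: eq_bigr => i _.
rewrite (near_eq _ (jtower h p [:: i])) //.
  by have [_ ->] := jD [:: i] x Ax.
move=> z Az; rewrite (near_eq _ (jtower h p [::])) //.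
by have [_ ->] := jD [::] z Az.
Qed.

(** G p stands for the sphere integral of Delta^p h(e^v theta) y(theta), G1 p for its derivative,
    and cc for k(k+d-2). Every clause is stable under linear combination, which later rebuilds the
    complex coefficient from real ones. *)
Definition radial_sys (tau cc : R) (G G1 : nat -> R -> R) :=
  [/\ forall p v, logI r0 r1 v -> is_derive v 1 (G p) (G1 p v),
      forall p v, logI r0 r1 v ->
        is_derive v 1 (G1 p) (expR v ^+ 2 * G p.+1 v - (d%:R - 2) * G1 p v + cc * G p v) &
      forall a b sigma, logI r0 r1 a -> logI r0 r1 b -> tau < sigma -> exists C, 0 <= C /\
        forall p v, a <= v <= b -> `|G p v| <= C * ((p.*2)`!)%:R * sigma ^+ p.*2].

(** The first equation is [is_derive_Sint]. Applied once more it produces the squared Euler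
    operator, which [sphere_ode] at radius e^v converts into the second equation. *)
Lemma radial_sys_exists (tau : R) k (h y : 'rV[R]_d -> R) :
  (0 < d)%N -> 0 <= r0 -> harm_homogR k y ->
  (forall s x, A x -> differentiable (pdsR s h) x) ->
  (forall K : set 'rV[R]_d, compact K -> K `<=` A -> forall eps, 0 < eps ->
     exists CK, 0 < CK /\ forall p x, K x ->
        `|iter p (@laplR R d) h x| <= CK * ((p.*2)`!)%:R * (tau + eps) ^+ (p.*2)) ->
  exists G G1, radial_sys tau (k%:R * (k%:R + d%:R - 2)) G G1 /\ forall v, G 0 v = Sint h y v.
Proof.
move=> d0 r00 Hy sm bd; have [/polyf_grad[_ gy] _ _] := Hy.
have cy : continuous y by move=> x; exact: has_grad_continuous (gy x).
pose D p := jtower h p.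
have jD p : jet A (D p) by exact: jet_tower.
have cD p s x (Ax : A x) : {for x, continuous (D p s)} := has_grad_continuous (jD p s x Ax).
have cco a (x : 'rV[R]_d) : {for x, continuous (fun y : 'rV[R]_d => y 0 a)} := has_grad_continuous (has_grad_coord x a).
have cE p x : A x -> {for x, continuous (jE (D p))}.
  by move=> Ax; apply: cont_sum => i; apply: contM => //; exact: cD.
have cE2 p x : A x -> {for x, continuous (jE2 (D p))}.
  move=> Ax; apply: contD; first exact: cE.
  apply: cont_sum => i; apply: cont_sum => j; apply: contM; last exact: cD.
  by apply: contM.
exists (fun p => Sint (D p [::]) y), (fun p => Sint (jE (D p)) y); split; last by [].
split.
- move=> p v Jv; apply: (@is_derive_Sint R d r0 r1 _ _ (fun x l => D p [:: l] x)) => //; first exact: jD.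
  exact: cE.
- move=> p v Jv.
  have gE x : A x -> has_grad (jE (D p)) x (fun l => \sum_i (x 0 i * D p [:: l; i] x + D p [:: i] x * (l == i)%:R)).
    move=> Ax; apply: (has_grad_sum (index_enum 'I_d)) => i.
    by apply: has_gradM; [exact: has_grad_coord|exact: jD].
  have EE : (fun x : 'rV[R]_d => \sum_l x 0 l * \sum_i (x 0 i * D p [:: l; i] x + D p [:: i] x * (l == i)%:R)) =
     jE2 (D p).
    apply/funext => x; rewrite /jE2 /jE -big_split; apply: eq_bigr => l _ /=.
    have S : \sum_i D p [:: i] x * (l == i)%:R = D p [:: l] x.
      by rewrite (bigD1 l) //= eqxx mulr1 big1 ?addr0 // => i il; rewrite eq_sym (negPf il) mulr0.
    rewrite big_split /= S mulrDr addrC; congr (_ + _).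
    by rewrite mulr_sumr; apply: eq_bigr => i _; rewrite mulrA.
  have := @is_derive_Sint R d r0 r1 (jE (D p)) y _ v d0 cy gE.
  rewrite EE => /(_ (cE2 p) Jv); move/is_derive_eq; apply.
  have := @sphere_ode R d A (D p) k y (expR v) d0 (jD p) Hy (lt0r_neq0 (expR_gt0 v))
    (fun th => annulus_ray Jv).
  have alg (e2 s2 s1 s0 c1 c2 : R) : e2 = s2 + c1 * s1 - c2 * s0 -> s2 = e2 - c1 * s1 + c2 * s0.
    by move=> ->; ring.
  exact: alg.
- move=> a b sigma Ja Jb ts.
  (* With eps = sigma - tau the hypothesis gives growth with base exactly sigma on the shell. *)
  have [CK [CK0 HK]] := bd _ (@compact_shell R d a b) (shell_annulus Ja Jb) (sigma - tau) ltac:(lra).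
  have [N [N0 HN]] := @compact_fun_bounded R _ _ y (@sphere_compact R d) (fun x _ => cy x).
  exists (d%:R * 2 ^+ d * (CK * N)); split.
    by rewrite !mulr_ge0 // ?exprn_ge0 // ltW.
  move=> p v vab; have Jv := logI_interval Ja Jb vab.
  have cS : sphC (fun th => D p [::] (expR v *: th) * y th) by apply: (sphC_ray (cD p [::])).
  have B0 : 0 <= CK * ((p.*2)`!)%:R * sigma ^+ p.*2.
    apply: mulr_ge0; first by apply: mulr_ge0; rewrite ?ler0n // ltW.
    by rewrite -mul2n exprM exprn_ge0 // sqr_ge0.
  apply: le_trans (sphere_int_bound d0 cS (M := CK * ((p.*2)`!)%:R * sigma ^+ p.*2 * N) _ _) _.
  + by rewrite mulr_ge0.
  + move=> th th1; rewrite normrM ler_pM //; last exact: HN.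
    rewrite /D -(iter_laplR p sm); last exact: annulus_ray.
    by have := HK p (expR v *: th) (shell_ray vab th1); rewrite addrC subrK.
  + by rewrite le_eqVlt; apply/orP; left; apply/eqP; ring.
Qed.

End RadialSystem.

(** * Closed form of the operators D^(n) *)

(** Absorbs a factor n+1 into a slightly larger geometric base. *)
Lemma succ_le_geom (R : realType) (q : R) : 1 < q -> exists C, 0 < C /\ forall n, n.+1%:R <= C * q ^+ n.
Proof.
move=> q1; have q0 : 0 < q - 1 by rewrite subr_gt0.
exists (1 + (q - 1)^-1); split; first by rewrite addr_gt0 // invr_gt0.
elim=> [|n IH]; first by rewrite expr0 mulr1 lerDl invr_ge0 ltW.
rewrite exprS -addn1 natrD; set C := 1 + _ in IH *.
have C0 : 1 <= (q - 1) * C by rewrite /C mulrDr mulr1 divff ?gt_eqF // lerDr ltW.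
have qn : 1 <= q ^+ n by rewrite exprn_ege1 // ltW.
have -> : C * (q * q ^+ n) = C * q ^+ n + (q - 1) * C * q ^+ n by ring.
by apply: lerD => //; rewrite -[leLHS]mulr1; apply: ler_pM.
Qed.

Definition lamR (R : realType) (d k n : nat) : R := (lam d k n)%:~R.

Lemma lam_even d k p : lam d k p.*2 = (k + p.*2)%:Z.
Proof. by rewrite /lam odd_double. Qed.

Lemma lam_odd d k p : lam d k p.*2.+1 = (p.*2.+2)%:Z - k%:Z - d%:Z.
Proof. by rewrite /lam /= odd_double /=; lia. Qed.

Lemma lamR_even (R : realType) d k p : lamR R d k p.*2 = k%:R + (p.*2)%:R.
Proof. by rewrite /lamR lam_even -natrD. Qed.

Lemma lamR_odd (R : realType) d k p : lamR R d k p.*2.+1 = (p.*2)%:R + 2 - k%:R - d%:R.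
Proof. by rewrite /lamR lam_odd !rmorphB /= -!pmulrn -addn2 natrD. Qed.

(** The closed form of D^(n) applied to the radial coefficient G 0. *)
Definition Eseq (R : realType) (k : nat) (G G1 : nat -> R -> R) (n : nat) (v : R) : R :=
  expR v ^+ (n./2).*2 * (if odd n then G1 n./2 v - k%:R * G n./2 v else G n./2 v).

Lemma Eseq_even (R : realType) k G G1 p (v : R) : Eseq k G G1 p.*2 v = expR v ^+ p.*2 * G p v.
Proof. by rewrite /Eseq odd_double doubleK. Qed.

Lemma Eseq_odd (R : realType) k G G1 p (v : R) :
  Eseq k G G1 p.*2.+1 v = expR v ^+ p.*2 * (G1 p v - k%:R * G p v).
Proof. by rewrite /Eseq /= odd_double /= uphalf_double. Qed.

Lemma is_derive_expRX (R : realType) m (v : R) :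
  is_derive v 1 (fun v : R => expR v ^+ m) (m%:R * expR v ^+ m).
Proof.
have := is_deriveX m (is_derive_expR v); rewrite /GRing.scale /=.
have -> : (@expR R ^+ m) = (fun v : R => expR v ^+ m) by rewrite exprfctE.
move/is_derive_eq; apply; case: m => [|m]; first by rewrite !mul0r.
by rewrite -mulrA -exprSr.
Qed.

Lemma is_deriveMf (R : realType) (f g : R -> R) (x df dg : R) : is_derive x 1 f df -> is_derive x 1 g dg ->
  is_derive x 1 (fun y => f y * g y) (f x * dg + g x * df).
Proof. by move=> Hf Hg; have := is_deriveM Hf Hg; rewrite /GRing.scale. Qed.

Lemma is_deriveBc (R : realType) (f g : R -> R) (c x df dg : R) : is_derive x 1 f df -> is_derive x 1 g dg ->
  is_derive x 1 (fun y => f y - c * g y) (df - c * dg).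
Proof.
move=> Hf Hg; have H := is_deriveB Hf (is_deriveZ c Hg).
exact: H.
Qed.

(** The second-order equation factors as (d/dv + k+d-2)(d/dv - k) G_p = e^{2v} G_{p+1}, and the
    weight e^{2pv} shifts the roots k and -k-d+2 by 2p, to lambda_{2p} and lambda_{2p+1}. *)
Lemma Eseq_deriv (R : realType) d k r0 r1 (tau : R) G G1 :
  radial_sys d r0 r1 tau (k%:R * (k%:R + d%:R - 2)) G G1 ->
  forall n v, logI r0 r1 v ->
  is_derive v 1 (Eseq k G G1 n) (Eseq k G G1 n.+1 v + lamR R d k n * Eseq k G G1 n v).
Proof.
move=> [dG dG1 _] n v Jv; rewrite -(odd_double_half n); move: (n./2) => p.
case: (odd n); rewrite ?add1n ?add0n.
- have H := is_deriveMf (is_derive_expRX p.*2 v) (is_deriveBc k%:R (dG1 p v Jv) (dG p v Jv)).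
  have -> : Eseq k G G1 p.*2.+1 = (fun y => expR y ^+ p.*2 * (G1 p y - k%:R * G p y)).
    by apply/funext => y; rewrite Eseq_odd.
  apply: (is_derive_eq H); rewrite -doubleS Eseq_even lamR_odd doubleS !exprS.
  by ring.
- have H := is_deriveMf (is_derive_expRX p.*2 v) (dG p v Jv).
  have -> : Eseq k G G1 p.*2 = (fun y => expR y ^+ p.*2 * G p y).
    by apply/funext => y; rewrite Eseq_even.
  by apply: (is_derive_eq H); rewrite Eseq_odd lamR_even; ring.
Qed.

Definition DopR (R : realType) (lam : nat -> R) (s : seq nat) (g : R -> R) : R -> R :=
  foldr (fun j h => fun v => derive1 h v - lam j * h v) g s.

Lemma DopR_rcons (R : realType) (lam : nat -> R) s j g :
  DopR lam (rcons s j) g = DopR lam s (fun v => derive1 g v - lam j * g v).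
Proof. by rewrite /DopR foldr_rcons. Qed.

(** The operator applies the factor of largest index first, whereas E is built starting from index
    0. The induction peels off d/dv - lambda_n: it turns E_m into E_{m+1} + (lambda_m - lambda_n)
    E_m, a sequence with the same recursion, whose n-th member is E_{n+1}. *)
Lemma DopR_seq (R : realType) (lam : nat -> R) (J : set R) n (E : nat -> R -> R) (g : R -> R) :
  (forall v, J v -> \forall s \near v, J s) ->
  (forall m v, J v -> is_derive v 1 (E m) (E m.+1 v + lam m * E m v)) ->
  (forall v, J v -> g v = E 0%N v) ->
  forall v, J v -> DopR lam (iota 0 n) g v = E n v.
Proof.
move=> oJ; elim: n E g => [|n IH] E g dE gE v Jv; first exact: gE.
rewrite -addn1 iotaD cats1 DopR_rcons add0n.
have dE' m u : J u -> is_derive u 1 (fun v => E m.+1 v + (lam m - lam n) * E m v)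
    ((E m.+2 u + (lam m.+1 - lam n) * E m.+1 u) + lam m * (E m.+1 u + (lam m - lam n) * E m u)).
  move=> Ju; have H := is_deriveD (dE m.+1 u Ju) (is_deriveZ (lam m - lam n) (dE m u Ju)).
  by apply: (is_derive_eq H); rewrite /GRing.scale /=; ring.
rewrite (IH _ _ dE') //; first by rewrite subrr mul0r addr0 addn1.
move=> u Ju; rewrite derive1E (@near_eq_derive _ _ _ g (E 0%N)); last first.
  by apply: filterS (oJ u Ju) => s; exact: gE.
by have [_ ->] := dE 0%N u Ju; rewrite gE //; ring.
Qed.

Lemma Dop_ReIm (R : realType) d k n (g : R -> R[i]) v :
  Dop d k n g v = Complex (DopR (lamR R d k) (iota 0 n) (fun v => complex.Re (g v)) v)
                          (DopR (lamR R d k) (iota 0 n) (fun v => complex.Im (g v)) v).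
Proof.
rewrite /Dop; move: (iota 0 n) => s; move: v.
elim: s => [|j s IH] v; first by rewrite /=; case: (g v).
have IHf := funext IH; rewrite /= in IHf *.
rewrite IHf /dC /=; congr Complex; rewrite ?mul0r ?subr0 ?addr0 //.
Qed.

(** * Growth of D^(n) *)

Lemma expR_bnd (R : realType) (m V c v : R) : `|c| <= m -> `|v| <= V -> expR (c * v) <= expR (m * V).
Proof.
move=> cm vV; rewrite ler_expR; apply: le_trans (ler_norm _) _.
by rewrite normrM ler_pM.
Qed.

(** For even n this is the growth of G_p. For odd n the quantity u_p = G_p' - k G_p is bounded by
    interpolation on [v, v + delta]: a mean value controls it at one point, and the first-order
    equation through G_{p+1} limits its variation. The bound on G_{p+1} costs (2p+2)! in place of
    (2p+1)!, a factor n+1 that the gap between sg and sigma absorbs. *)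
Lemma Eseq_bound (R : realType) d k r0 r1 (tau : R) G G1 : (1 < d)%N -> 0 <= tau ->
  radial_sys d r0 r1 tau (k%:R * (k%:R + d%:R - 2)) G G1 ->
  forall a b sigma, logI r0 r1 a -> logI r0 r1 b -> tau < sigma -> exists C, 0 <= C /\
    forall n v, a <= v <= b -> `|Eseq k G G1 n v| <= C * (n`!)%:R * sigma ^+ n * expR v ^+ n.
Proof.
move=> d1 tau0 [dG dG1 bG] a b sigma Ja Jb ts.
have [delta [dl0 _ Jbd]] := logI_delta Jb.
pose sg := (tau + sigma) / 2.
have tsg : tau < sg by rewrite /sg; lra.
have sgs : sg < sigma by rewrite /sg; lra.
have sg0 : 0 < sg by lra.
have sg0' := ltW sg0; have dl0' := ltW dl0.
have [CG [CG0 HG]] := bG a (b + delta) sg Ja Jbd tsg.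
have q1 : 1 < sigma / sg by rewrite ltr_pdivlMr // mul1r.
have [Cq [Cq0 Hq]] := succ_le_geom q1.
pose V := `|a| + `|b| + delta; pose m : R := 2 * k%:R + d%:R.
have k0 : 0 <= k%:R :> R by exact: ler0n.
have d2 : 2 <= d%:R :> R by rewrite ler_nat.
(* B dominates every exponential e^{cv} with |c| <= m that occurs below, over the whole interval
   [a, b + delta]. *)
pose B := expR (m * V).
have Vb v : a <= v <= b + delta -> `|v| <= V.
  move=> /andP[av vb]; rewrite /V ler_norml; apply/andP; split.
    by have := ler_norm (- a); rewrite normrN; have := normr_ge0 b; lra.
  by have := ler_norm b; have := normr_ge0 a; lra.
have Bb (c v : R) : `|c| <= m -> a <= v <= b + delta -> expR (c * v) <= B.
  by move=> cm /Vb; exact: expR_bnd.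
have B1 : 1 <= B.
  rewrite -expR0 ler_expR; apply: mulr_ge0; first by rewrite /m; lra.
  by rewrite /V; have := normr_ge0 a; have := normr_ge0 b; lra.
have B0 : 0 < B by lra.
have B0' := ltW B0; have BV0 : 0 <= B^-1 by rewrite invr_ge0.
have dV0 : 0 <= delta^-1 by rewrite invr_ge0.
have sV0 : 0 <= sg^-1 by rewrite invr_ge0.
pose M p := CG * ((p.*2)`!)%:R * sg ^+ p.*2.
have M0 p : 0 <= M p.
  by apply: mulr_ge0; [apply: mulr_ge0; rewrite ?ler0n|rewrite exprn_ge0].
pose u p v := G1 p v - k%:R * G p v.
(* -s1 is the second root: u_p solves u' + s1 u = e^{2v} G_{p+1}. *)
pose s1 : R := k%:R + d%:R - 2.
have du p v : logI r0 r1 v -> is_derive v 1 (u p) (expR v ^+ 2 * G p.+1 v - s1 * u p v).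
  move=> Jv; apply: (is_derive_eq (is_deriveBc k%:R (dG1 p v Jv) (dG p v Jv))).
  by rewrite /u /s1; ring.
have dexp (c v : R) : is_derive v 1 (fun v : R => expR (c * v)) (expR (c * v) * c).
  have h0 : is_derive v 1 (fun u => c * u) c.
    by apply: (is_derive_eq (is_deriveZ c (is_derive_id v 1))); rewrite /GRing.scale /= mulr1.
  exact: (@is_derive1_comp R (@expR R) (fun u => c * u) v _ _ (is_derive_expR _) h0).
have ub p v : a <= v <= b -> `|u p v| <= B * (2 * B ^+ 2 / delta * M p + delta * B * M p.+1).
  move=> /andP[av vb].
  have J x : v <= x <= v + delta -> logI r0 r1 x.
    by move=> /andP[? ?]; apply: (logI_interval Ja Jbd); apply/andP; split; lra.
  have I x : v <= x <= v + delta -> a <= x <= b + delta.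
    by move=> /andP[? ?]; apply/andP; split; lra.
  (* Integrating factors: phi' is an exponential times psi, and psi' is an exponential times
     G_{p+1}. *)
  pose phi x := expR (- k%:R * x) * G p x.
  pose psi x := expR (s1 * x) * u p x.
  have dphi (x : R) : v <= x <= v + delta -> is_derive x 1 phi (expR (- (k%:R + s1) * x) * psi x).
    move=> /J Jx; apply: (is_derive_eq (is_deriveMf (dexp (- k%:R) x) (dG p x Jx))).
    rewrite /psi [RHS]mulrA -expRD; have -> : - (k%:R + s1) * x + s1 * x = - k%:R * x by ring.
    by rewrite /u; ring.
  have dpsi (x : R) : v <= x <= v + delta -> is_derive x 1 psi (expR ((s1 + 2) * x) * G p.+1 x).
    move=> /J Jx; apply: (is_derive_eq (is_deriveMf (dexp s1 x) (du p x Jx))).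
    have -> : (s1 + 2) * x = s1 * x + x + x by ring.
    by rewrite !expRD; ring.
  have [xi /andP[vx xv] Hxi] : exists2 xi, v <= xi <= v + delta &
      phi (v + delta) - phi v = expR (- (k%:R + s1) * xi) * psi xi * delta.
    have [|||c] := @MVT_segment R phi (fun x => expR (- (k%:R + s1) * x) * psi x) v (v + delta).
    - by rewrite lerDl ltW.
    - by move=> x; rewrite in_itv /= => /andP[? ?]; apply: dphi; rewrite !ltW.
    - apply: derivable_within_continuous => x; rewrite in_itv /= => xab.
      by have [] := dphi x xab.
    - rewrite in_itv /= => cI ->; exists c => //.
      by congr (_ * _); ring.
  have vI : v <= v <= v + delta by rewrite lexx lerDl ltW.
  have vdI : v <= v + delta <= v + delta by rewrite lexx lerDl ltW.
  have xI : v <= xi <= v + delta by rewrite vx.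
  have phib x : v <= x <= v + delta -> `|phi x| <= B * M p.
    move=> xx; rewrite /phi normrM (ger0_norm (expR_ge0 _)) ler_pM ?expR_ge0 //.
      by apply: Bb; rewrite ?normrN ?ger0_norm //; [rewrite /m; lra|exact: I].
    by apply: HG; exact: I.
  have psixi : `|psi xi| <= 2 * B ^+ 2 / delta * M p.
    have -> : psi xi = expR ((k%:R + s1) * xi) * ((phi (v + delta) - phi v) / delta).
      by rewrite Hxi mulfK ?gt_eqF // [RHS]mulrA -expRD mulNr addrN expR0 mul1r.
    rewrite normrM (ger0_norm (expR_ge0 _)).
    have -> : 2 * B ^+ 2 / delta * M p = B * ((B * M p + B * M p) / delta) by field; rewrite gt_eqF.
    rewrite ler_pM ?expR_ge0 //.
      apply: Bb; last exact: I.
      by rewrite ger0_norm /s1 /m; lra.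
    rewrite normrM normfV (gtr0_norm dl0) ler_wpM2r //.
    apply: (le_trans (ler_normB _ _)); apply: lerD; exact: phib.
  have psiv : `|psi v - psi xi| <= delta * B * M p.+1.
    have mm x : Num.min xi v <= x <= Num.max xi v -> v <= x <= v + delta.
      by rewrite ge_min le_max => /andP[/orP[?|?] /orP[?|?]]; apply/andP; split; lra.
    apply: le_trans (@lip_of_deriv R psi _ xi v (B * M p.+1) (fun x Hx => dpsi x (mm x Hx)) _) _.
      move=> x /mm Hx; rewrite normrM (ger0_norm (expR_ge0 _)) ler_pM ?expR_ge0 //.
        by apply: Bb; [rewrite ger0_norm /s1 /m; lra|exact: I].
      by apply: HG; exact: I.
    have -> : delta * B * M p.+1 = B * M p.+1 * delta by ring.
    have BM : 0 <= B * M p.+1 by apply: mulr_ge0.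
    by apply: (ler_wpM2l BM); rewrite distrC ger0_norm; lra.
  have -> : u p v = expR (- s1 * v) * psi v by rewrite /psi [RHS]mulrA -expRD mulNr addNr expR0 mul1r.
  rewrite normrM (ger0_norm (expR_ge0 _)) ler_pM ?expR_ge0 //.
    apply: Bb; last exact: I.
    by rewrite normrN ger0_norm /s1 /m; lra.
  have -> : psi v = psi xi + (psi v - psi xi) by ring.
  by apply: (le_trans (ler_normD _ _)); exact: lerD.
(* One factor B comes from [ub], the other pays for the missing e^v through B^{-1} <= e^v; the
   powers of sg bring the bounds for p and p+1 to the common exponent 2p+1. *)
pose C2 := B ^+ 2 * (2 * B ^+ 2 / delta * sg^-1 + delta * B * sg) * CG.
have C20 : 0 <= C2.
  have s2 : 0 <= B ^+ 2 by exact: sqr_ge0.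
  by do ?[apply: mulr_ge0 => //|apply: addr_ge0 => //].
have key n v : a <= v <= b ->
    `|Eseq k G G1 n v| <= (CG + C2) * (n.+1%:R * (n`!)%:R * sg ^+ n) * expR v ^+ n.
  move=> vab; have vab' : a <= v <= b + delta.
    by move: vab => /andP[? ?]; apply/andP; split; lra.
  have P0 l : 0 <= l.+1%:R * (l`!)%:R * sg ^+ l by rewrite !mulr_ge0 ?ler0n // exprn_ge0.
  rewrite -(odd_double_half n); move: (n./2) => p; case: (odd n); rewrite ?add1n ?add0n.
    rewrite Eseq_odd normrM (ger0_norm (exprn_ge0 _ (expR_ge0 _))).
    apply: (@le_trans _ _ (C2 * (p.*2.+2%:R * (p.*2.+1`!)%:R * sg ^+ p.*2.+1) * expR v ^+ p.*2.+1)); last first.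
      by rewrite ler_wpM2r ?exprn_ge0 ?expR_ge0 // ler_wpM2r ?lerDr.
    rewrite [leRHS](_ : _ = expR v ^+ p.*2 *
      (expR v * (C2 * (p.*2.+2%:R * (p.*2.+1`!)%:R * sg ^+ p.*2.+1)))); last first.
      by rewrite !(exprS _ p.*2); ring.
    apply: ler_wpM2l; first by rewrite exprn_ge0 // expR_ge0.
    (* In odd order the weight is only e^{2pv}, one factor e^v short of the claimed e^{nv}. *)
    have Bv : B^-1 <= expR v.
      rewrite -[v]opprK expRN lef_pV2 ?posrE ?expR_gt0 // -mulN1r.
      by apply: Bb => //; rewrite normrN1 /m; lra.
    apply: le_trans (ub p v vab) _.
    set F : R := p.*2.+2%:R * (p.*2.+1`!)%:R.
    have F2 : ((p.+1.*2)`!)%:R = F by rewrite doubleS factS natrM.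
    have F1 : ((p.*2)`!)%:R <= F.
      rewrite /F factS natrM mulrA ler_peMl ?ler0n // -natrM ler1n //.
    have F0 : 0 <= F by rewrite /F mulr_ge0 ?ler0n.
    have S0 : 0 <= sg ^+ p.*2 by rewrite exprn_ge0.
    apply: (@le_trans _ _ (B^-1 * (C2 * (F * sg ^+ p.*2.+1)))); last first.
      by rewrite ler_wpM2r // mulr_ge0 // mulr_ge0 // exprn_ge0.
    have -> : B^-1 * (C2 * (F * sg ^+ p.*2.+1)) =
       B * (2 * B ^+ 2 / delta * (CG * F * sg ^+ p.*2) + delta * B * (CG * F * sg ^+ p.*2.+2)).
      by rewrite /C2 !exprS; field; rewrite !gt_eqF.
    rewrite ler_wpM2l // lerD //.
      rewrite ler_wpM2l //; first by apply: mulr_ge0 => //; apply: mulr_ge0 => //; exact: sqr_ge0.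
      rewrite /M.
      by rewrite ler_wpM2r // ler_wpM2l.
    by rewrite /M F2 doubleS.
  rewrite Eseq_even normrM (ger0_norm (exprn_ge0 _ (expR_ge0 _))) mulrC.
  rewrite ler_wpM2r ?exprn_ge0 ?expR_ge0 //.
  apply: le_trans (HG p v vab') _.
  apply: (@le_trans _ _ (CG * (p.*2.+1%:R * (p.*2`!)%:R * sg ^+ p.*2))); last first.
    by rewrite ler_wpM2r ?lerDl.
  rewrite -mulrA ler_wpM2l // ler_wpM2r ?exprn_ge0 //.
  by rewrite ler_peMl ?ler0n // ler1n.
exists ((CG + C2) * Cq); split; first by rewrite mulr_ge0 ?addr_ge0 // ltW.
move=> n v vab; apply: le_trans (key n v vab) _.
rewrite ler_wpM2r ?exprn_ge0 ?expR_ge0 // -!mulrA ler_wpM2l ?addr_ge0 //.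
rewrite mulrCA [Cq * _]mulrCA ler_wpM2l ?ler0n //.
apply: le_trans (ler_wpM2r (exprn_ge0 _ (ltW sg0)) (Hq n)) _.
by rewrite -mulrA -exprMn divfK ?gt_eqF.
Qed.

(** * Divided differences of the exponential *)

(** The value q_n'(l j) at a root of q_n, as [deriv_prodXsubC_root] confirms. *)
Definition wden (R : realType) (l : nat -> R) (n j : nat) : R :=
  \prod_(i < n.+1 | i != j :> nat) (l j - l i).

Lemma deriv_prodXsubC_root (R : realType) (l : nat -> R) n (j : 'I_n.+1) :
  (deriv (\prod_(i < n.+1) ('X - (l i)%:P))).[l j] = wden l n j.
Proof.
rewrite (bigD1 j) //= derivM hornerD !hornerM derivXsubC hornerC mul1r hornerXsubC subrr mul0r addr0.
rewrite horner_prod /wden; apply: eq_bigr => i _.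
by rewrite hornerXsubC.
Qed.

Lemma wden_neq0 (R : realType) (l : nat -> R) n j : injective l -> wden l n j != 0.
Proof.
move=> lI; apply/prodf_neq0 => i ij; rewrite subr_eq0 (inj_eq lI) eq_sym //.
Qed.

Lemma wdenS (R : realType) (l : nat -> R) n j : (j <= n)%N ->
  wden l n.+1 j = wden l n j * (l j - l n.+1).
Proof.
move=> jn; rewrite /wden big_mkcond big_ord_recr /= -big_mkcond /=.
by rewrite ifT // gtn_eqF.
Qed.

(** The divided difference of the constant 1: its Lagrange interpolant at the n+1 nodes is 1 itself,
    and the left side is the coefficient of X^n in it. *)
Lemma sum_wdenV (R : realType) (l : nat -> R) n : injective l ->
  \sum_(j < n.+1) (wden l n j)^-1 = (n == 0%N)%:R.
Proof.
move=> lI.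
pose L (j : 'I_n.+1) : {poly R} := \prod_(i <- [seq l (val i) | i <- enum 'I_n.+1 & i != j]) ('X - i%:P).
pose P := \sum_(j < n.+1) (wden l n j)^-1 *: L j.
have szL j : size (L j) = n.+1.
  rewrite /L size_prod_XsubC size_map size_filter -(@eq_count _ (predC (pred1 j))) //.
  have := count_predC (pred1 j) (enum 'I_n.+1); rewrite size_enum_ord.
  by rewrite count_uniq_mem ?enum_uniq // mem_enum add1n => -[->].
have Lroot (j i : 'I_n.+1) : (L j).[l i] = if i == j then wden l n j else 0.
  rewrite /L big_map big_filter big_enum_cond /= horner_prod.
  case: eqVneq => [->|ij].
    by rewrite /wden; apply: eq_bigr => a _; rewrite hornerXsubC.
  by rewrite (bigD1 i) //= hornerXsubC subrr mul0r.
have Pr (i : 'I_n.+1) : P.[l i] = 1.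
  rewrite /P horner_sum (bigD1 i) //= hornerZ Lroot eqxx mulVf ?wden_neq0 //.
  by rewrite big1 ?addr0 // => j ji; rewrite hornerZ Lroot eq_sym (negPf ji) mulr0.
(* Two polynomials of degree at most n that agree at n+1 distinct points. *)
have P1 : P = 1.
  apply/eqP; rewrite -subr_eq0; apply/eqP.
  apply: (@roots_geq_poly_eq0 _ _ [seq l (val i) | i <- enum 'I_n.+1]).
  - apply/allP => _ /mapP[i _ ->]; by rewrite /root !hornerE Pr subrr.
  - by rewrite map_inj_uniq ?enum_uniq // => a b /lI /val_inj.
  - rewrite size_map size_enum_ord (leq_trans (size_polyD _ _)) // geq_max size_polyN size_poly1 /= andbT.
    apply: (leq_trans (size_sum _ _ _)); apply/bigmax_leqP => j _.
    by rewrite (leq_trans (size_scale_leq _ _)) // szL.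
have -> : \sum_(j < n.+1) (wden l n j)^-1 = P`_n.
  rewrite /P coef_sum; apply: eq_bigr => j _; rewrite coefZ.
  have := monic_prod_XsubC [seq l (val i) | i <- enum 'I_n.+1 & i != j] predT id.
  by rewrite monicE lead_coefE -/(L j) szL /= => /eqP ->; rewrite mulr1.
by rewrite P1 coef1.
Qed.

Lemma is_derive_sumf (R : realType) n (f : 'I_n -> R -> R) (x : R) (df : 'I_n -> R) :
  (forall i, is_derive x 1 (f i) (df i)) -> is_derive x 1 (fun y => \sum_(i < n) f i y) (\sum_(i < n) df i).
Proof.
elim: n f df => [|n IH] f df H.
  have -> : (fun y => \sum_(i < 0) f i y) = cst 0 by apply/funext => y; rewrite big_ord0.
  by rewrite big_ord0; exact: is_derive_cst.
have -> : (fun y => \sum_(i < n.+1) f i y) =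
    (fun y => \sum_(i < n) f (widen_ord (leqnSn n) i) y) + f ord_max.
  by apply/funext => y; rewrite big_ord_recr.
rewrite big_ord_recr /=; apply: is_deriveD; apply: IH => i; exact: H.
Qed.

(** The divided difference of lambda -> e^{lambda t} at l 0, ..., l n, which takes the place of t^n
    / n! in Taylor's formula. *)
Definition Phi (R : realType) (l : nat -> R) n (t : R) : R :=
  \sum_(j < n.+1) expR (l j * t) / wden l n j.

Lemma is_derive_expRM (R : realType) (c t : R) : is_derive t 1 (fun t => expR (c * t)) (c * expR (c * t)).
Proof.
have h0 : is_derive t 1 (fun u => c * u) c.
  by apply: (is_derive_eq (is_deriveZ c (is_derive_id t 1))); rewrite /GRing.scale /= mulr1.
have := @is_derive1_comp R (@expR R) (fun u => c * u) t _ _ (is_derive_expR _) h0.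
by rewrite mulrC.
Qed.

(** Under d/dt - l n the term j = n disappears, and in every other term the new factor l j - l n
    cancels the last factor of the denominator. *)
Lemma is_derive_Phi (R : realType) (l : nat -> R) n (t : R) : injective l ->
  is_derive t 1 (Phi l n) (l n * Phi l n t + if n is n'.+1 then Phi l n' t else 0).
Proof.
move=> lI.
have H j : is_derive t 1 (fun t => expR (l j * t) / wden l n j) (l j * expR (l j * t) / wden l n j).
  have -> : (fun t => expR (l j * t) / wden l n j) = (wden l n j)^-1 \*: (fun t => expR (l j * t)).
    by apply/funext => s /=; rewrite mulrC.
  by apply: (is_derive_eq (is_deriveZ _ (is_derive_expRM _ _))); rewrite /GRing.scale /= mulrC.
apply: (is_derive_eq (is_derive_sumf (fun j : 'I_n.+1 => H j))).
rewrite /Phi; case: n H => [|n] H.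
  by rewrite !big_ord_recr !big_ord0 /= !add0r addr0 mulrA.
rewrite mulr_sumr big_ord_recr [X in _ = X + _]big_ord_recr /= mulrA addrAC; congr (_ + _).
rewrite -big_split /=; apply: eq_bigr => j _.
rewrite wdenS; last by rewrite -ltnS.
have w0 := wden_neq0 n j lI.
have lj : l j - l n.+1 != 0 by rewrite subr_eq0 (inj_eq lI) ltn_eqF.
by field; rewrite w0.
Qed.

Lemma Phi0 (R : realType) (l : nat -> R) n : injective l -> Phi l n 0 = (n == 0%N)%:R.
Proof.
by move=> lI; rewrite -(sum_wdenV n lI); apply: eq_bigr => j _; rewrite mulr0 expR0 mul1r.
Qed.

(** * Lower bounds for the denominators *)

Lemma fact_le_prod (s : seq nat) : uniq s -> all (leq 1) s -> ((size s)`! <= \prod_(x <- s) x)%N.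
Proof.
have [n] := ubnP (size s); elim: n s => // n IH s sn us s1.
case: (posnP (size s)) => [|s0]; first by case: s us s1 sn => // *; rewrite big_nil.
(* Otherwise all entries would be distinct elements of {1, ..., size - 1}; such a large entry is
   removed and the induction continues. *)
have [x xs sx] : exists2 x, x \in s & (size s <= x)%N.
  apply/hasP; apply/negPn/negP => /hasPn H.
  have : {subset s <= iota 1 (size s).-1}.
    move=> x xs; rewrite mem_iota add1n prednK // (allP s1 x xs) /=.
    by rewrite ltnNge H.
  by move/(uniq_leq_size us); rewrite size_iota leqNgt ltn_predL s0.
rewrite (perm_big _ (perm_to_rem xs)) big_cons /=.
have sr := size_rem xs.
rewrite -(prednK s0) factS (prednK s0) leq_mul // -sr; apply: IH.
- by rewrite sr -ltnS prednK.
- exact: rem_uniq.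
- by apply/allP => y /mem_rem; exact: (allP s1).
Qed.

Lemma fact_le_prod_in (s : seq nat) (a : nat -> nat) : uniq s -> {in s &, injective a} ->
  {in s, forall i, (0 < a i)%N} -> ((size s)`! <= \prod_(i <- s) a i)%N.
Proof.
move=> us aI a0; rewrite -(size_map a s) -(big_map a predT id); apply: fact_le_prod.
  by rewrite map_inj_in_uniq.
by apply/allP => _ /mapP[i si ->]; exact: a0.
Qed.

Definition rk (lam : nat -> int) n j := count (fun i => lam i < lam j) (iota 0 n.+1).

Lemma rk_split (lam : nat -> int) n j : injective lam -> (j <= n)%N ->
  (rk lam n j + count (fun i => (lam j < lam i)%R) (iota 0 n.+1))%N = n.
Proof.
move=> lI jn.
have := count_predC (fun i => lam i < lam j) (iota 0 n.+1); rewrite size_iota -/(rk lam n j).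
have -> : count (predC (fun i => lam i < lam j)) (iota 0 n.+1) =
   (count (fun i => (lam j < lam i)%R) (iota 0 n.+1) + count (pred1 j) (iota 0 n.+1))%N.
  rewrite -count_predUI.
  rewrite [X in (_ + X)%N](_ : _ = 0%N) ?addn0.
    apply: eq_count => i /=; rewrite -leNgt le_eqVlt (inj_eq lI) orbC; congr (_ || _).
    exact: eq_sym.
  apply/eqP; rewrite -leqn0 leqNgt -has_count; apply/hasPn => i _ /=.
  by apply/negP => /andP[ij /eqP ji]; move: ij; rewrite ji ltxx.
rewrite count_uniq_mem ?iota_uniq // mem_iota /= add0n ltnS jn addn1 addnS => -[].
by [].
Qed.

(** The distances from lam j to the nodes below it are distinct positive integers, as are those to
    the nodes above it; each group has product at least the factorial of its size. *)
Lemma prod_dist_ge (lam : nat -> int) n j : injective lam -> (j <= n)%N ->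
  ((rk lam n j)`! * (n - rk lam n j)`! <= \prod_(i < n.+1 | i != j :> nat) absz (lam j - lam i)%R)%N.
Proof.
move=> lI jn.
rewrite -(big_mkord (fun i => i != j) (fun i => absz (lam j - lam i)%R)) /index_iota subn0.
rewrite (bigID (fun i => lam i < lam j)) /=.
have e1 : \prod_(i <- iota 0 n.+1 | (i != j) && (lam i < lam j)) absz (lam j - lam i)%R =
          \prod_(i <- [seq i <- iota 0 n.+1 | lam i < lam j]) absz (lam j - lam i)%R.
  rewrite big_filter; apply: eq_bigl => i; case: eqVneq => [->|//]; by rewrite ltxx.
have e2 : \prod_(i <- iota 0 n.+1 | (i != j) && ~~ (lam i < lam j)) absz (lam j - lam i)%R =
          \prod_(i <- [seq i <- iota 0 n.+1 | lam j < lam i]) absz (lam j - lam i)%R.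
  rewrite big_filter; apply: eq_bigl => i; rewrite -leNgt lt_neqAle (inj_eq lI) eq_sym //.
rewrite e1 e2.
have := rk_split lI jn; rewrite /rk -!size_filter => Hn.
rewrite -[X in (X - _)%N]Hn addKn.
by apply: leq_mul; apply: fact_le_prod_in; rewrite ?filter_uniq ?iota_uniq //;
  try (move=> a b; rewrite !mem_filter => /andP[Ha _] /andP[Hb _] ab; apply: lI; lia);
  move=> a; rewrite mem_filter => /andP[Ha _]; lia.
Qed.

Lemma count_ltn_iota m n : count (fun i => (i < m)%N) (iota 0 n) = minn m n.
Proof.
elim: n => [|n IH]; first by rewrite minn0.
rewrite -addn1 iotaD count_cat IH /= add0n addn0.
by case: ltnP => H; rewrite ?addn1 ?addn0; case: (leqP m n.+1) => H2; lia.
Qed.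

(** Every index i < lam j - c0 has lam i < lam j, and every i with lam i < lam j satisfies i < lam j
    + c0; counting these indices pins the rank down to within c0 of lam j. *)
Lemma rk_close (lam : nat -> int) (c0 n j : nat) : (forall i, (`|lam i - i%:Z| <= c0)%N) ->
  (j <= n)%N -> (`|lam j - (rk lam n j)%:Z| <= c0)%N.
Proof.
move=> Hl jn; have Hj := Hl j.
have up : (rk lam n j <= absz (lam j + c0%:Z)%R)%N.
  apply: (leq_trans (n := count (fun i => (i < absz (lam j + c0%:Z)%R)%N) (iota 0 n.+1))).
    apply: sub_count => i /= ij; have := Hl i; lia.
  by rewrite count_ltn_iota geq_minl.
have lo (m : nat) : m%:Z = lam j - c0%:Z -> (m <= rk lam n j)%N.
  move=> mE; apply: (leq_trans (n := count (fun i => (i < m)%N) (iota 0 n.+1))).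
    by rewrite count_ltn_iota leq_min leqnn /=; lia.
  apply: sub_count => i /= im; have := Hl i; lia.
case E : (lam j - c0%:Z) => [m|m]; last by lia.
have := lo m (esym E); lia.
Qed.

Lemma wden_ge (R : realType) (lam : nat -> int) n j : injective lam -> (j <= n)%N ->
  ((rk lam n j)`! * (n - rk lam n j)`!)%:R <= `|wden (fun i => (lam i)%:~R : R) n j|.
Proof.
move=> lI jn; have H := prod_dist_ge lI jn.
rewrite /wden normr_prod.
have -> : \prod_(i < n.+1 | i != j :> nat) `|(lam j)%:~R - (lam i)%:~R : R| =
   (\prod_(i < n.+1 | i != j :> nat) absz (lam j - lam i)%R)%:R.
  rewrite natr_prod; apply: eq_bigr => i _.
  by rewrite -rmorphB /= -intr_norm natr_absz.
by rewrite ler_nat.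
Qed.

Lemma exprz_bound (R : realType) (x : R) (m : int) c : 0 < x -> (`|m| <= c)%N ->
  x ^ m <= (x + x^-1) ^+ c.
Proof.
move=> x0 mc; have xi : 0 < x^-1 by rewrite invr_gt0.
have Y1 : 1 <= x + x^-1.
  have [x1|x1] := leP 1 x; first by rewrite (le_trans x1) // lerDl ltW.
  by rewrite (@le_trans _ _ x^-1) ?lerDr ?ltW // invf_gt1.
case: m mc => a /= ac.
  rewrite -exprnP; apply: (@le_trans _ _ ((x + x^-1) ^+ a)).
    by rewrite lerXn2r ?nnegrE ?addr_ge0 ?lerDl // ltW.
  exact: ler_weXn2l.
rewrite NegzE -exprnN -exprVn; apply: (@le_trans _ _ ((x + x^-1) ^+ a.+1)).
  by rewrite lerXn2r ?nnegrE ?addr_ge0 ?lerDr // ltW.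
exact: ler_weXn2l.
Qed.

(** With q the rank, x^{lam j} = x^{lam j - q} x^q. The first factor has exponent at most c0 in
    absolute value, and x^q / (q! (n-q)!) is a single term of the binomial expansion of (1+x)^n /
    n!. *)
Lemma wden_term_bound (R : realType) (lam : nat -> int) c0 n j (x : R) : injective lam ->
  (forall i, (`|lam i - i%:Z| <= c0)%N) -> (j <= n)%N -> 0 < x ->
  x ^ (lam j) / `|wden (fun i => (lam i)%:~R : R) n j| <= (x + x^-1) ^+ c0 * ((1 + x) ^+ n / (n`!)%:R).
Proof.
move=> lI Hl jn x0.
set q := rk lam n j.
have qn : (q <= n)%N by rewrite -[X in (_ <= X)%N](rk_split lI jn) leq_addr.
have -> : x ^ (lam j) = x ^ (lam j - q%:Z) * x ^+ q.
  by rewrite -[x ^+ q]/(x ^ q%:Z) -expfzDr ?gt_eqF // subrK.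
have w0 := wden_ge R lI jn.
have f0 : 0 < (q`! * (n - q)`!)%:R :> R by rewrite ltr0n muln_gt0 !fact_gt0.
rewrite -mulrA; apply: ler_pM.
- by rewrite exprz_ge0 // ltW.
- by rewrite divr_ge0 // exprn_ge0 // ltW.
- by apply: exprz_bound => //; exact: rk_close.
apply: (@le_trans _ _ (x ^+ q / (q`! * (n - q)`!)%:R)).
  rewrite ler_wpM2l ?exprn_ge0 ?(ltW x0) // lef_pV2 // posrE //.
  exact: lt_le_trans w0.
have nf : 0 < (n`!)%:R :> R by rewrite ltr0n fact_gt0.
rewrite ler_pdivrMr // mulrAC ler_pdivlMr //.
have E : (n`!)%:R = 'C(n, q)%:R * (q`! * (n - q)`!)%:R :> R by rewrite -natrM bin_fact.
rewrite E mulrA ler_pM2r //.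
rewrite exprDn (bigD1 (Ordinal (qn : (q < n.+1)%N))) //= expr1n mul1r mulr_natr lerDl.
by apply: sumr_ge0 => i _; rewrite mulrn_wge0 // mulr_ge0 ?exprn_ge0 // ltW.
Qed.

(** Within one parity class of indices the sequence is strictly increasing; across the classes the
    difference is 2k + d - 2 plus an even number, odd because d is. *)
Lemma lam_inj d k : odd d -> injective (lam d k).
Proof.
move=> od i j; rewrite -(odd_double_half i) -(odd_double_half j) -(odd_double_half d) od.
by case: (odd i); case: (odd j); rewrite ?add1n ?add0n /lam /= ?odd_double /=; lia.
Qed.

Lemma lam_close d k i : (1 < d)%N -> (`|lam d k i - i%:Z| <= k + d)%N.
Proof. by move=> d1; rewrite /lam; case: ifP => _; lia. Qed.

Lemma expR_exprz (R : realType) (m : int) (t : R) : expR (m%:~R * t) = expR t ^ m.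
Proof.
case: m => n; first by rewrite -pmulrn expRM_natl exprnP.
by rewrite NegzE mulrNz mulNr expRN -pmulrn expRM_natl exprnN.
Qed.

(** * Taylor expansion with remainder *)

(** In the base point w, E_n contributes E_{n+1} + l_n E_n and Phi_n(v - w) contributes -l_n Phi_n -
    Phi_{n-1}; the sum telescopes. *)
Lemma taylor_deriv (R : realType) (l : nat -> R) (E : nat -> R -> R) (v w : R) N : injective l ->
  (forall m, is_derive w 1 (E m) (E m.+1 w + l m * E m w)) ->
  is_derive w 1 (fun w => \sum_(n < N.+1) E n w * Phi l n (v - w)) (E N.+1 w * Phi l N (v - w)).
Proof.
move=> lI dE.
have dP n : is_derive w 1 (fun w => Phi l n (v - w))
   (- (l n * Phi l n (v - w) + if n is n'.+1 then Phi l n' (v - w) else 0)).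
  have h0 : is_derive w 1 (fun w => v - w) (- 1).
    have H := is_deriveB (is_derive_cst v w 1) (is_derive_id w 1).
    by apply: (is_derive_eq H); rewrite sub0r.
  have H := @is_derive1_comp R (Phi l n) (fun w => v - w) w _ _ (is_derive_Phi n (v - w) lI) h0.
  by apply: (@is_derive_eq _ _ _ (fun w => Phi l n (v - w)) _ _ _ _ H); rewrite mulrN1.
elim: N => [|N IH].
  have -> : (fun w => \sum_(n < 1) E n w * Phi l n (v - w)) = (fun w => E 0%N w * Phi l 0 (v - w)).
    by apply/funext => u; rewrite big_ord1.
  by apply: (is_derive_eq (is_deriveMf (dE 0%N) (dP 0%N))); ring.
have -> : (fun w => \sum_(n < N.+2) E n w * Phi l n (v - w)) =
   (fun w => \sum_(n < N.+1) E n w * Phi l n (v - w)) + (fun w => E N.+1 w * Phi l N.+1 (v - w)).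
  by apply/funext => u; rewrite [LHS]big_ord_recr.
apply: (is_derive_eq (is_deriveD IH (is_deriveMf (dE N.+1) (dP N.+1)))); ring.
Qed.

Lemma sq_succ_geom (R : realType) (kap : R) : 0 <= kap < 1 -> exists kap' C,
  [/\ 0 <= kap' < 1, 0 <= C & forall n, n.+1%:R ^+ 2 * kap ^+ n <= C * kap' ^+ n].
Proof.
(* q exceeds 1 by so little that q^2 kap stays below 1. *)
move=> /andP[k0 k1]; pose q := 1 + (1 - kap) / 4.
have q1 : 1 < q by rewrite /q; lra.
have [C [C0 HC]] := succ_le_geom q1.
exists (q ^+ 2 * kap), (C ^+ 2); split.
- by apply/andP; split; [rewrite mulr_ge0 ?sqr_ge0|rewrite /q; nra].
- exact: sqr_ge0.
- move=> n; rewrite exprMn mulrA ler_wpM2r ?exprn_ge0 // -exprM mulnC exprM -exprMn.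
  by rewrite lerXn2r ?nnegrE ?ler0n // (le_trans _ (HC n)) ?ler0n.
Qed.

Lemma cvg_geom0 (R : realType) (C kap : R) : 0 <= kap < 1 -> C * kap ^+ n @[n --> \oo] --> 0.
Proof.
move=> /andP[k0 k1]; rewrite -[X in _ --> X](mulr0 C); apply: cvgM; first exact: cvg_cst.
by apply: cvg_expr; rewrite ger0_norm.
Qed.

Lemma Phi_bound (R : realType) (lam : nat -> int) c0 n (t : R) : injective lam ->
  (forall i, (`|lam i - i%:Z| <= c0)%N) ->
  `|Phi (fun i => (lam i)%:~R) n t| <= n.+1%:R * ((expR t + (expR t)^-1) ^+ c0 * ((1 + expR t) ^+ n / (n`!)%:R)).
Proof.
move=> lI Hl; apply: le_trans (ler_norm_sum _ _ _) _.
rewrite mulr_natl -[X in _ *+ X]card_ord -sumr_const; apply: ler_sum => j _.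
rewrite normrM normfV (ger0_norm (expR_ge0 _)) expR_exprz.
by apply: wden_term_bound => //; [rewrite -ltnS|exact: expR_gt0].
Qed.

(** The remainder is a mean value bound for the telescoped derivative. The quotient (N+1)!/N! and
    the number of terms in Phi_N give (N+1)^2, and the powers combine to (sg (e^w + e^v))^N <= (2 sg
    rho)^N. *)
Lemma taylor_cvg (R : realType) (lam : nat -> int) c0 (E : nat -> R -> R) (v0 v C sg rho : R) :
  injective lam -> (forall i, (`|lam i - i%:Z| <= c0)%N) ->
  (forall m w, Num.min v0 v <= w <= Num.max v0 v ->
     is_derive w 1 (E m) (E m.+1 w + (lam m)%:~R * E m w)) ->
  0 <= C -> 0 <= sg ->
  (forall n w, Num.min v0 v <= w <= Num.max v0 v -> `|E n w| <= C * (n`!)%:R * sg ^+ n * expR w ^+ n) ->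
  expR v0 <= rho -> expR v <= rho -> 2 * sg * rho < 1 ->
  \sum_(n < N) E n v0 * Phi (fun i => (lam i)%:~R) n (v - v0) @[N --> \oo] --> E 0%N v.
Proof.
move=> lI Hl dE C0 sg0 bE r0 r1 sr.
have lI' : injective (fun i => (lam i)%:~R : R) by move=> i j /eqP; rewrite eqr_int => /eqP /lI.
have rho0 : 0 < rho by apply: lt_le_trans r0; exact: expR_gt0.
pose kap := 2 * sg * rho.
have kap01 : 0 <= kap < 1 by rewrite sr andbT !mulr_ge0 // ltW.
have [kap' [C1 [kap'01 C10 HC1]]] := sq_succ_geom kap01.
pose Y0 := 2 * expR `|v - v0|.
have Y00 : 0 <= Y0 by rewrite mulr_ge0 // expR_ge0.
pose S N := \sum_(n < N) E n v0 * Phi (fun i => (lam i)%:~R) n (v - v0).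
have bnd N : `|E 0%N v - S N.+1| <= C * Y0 ^+ c0 * C1 * `|v - v0| * kap' ^+ N.
  (* As a function of the base point, W is the partial sum at w = v0 and equals E 0 v at w = v,
     where only Phi_0 survives. *)
  pose W w := \sum_(n < N.+1) E n w * Phi (fun i => (lam i)%:~R) n (v - w).
  have -> : E 0%N v = W v.
    rewrite /W big_ord_recl /= subrr Phi0 // mulr1 big1 ?addr0 // => i _.
    by rewrite Phi0 // mulr0.
  have H := @lip_of_deriv R W (fun w => E N.+1 w * Phi (fun i => (lam i)%:~R) N (v - w)) v0 v
     (C * Y0 ^+ c0 * C1 * kap' ^+ N).
  apply: (@le_trans _ _ (C * Y0 ^+ c0 * C1 * kap' ^+ N * `|v - v0|)); last first.
    by rewrite -mulrA [X in _ <= X](_ : _ = C * Y0 ^+ c0 * C1 * (kap' ^+ N * `|v - v0|)) //; ring.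
  apply: H => w ww; first by apply: taylor_deriv => // m; exact: dE.
  have wrho : expR w <= rho.
    apply: le_trans (_ : expR (Num.max v0 v) <= _).
      by rewrite ler_expR; case/andP: ww.
    by have [_|_] := leP v0 v.
  have [ew ev] : 0 < expR w /\ 0 < expR v by split; exact: expR_gt0.
  have wv : `|v - w| <= `|v - v0|.
    move: ww; have [vv|vv] := leP v0 v => /andP[h1 h2].
      by rewrite !ger0_norm ?subr_ge0 //; lra.
    by rewrite !ler0_norm ?subr_le0 ?(ltW vv) //; lra.
  have Yb : expR (v - w) + (expR (v - w))^-1 <= Y0.
    rewrite -expRN /Y0 mulr_natl mulr2n lerD // ler_expR.
      exact: le_trans (ler_norm _) wv.
    by apply: le_trans wv; rewrite -normrN ler_norm.
  rewrite normrM; apply: le_trans (ler_pM _ _ (bE N.+1 w ww) (Phi_bound N (v - w) lI Hl)) _ => //.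
  have nf : 0 < (N`!)%:R :> R by rewrite ltr0n fact_gt0.
  have -> : C * (N.+1`!)%:R * sg ^+ N.+1 * expR w ^+ N.+1 *
     (N.+1%:R * ((expR (v - w) + (expR (v - w))^-1) ^+ c0 * ((1 + expR (v - w)) ^+ N / (N`!)%:R))) =
     C * (expR (v - w) + (expR (v - w))^-1) ^+ c0 * (sg * expR w) *
       (N.+1%:R ^+ 2 * (sg * (expR w + expR v)) ^+ N).
    have -> : expR w + expR v = expR w * (1 + expR (v - w)).
      by rewrite mulrDr mulr1 -expRD; congr (_ + expR _); ring.
    by rewrite factS natrM !exprMn !exprS; field; rewrite gt_eqF.
  rewrite -!mulrA ler_wpM2l //.
  have sw1 : sg * expR w <= 1.
    have : sg * expR w <= sg * rho by rewrite ler_wpM2l.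
    have : 0 <= sg * rho by rewrite mulr_ge0 // ltW.
    lra.
  apply: ler_pM.
  - by rewrite exprn_ge0 // addr_ge0 ?invr_ge0 ?expR_ge0.
  - by rewrite !mulr_ge0 ?ler0n ?exprn_ge0 ?mulr_ge0 ?addr_ge0 ?expR_ge0.
  - by rewrite lerXn2r ?nnegrE ?addr_ge0 ?invr_ge0 ?expR_ge0.
  apply: le_trans (HC1 N); rewrite mulrA -[leRHS]mul1r.
  apply: ler_pM => //; first by rewrite mulr_ge0 // ltW.
    by rewrite !mulr_ge0 ?ler0n ?exprn_ge0 ?mulr_ge0 ?addr_ge0 ?expR_ge0.
  have kb : sg * (expR w + expR v) <= kap.
    have : sg * (expR w + expR v) <= sg * (rho + rho) by rewrite ler_wpM2l // lerD.
    by rewrite /kap; lra.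
  have kb0 : 0 <= sg * (expR w + expR v) by rewrite mulr_ge0 // addr_ge0 ?expR_ge0.
  have kap0 : 0 <= kap by case/andP: kap01.
  by rewrite mulrA -expr2 ler_wpM2l ?sqr_ge0 // lerXn2r.
rewrite -/(S _) -(cvg_shiftS S).
apply/cvgrPdist_le => e e0; near=> N.
apply: le_trans (bnd N) _.
near: N.
have := @cvg_geom0 R (C * Y0 ^+ c0 * C1 * `|v - v0|) kap' kap'01.
move=> /cvgrPdist_le /(_ e e0); apply: filterS => n; rewrite sub0r normrN.
exact: le_trans (ler_norm _).
Unshelve. all: by end_near. Qed.

(** * Geometric majorants and the complex modulus *)

(** The tail estimate depends only on C and kap, so it is uniform over any family of series with a
    common majorant. *)
Lemma geom_Mtest (R : realType) (u : nat -> R) (C kap : R) : 0 <= C -> 0 <= kap < 1 ->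
  (forall n, `|u n| <= C * kap ^+ n) ->
  forall N, `|\sum_(n < N) u n - limn (fun N => \sum_(n < N) u n)| <= C / (1 - kap) * kap ^+ N.
Proof.
move=> C0 k01 Hu; have /andP[k0 k1] := k01.
have k1' : 0 < 1 - kap by rewrite subr_gt0.
pose U N := \sum_(n < N) u n.
have tail N M : (N <= M)%N -> `|U N - U M| <= C / (1 - kap) * (kap ^+ N - kap ^+ M).
  move=> /subnK <-; elim: (M - N)%N => [|m IH]; first by rewrite !subrr normr0 mulr0.
  rewrite addSn /U big_ord_recr /= -/(U (m + N)%N) opprD addrA.
  apply: (le_trans (ler_normB _ _)).
  apply: (le_trans (lerD IH (Hu _))).
  rewrite exprS [leRHS](_ : _ = C / (1 - kap) * (kap ^+ N - kap ^+ (m + N)) + C * kap ^+ (m + N)) //.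
  by field; rewrite gt_eqF.
have tail' N M : (N <= M)%N -> `|U N - U M| <= C / (1 - kap) * kap ^+ N.
  move=> NM; apply: le_trans (tail N M NM) _.
  by rewrite ler_wpM2l ?divr_ge0 ?(ltW k1') // gerBl exprn_ge0.
have cU : cvgn U.
  have -> : U = series u by apply/funext => n; rewrite /U /series /= big_mkord.
  apply: normed_cvg; apply: (@series_le_cvg _ _ (geometric C kap)) => [n|n|n|].
  - exact: normr_ge0.
  - by rewrite /= mulr_ge0 // exprn_ge0.
  - exact: Hu.
  - by apply: is_cvg_geometric_series; rewrite ger0_norm.
move=> N.
have h : `|U N - U M| @[M --> \oo] --> `|U N - limn U|.
  by apply: cvg_norm; apply: cvgB; [exact: cvg_cst|exact: cU].
apply: (cvgr_to_le h); near=> M; apply: tail'.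
by near: M; exact: nbhs_infty_ge.
Unshelve. all: by end_near. Qed.

Lemma cabs_normc (R : realType) (z : R[i]) : cabs z = Normc.normc z.
Proof. by case: z. Qed.

Lemma cabs_ge0 (R : realType) (z : R[i]) : 0 <= cabs z.
Proof. exact: sqrtr_ge0. Qed.

Lemma cabsM (R : realType) (z w : R[i]) : cabs (z * w) = cabs z * cabs w.
Proof. by rewrite !cabs_normc Normc.normcM. Qed.

Lemma cabs_real (R : realType) (x : R) : cabs (x%:C%C) = `|x|.
Proof. by rewrite /cabs /= expr0n addr0 sqrtr_sqr. Qed.

Lemma cabsXz (R : realType) (z : R[i]) (m : int) : cabs (z ^ m) = cabs z ^ m.
Proof.
have HX n : cabs (z ^+ n) = cabs z ^+ n.
  elim: n => [|n IH]; last by rewrite !exprS cabsM IH.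
  by rewrite !expr0 cabs_normc Normc.normc1.
case: m => n; first by rewrite -!exprnP.
by rewrite NegzE -!exprnN -HX !cabs_normc Normc.normcV.
Qed.

Lemma cabs_le (R : realType) (z : R[i]) : cabs z <= `|complex.Re z| + `|complex.Im z|.
Proof.
rewrite /cabs -(@ler_pXn2r _ 2) ?nnegrE ?sqrtr_ge0 ?addr_ge0 // sqr_sqrtr ?addr_ge0 ?sqr_ge0 //.
rewrite sqrrD !real_normK ?num_real // lerD2r lerDl mulrn_wge0 // mulr_ge0 //.
Qed.

Lemma Re_le_cabs (R : realType) (z : R[i]) : `|complex.Re z| <= cabs z.
Proof. by rewrite /cabs -sqrtr_sqr ler_wsqrtr // lerDl sqr_ge0. Qed.

Lemma Im_le_cabs (R : realType) (z : R[i]) : `|complex.Im z| <= cabs z.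
Proof. by rewrite /cabs -sqrtr_sqr ler_wsqrtr // lerDr sqr_ge0. Qed.

(** * Real and imaginary parts of the coefficient *)

Lemma pdsC_ReIm (R : realType) d (s : seq 'I_d) (f : 'rV[R]_d -> R[i]) :
  (pdsR s (fun x => complex.Re (f x)) = (fun x => complex.Re (pdsC s f x))) /\
  (pdsR s (fun x => complex.Im (f x)) = (fun x => complex.Im (pdsC s f x))).
Proof. by elim: s => [//|i s [IH1 IH2]]; rewrite /= IH1 IH2. Qed.

Lemma iter_laplC_ReIm (R : realType) d p (f : 'rV[R]_d -> R[i]) :
  (iter p (@laplR R d) (fun x => complex.Re (f x)) = (fun x => complex.Re (iter p (@laplC R d) f x))) /\
  (iter p (@laplR R d) (fun x => complex.Im (f x)) = (fun x => complex.Im (iter p (@laplC R d) f x))).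
Proof.
elim: p => [//|p [IH1 IH2]]; rewrite !iterS IH1 IH2.
by split; apply/funext => x; rewrite /laplR /laplC ?Re_sum ?Im_sum.
Qed.

Lemma radial_sysD (R : realType) d (r0 : R) r1 (tau cc e : R) G G1 H H1 :
  radial_sys d r0 r1 tau cc G G1 -> radial_sys d r0 r1 tau cc H H1 ->
  radial_sys d r0 r1 tau cc (fun p v => G p v + e * H p v) (fun p v => G1 p v + e * H1 p v).
Proof.
move=> [dG dG1 bG] [dH dH1 bH].
have lin (a b : R -> R) (v da db : R) : is_derive v 1 a da -> is_derive v 1 b db ->
    is_derive v 1 (fun v => a v + e * b v) (da + e * db).
  by move=> Ha Hb; exact: (is_deriveD Ha (is_deriveZ e Hb)).
split.
- by move=> p v Jv; exact: lin (dG p v Jv) (dH p v Jv).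
- move=> p v Jv; apply: (is_derive_eq (lin _ _ _ _ _ (dG1 p v Jv) (dH1 p v Jv))).
  by ring.
- move=> a b sg Ja Jb ts.
  have [C [C0 HC]] := bG a b sg Ja Jb ts; have [D [D0 HD]] := bH a b sg Ja Jb ts.
  exists (C + `|e| * D); split; first by rewrite addr_ge0 // mulr_ge0.
  move=> p v vab; apply: le_trans (ler_normD _ _) _; rewrite normrM.
  have -> : (C + `|e| * D) * ((p.*2)`!)%:R * sg ^+ p.*2 =
    C * ((p.*2)`!)%:R * sg ^+ p.*2 + `|e| * (D * ((p.*2)`!)%:R * sg ^+ p.*2) by ring.
  by apply: lerD; [exact: HC|apply: ler_wpM2l => //; exact: HD].
Qed.

(** The real part of f conj(Y) is Re f Re Y + Im f Im Y, the imaginary part is Im f Re Y - Re f Im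
    Y. Each product falls under [radial_sys_exists], and the two systems are combined with
    coefficient 1 or -1. *)
Lemma fcoef_sys (R : realType) d (r0 : R) (r1 : \bar R) (tau : R) (f Y : 'rV[R]_d -> R[i]) k :
  (0 < d)%N -> 0 <= r0 -> polyharmonic_inf (annulus r0 r1) tau f -> harm_homog_poly k Y ->
  (exists G G1, radial_sys d r0 r1 tau (k%:R * (k%:R + d%:R - 2)) G G1 /\
     forall v, logI r0 r1 v -> complex.Re (fcoef f Y (expR v)) = G 0%N v) /\
  (exists G G1, radial_sys d r0 r1 tau (k%:R * (k%:R + d%:R - 2)) G G1 /\
     forall v, logI r0 r1 v -> complex.Im (fcoef f Y (expR v)) = G 0%N v).
Proof.
move=> d0 r00 [sm bd] HY.
have [Hy1 Hy2] := harm_homog_ReIm HY.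
pose h1 x := complex.Re (f x); pose h2 x := complex.Im (f x).
pose y1 x := complex.Re (Y x); pose y2 x := complex.Im (Y x).
have sm1 s x : annulus r0 r1 x -> differentiable (pdsR s h1) x.
  by move=> Ax; rewrite /h1 (pdsC_ReIm s f).1; exact: (sm s x Ax).1.
have sm2 s x : annulus r0 r1 x -> differentiable (pdsR s h2) x.
  by move=> Ax; rewrite /h2 (pdsC_ReIm s f).2; exact: (sm s x Ax).2.
have bd1 (K : set 'rV[R]_d) : compact K -> K `<=` annulus r0 r1 -> forall eps, 0 < eps ->
     exists CK, 0 < CK /\ forall p x, K x ->
        `|iter p (@laplR R d) h1 x| <= CK * ((p.*2)`!)%:R * (tau + eps) ^+ (p.*2).
  move=> cK KA eps e0; have [CK [CK0 HK]] := bd K cK KA eps e0; exists CK; split=> // p x Kx.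
  by rewrite /h1 (iter_laplC_ReIm p f).1; exact: le_trans (Re_le_cabs _) (HK p x Kx).
have bd2 (K : set 'rV[R]_d) : compact K -> K `<=` annulus r0 r1 -> forall eps, 0 < eps ->
     exists CK, 0 < CK /\ forall p x, K x ->
        `|iter p (@laplR R d) h2 x| <= CK * ((p.*2)`!)%:R * (tau + eps) ^+ (p.*2).
  move=> cK KA eps e0; have [CK [CK0 HK]] := bd K cK KA eps e0; exists CK; split=> // p x Kx.
  by rewrite /h2 (iter_laplC_ReIm p f).2; exact: le_trans (Im_le_cabs _) (HK p x Kx).
have cy (y : 'rV[R]_d -> R) : harm_homogR k y -> continuous y.
  by move=> [/polyf_grad[_ gy] _ _] x; exact: has_grad_continuous (gy x).
have ch (h : 'rV[R]_d -> R) : (forall s x, annulus r0 r1 x -> differentiable (pdsR s h) x) ->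
    forall x, annulus r0 r1 x -> {for x, continuous h}.
  by move=> sh x Ax; exact: differentiable_continuous (sh [::] x Ax).
have comb e (h h' y y' : 'rV[R]_d -> R) v : logI r0 r1 v ->
    (forall s x, annulus r0 r1 x -> differentiable (pdsR s h) x) ->
    (forall s x, annulus r0 r1 x -> differentiable (pdsR s h') x) ->
    harm_homogR k y -> harm_homogR k y' ->
    sphere_int (fun th => h (expR v *: th) * y th + e * (h' (expR v *: th) * y' th)) =
    Sint h y v + e * Sint h' y' v.
  move=> Jv sh sh' hy hy'.
  have c1 := sphC_ray (ch h sh) (cy y hy) Jv; have c2 := sphC_ray (ch h' sh') (cy y' hy') Jv.
  have := sphere_int_lin 1 e d0 c1 c2; rewrite !mul1r => <-.
  by congr sphere_int; apply/funext => th; rewrite mul1r.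
split.
- have [G [G1 [GS G0]]] := radial_sys_exists d0 r00 Hy1 sm1 bd1.
  have [H [H1 [HS H0]]] := radial_sys_exists d0 r00 Hy2 sm2 bd2.
  exists (fun p v => G p v + 1 * H p v), (fun p v => G1 p v + 1 * H1 p v); split; first exact: radial_sysD.
  move=> v Jv; rewrite G0 H0 -comb //; congr sphere_int; apply/funext => th.
  by rewrite /h1 /h2 /y1 /y2; case: (f _) => a b; case: (Y th) => c e /=; ring.
- have [G [G1 [GS G0]]] := radial_sys_exists d0 r00 Hy1 sm2 bd2.
  have [H [H1 [HS H0]]] := radial_sys_exists d0 r00 Hy2 sm1 bd1.
  exists (fun p v => G p v + (-1) * H p v), (fun p v => G1 p v + (-1) * H1 p v); split; first exact: radial_sysD.
  move=> v Jv; rewrite G0 H0 -comb //; congr sphere_int; apply/funext => th.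
  by rewrite /h1 /h2 /y1 /y2; case: (f _) => a b; case: (Y th) => c e /=; ring.
Qed.

(** * Estimates and evaluation of the double series *)

Lemma lamR_inj (R : realType) d k : odd d -> injective (lamR R d k).
Proof. by move=> od i j /eqP; rewrite /lamR eqr_int => /eqP /(lam_inj od). Qed.

Lemma qpoly_deriv (R : realType) d k n j : (j <= n)%N ->
  (deriv (@Defs.qpoly R d k n)).[(lam d k j)%:~R] = wden (lamR R d k) n j.
Proof. by move=> jn; exact: (@deriv_prodXsubC_root R (lamR R d k) n (Ordinal (jn : (j < n.+1)%N))). Qed.

(** In modulus e^{-lambda_j v0} z^{lambda_j} is x^{lambda_j}, so [wden_term_bound] applies to each
    of the n+1 terms. *)
Lemma Fterm_bound (R : realType) d k (f Y : 'rV[R]_d -> R[i]) (v0 : R) n (z : R[i]) (x : R) : (1 < d)%N -> odd d ->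
  0 < cabs z -> x = cabs z / expR v0 ->
  \sum_(j < n.+1) cabs (Fterm k f Y v0 n j z) <=
  cabs (Dop d k n (fun v => fcoef f Y (expR v)) v0) *
    (n.+1%:R * ((x + x^-1) ^+ (k + d) * ((1 + x) ^+ n / (n`!)%:R))).
Proof.
move=> d1 od z0 xE; have x0 : 0 < x by rewrite xE divr_gt0 ?expR_gt0.
rewrite mulrCA mulr_natl -[X in _ *+ X]card_ord -sumr_const; apply: ler_sum => j _.
have jn : (j <= n)%N by rewrite -ltnS.
rewrite /Fterm !cabsM -mulrA ler_wpM2l ?cabs_ge0 // qpoly_deriv // cabs_real cabsXz.
apply: (le_trans _ (@wden_term_bound R (lam d k) (k + d) n j x (lam_inj od) (fun i => lam_close k i d1) jn x0)).
rewrite normrM normfV (ger0_norm (expR_ge0 _)) mulNr expRN expR_exprz.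
by rewrite mulrAC xE expfzMl invr_expz exprz_inv [X in X / _]mulrC.
Qed.

(** A continuous positive function has a bounded reciprocal on a compact set; this is used for |z|
    and for 1 - 2 tau |z|, the latter form covering tau = 0 too. *)
Lemma compactC_bounds (R : realType) (K : set R[i]) (tau : R) : compactC K ->
  K `<=` [set z : R[i] | 0 < cabs z /\ 2 * tau * cabs z < 1] ->
  exists B, 0 < B /\ forall z, K z -> [/\ B^-1 <= cabs z, cabs z <= B & 2 * tau * cabs z <= 1 - B^-1].
Proof.
move=> cK KS; set S := [set (complex.Re z, complex.Im z) | z in K] in cK.
pose N (p : R * R) := Num.sqrt (p.1 ^+ 2 + p.2 ^+ 2).
have cN : continuous N.
  move=> p; apply: (@continuous_comp _ _ _ (fun p : R * R => p.1 ^+ 2 + p.2 ^+ 2) Num.sqrt); last exact: sqrt_continuous.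
  apply: contD.
    by apply: (@continuous_comp _ _ _ (fun p : R * R => p.1) (fun v => v ^+ 2)); [exact: cvg_fst|exact: exprn_continuous].
  by apply: (@continuous_comp _ _ _ (fun p : R * R => p.2) (fun v => v ^+ 2)); [exact: cvg_snd|exact: exprn_continuous].
have NS p : S p -> 0 < N p /\ 2 * tau * N p < 1 by move=> [z Kz <-]; exact: (KS z Kz).
have cV (g : R * R -> R) p : continuous g -> 0 < g p -> {for p, continuous (fun p => (g p)^-1)}.
  by move=> cg gp; apply: cvgV; [exact: lt0r_neq0|exact: cg].
have [B1 [B10 HB1]] := compact_fun_bounded cK (fun p _ => cN p).
have [B2 [B20 HB2]] := compact_fun_bounded cK (fun p Sp => cV N p cN (NS p Sp).1).
have cM : continuous (fun p => 1 - 2 * tau * N p).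
  move=> p; apply: (@contD R _ (fun=> 1) (fun p => - (2 * tau * N p))); first exact: contc.
  apply: (@contN R _ (fun p => 2 * tau * N p)); apply: (@contM R _ (fun=> 2 * tau) N); [exact: contc|exact: cN].
have M0 p : S p -> 0 < 1 - 2 * tau * N p by move=> /NS[_]; rewrite subr_gt0.
have [B3 [B30 HB3]] := compact_fun_bounded cK (fun p Sp => cV _ p cM (M0 p Sp)).
pose B := 1 + B1 + B2 + B3.
have B0 : 0 < B by rewrite /B; lra.
exists B; split=> // z Kz.
pose p := (complex.Re z, complex.Im z).
have Sp : S p by exists z.
have [N0 N1] := NS p Sp; have M0p := M0 p Sp.
have Nz : cabs z = N p by [].
have inv (u b : R) : 0 < u -> `|u^-1| <= b -> b <= B -> B^-1 <= u.
  move=> u0 ub bB; rewrite -[u]invrK lef_pV2 ?posrE ?invr_gt0 //.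
  by apply: le_trans bB; apply: le_trans ub; exact: ler_norm.
rewrite Nz; split.
- by apply: (inv _ B2) => //; [exact: HB2|rewrite /B; lra].
- apply: (@le_trans _ _ B1); last by rewrite /B; lra.
  by apply: le_trans (HB1 p Sp); exact: ler_norm.
- by have : B^-1 <= 1 - 2 * tau * N p; [apply: (inv _ B3) => //; [exact: HB3|rewrite /B; lra]|lra].
Qed.

Lemma unif_geom_bound (R : realType) (c kap e : R) : 0 <= kap < 1 -> 0 < e ->
  exists N, forall n, (N <= n)%N -> c * kap ^+ n < e.
Proof.
move=> k01 e0; have := cvg_geom0 c k01 => /cvgrPdist_lt /(_ e e0) [N _ HN].
by exists N => n Nn; have := HN n Nn; rewrite /= sub0r normrN; exact: le_lt_trans (ler_norm _).
Qed.

(** For z = e^v the inner sum collapses to D^(n)(v0) Phi_n(v - v0). *)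
Lemma Fpartial_real (R : realType) d k (f Y : 'rV[R]_d -> R[i]) (v0 v : R) N :
  let D n := Dop d k n (fun v => fcoef f Y (expR v)) v0 in
  complex.Re (Fpartial k f Y v0 N (expR v)%:C%C) =
    \sum_(n < N) complex.Re (D n) * Phi (lamR R d k) n (v - v0) /\
  complex.Im (Fpartial k f Y v0 N (expR v)%:C%C) =
    \sum_(n < N) complex.Im (D n) * Phi (lamR R d k) n (v - v0).
Proof.
move=> D.
have FE n : \sum_(j < n.+1) Fterm k f Y v0 n j (expR v)%:C%C = D n * (Phi (lamR R d k) n (v - v0))%:C%C.
  rewrite /Phi rmorph_sum mulr_sumr; apply: eq_bigr => j _; rewrite /Fterm -/(D n) -mulrA; congr (_ * _).
  rewrite -fmorphXz -rmorphM qpoly_deriv -?expR_exprz; last by rewrite -ltnS.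
  congr (_%:C%C); rewrite mulrAC -expRD; congr (expR _ / _).
  by rewrite /lamR; ring.
rewrite /Fpartial; split.
  by rewrite Re_sum; apply: eq_bigr => n _; rewrite FE Re_mulr_real.
by rewrite Im_sum; apply: eq_bigr => n _; rewrite FE Im_mulr_real.
Qed.

Lemma lt_max_ub (R : realType) (a b c : R) : a < c -> b < c -> Num.max a b < c.
Proof. by move=> ac bc; rewrite gt_max ac. Qed.

Lemma Eseq_taylor (R : realType) d k (r0 : R) r1 (tau : R) G G1 v0 v : (1 < d)%N -> odd d -> 0 <= tau ->
  radial_sys d r0 r1 tau (k%:R * (k%:R + d%:R - 2)) G G1 ->
  logI r0 r1 v0 -> logI r0 r1 v -> 2 * tau * expR v0 < 1 -> 2 * tau * expR v < 1 ->
  \sum_(n < N) Eseq k G G1 n v0 * Phi (lamR R d k) n (v - v0) @[N --> \oo] --> G 0%N v.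
Proof.
move=> d1 od t0 GS J0 J t1 t2.
pose rho := Num.max (expR v0) (expR v).
have rho0 : 0 < rho by rewrite lt_max expR_gt0.
have rho1 : 2 * tau * rho < 1 by rewrite /rho; case: (leP (expR v0) (expR v)).
(* Chosen so that 2 sg rho is the midpoint between 2 tau rho and 1. *)
pose sg := tau + (1 - 2 * tau * rho) / (4 * rho).
have tsg : tau < sg by rewrite ltrDl divr_gt0 ?subr_gt0 ?mulr_gt0.
have sg1 : 2 * sg * rho < 1.
  have -> : 2 * sg * rho = 2 * tau * rho + (1 - 2 * tau * rho) / 2 by rewrite /sg; field; rewrite gt_eqF.
  by lra.
have Jm : logI r0 r1 (Num.min v0 v) by case: (leP v0 v).
have JM : logI r0 r1 (Num.max v0 v) by case: (leP v0 v).
have [C [C0 HC]] := Eseq_bound d1 t0 GS Jm JM tsg.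
have -> : G 0%N v = Eseq k G G1 0 v by rewrite (Eseq_even k G G1 0) expr0 mul1r.
have sg0 : 0 <= sg by apply: le_trans t0 _; exact: ltW.
have dE m w : Num.min v0 v <= w <= Num.max v0 v ->
    is_derive w 1 (Eseq k G G1 m) (Eseq k G G1 m.+1 w + (lam d k m)%:~R * Eseq k G G1 m w).
  by move=> ww; apply: (Eseq_deriv GS); exact: (logI_interval Jm JM ww).
have e0 : expR v0 <= rho by rewrite le_max lexx.
have e1 : expR v <= rho by rewrite le_max lexx orbT.
exact: (@taylor_cvg R (lam d k) (k + d) (Eseq k G G1) v0 v C sg rho (lam_inj od)
  (fun i => lam_close k i d1) dE C0 sg0 HC e0 e1 sg1).
Qed.

(** * Assembly of the theorem *)

Unset Implicit Arguments. Set Strict Implicit.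

Theorem mainTheorem14 (R : realType) (d : nat) (r0 : R) (r1 : \bar R) (tau : R)
  (f : 'rV[R]_d -> R[i]) (k : nat) (Y : 'rV[R]_d -> R[i]) (v0 : R) :
  (1 < d)%N -> odd d ->
  0 <= r0 -> (r0%:E < r1)%E ->
  0 <= tau -> 2 * tau * r0 < 1 ->
  polyharmonic_inf (annulus r0 r1) tau f ->
  harm_homog_poly k Y ->
  sphere_int (fun th => cabs (Y th) ^+ 2) = 1 ->
  r0 < expR v0 -> ((expR v0)%:E < r1)%E -> 2 * tau * expR v0 < 1 ->
  exists (F : R[i] -> R[i]) (Fabs : R[i] -> R),
    (forall K : set R[i], compactC K ->
       K `<=` [set z : R[i] | 0 < cabs z /\ 2 * tau * cabs z < 1] ->
       unif_cvgC K (Fpartial k f Y v0) F /\ unif_cvgR K (Fpartial_abs k f Y v0) Fabs) /\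
    (forall r : R, r0 < r -> (r%:E < r1)%E -> 2 * tau * r < 1 ->
       F (r%:C)%C = fcoef f Y r).
Proof.
move=> d1 od r00 _ t0 _ Hf HY _ v0r0 v0r1 tv0.
have J0 : logI r0 r1 v0 by split.
have [[G [G1 [GS Gf]]] [H [H1 [HS Hff]]]] := fcoef_sys (ltnW d1) r00 Hf HY.
pose D n := Dop d k n (fun v => fcoef f Y (expR v)) v0.
have DE n : D n = Complex (Eseq k G G1 n v0) (Eseq k H H1 n v0).
  have DS A A1 (g : R -> R) : radial_sys d r0 r1 tau (k%:R * (k%:R + d%:R - 2)) A A1 ->
      (forall v, logI r0 r1 v -> g v = A 0%N v) -> DopR (lamR R d k) (iota 0 n) g v0 = Eseq k A A1 n v0.
    move=> AS gA; have gE v : logI r0 r1 v -> g v = Eseq k A A1 0 v.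
      by move=> Jv; rewrite gA // (Eseq_even k A A1 0) expr0 mul1r.
    exact: (@DopR_seq R (lamR R d k) (logI r0 r1) n (Eseq k A A1) g (@nbhs_logI R r0 r1)
      (Eseq_deriv AS) gE v0 J0).
  by rewrite /D Dop_ReIm (DS _ _ _ GS Gf) (DS _ _ _ HS Hff).
(* Defined for every z through [limn], which has a default value where there is no convergence; only
   values in the punctured disc are used. *)
pose F z := Complex (limn (fun N => complex.Re (Fpartial k f Y v0 N z)))
                    (limn (fun N => complex.Im (Fpartial k f Y v0 N z))).
pose Fabs z := limn (fun N => Fpartial_abs k f Y v0 N z).
exists F, Fabs; split; last first.
  move=> r rr0 rr1 tr; have rp : 0 < r by exact: le_lt_trans rr0.
  have rE : expR (ln r) = r by rewrite lnK.
  have J : logI r0 r1 (ln r) by rewrite /logI /= rE.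
  have tr' : 2 * tau * expR (ln r) < 1 by rewrite rE.
  rewrite /F -rE.
  have -> : (fun N => complex.Re (Fpartial k f Y v0 N (expR (ln r))%:C%C)) =
      (fun N => \sum_(n < N) Eseq k G G1 n v0 * Phi (lamR R d k) n (ln r - v0)).
    apply/funext => N; rewrite (Fpartial_real k f Y v0 (ln r) N).1.
    by apply: eq_bigr => n _; rewrite -/(D n) DE.
  have -> : (fun N => complex.Im (Fpartial k f Y v0 N (expR (ln r))%:C%C)) =
      (fun N => \sum_(n < N) Eseq k H H1 n v0 * Phi (lamR R d k) n (ln r - v0)).
    apply/funext => N; rewrite (Fpartial_real k f Y v0 (ln r) N).2.
    by apply: eq_bigr => n _; rewrite -/(D n) DE.
  rewrite (cvg_lim (@Rhausdorff R) (Eseq_taylor d1 od t0 GS J0 J tv0 tr')).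
  rewrite (cvg_lim (@Rhausdorff R) (Eseq_taylor d1 od t0 HS J0 J tv0 tr')).
  by rewrite -Gf // -Hff //; case: (fcoef _ _ _).
move=> K cK KS.
have [B [B0 HB]] := compactC_bounds cK KS.
have BV : 0 < B^-1 by rewrite invr_gt0.
pose r := expR v0; have r_gt0 : 0 < r by exact: expR_gt0.
(* An upper bound for tau (r + |z|) on K; it is below 1 because 2 tau r < 1 and 2 tau |z| <= 1 -
   1/B. *)
pose kap0 := tau * r + (1 - B^-1) / 2.
have kap01 : kap0 < 1 by rewrite /kap0 /r; lra.
(* Then eps (r + B) is half the distance from kap0 to 1, so sg (r + |z|) <= (1 + kap0)/2 on K. *)
pose eps := (1 - kap0) / (2 * (r + B)).
have eps0 : 0 < eps by rewrite divr_gt0 ?subr_gt0 // mulr_gt0 // addr_gt0.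
pose sg := tau + eps; have tsg : tau < sg by rewrite ltrDl.
have sg0 : 0 <= sg by rewrite addr_ge0 // ltW.
(* The maximum with 0 secures nonnegativity, since only 0 < B is recorded about B. *)
pose kap := Num.max 0 ((1 + kap0) / 2).
have kap_01 : 0 <= kap < 1 by rewrite le_max lexx gt_max ltr01 /=; lra.
have kapP z : K z -> sg * (r + cabs z) <= kap.
  move=> /HB[_ zB tz]; rewrite le_max; apply/orP; right.
  have h1 : tau * (r + cabs z) <= kap0 by rewrite /kap0; lra.
  have h2 : eps * (r + cabs z) <= eps * (r + B) by rewrite ler_wpM2l ?(ltW eps0) // lerD2l.
  have h3 : eps * (r + B) = (1 - kap0) / 2 by rewrite /eps; field; rewrite gt_eqF // addr_gt0.
  by rewrite /sg mulrDl; lra.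
(* Only the point v0 matters here, so the interval is degenerate. *)
have [CG [CG0 HG]] := Eseq_bound d1 t0 GS J0 J0 tsg.
have [CH [CH0 HH]] := Eseq_bound d1 t0 HS J0 J0 tsg.
have [kap' [C1 [kap'01 C10 HC1]]] := sq_succ_geom kap_01.
(* Bounds x + 1/x for x = |z|/r, uniformly on K. *)
pose Y0 := B / r + r * B.
have Y00 : 0 <= Y0 by rewrite addr_ge0 // ?divr_ge0 ?mulr_ge0 // ltW.
pose C := (CG + CH) * Y0 ^+ (k + d) * C1.
have C0 : 0 <= C by rewrite !mulr_ge0 ?addr_ge0 ?exprn_ge0.
have bound z n : K z -> \sum_(j < n.+1) cabs (Fterm k f Y v0 n j z) <= C * kap' ^+ n.
  move=> Kz; have [zl zB tz] := HB z Kz.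
  have z0 : 0 < cabs z by apply: lt_le_trans zl.
  apply: le_trans (Fterm_bound k f Y n d1 od z0 erefl) _; rewrite -/r -/(D n).
  set x := cabs z / r.
  have x0 : 0 < x by rewrite divr_gt0.
  have xY : x + x^-1 <= Y0.
    rewrite /x /Y0 lerD //; first by rewrite ler_wpM2r // invr_ge0 ltW.
    rewrite invfM invrK mulrC ler_wpM2l ?(ltW r_gt0) //.
    by rewrite -[B]invrK lef_pV2 ?posrE.
  have DB : cabs (D n) <= (CG + CH) * (n`!)%:R * sg ^+ n * r ^+ n.
    apply: le_trans (cabs_le _) _; rewrite DE /= !mulrDl.
    by apply: lerD; [apply: HG|apply: HH]; rewrite lexx.
  have nf : 0 < (n`!)%:R :> R by rewrite ltr0n fact_gt0.
  apply: (@le_trans _ _ (((CG + CH) * (n`!)%:R * sg ^+ n * r ^+ n) *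
     (n.+1%:R * (Y0 ^+ (k + d) * ((1 + x) ^+ n / (n`!)%:R))))).
    have P0 : 0 <= (1 + x) ^+ n / (n`!)%:R by rewrite divr_ge0 ?exprn_ge0 ?addr_ge0 // ltW.
    have xx0 : 0 <= x + x^-1 by apply: addr_ge0; rewrite ?invr_ge0 ltW.
    apply: ler_pM => //; first exact: cabs_ge0.
      by apply: mulr_ge0; rewrite ?ler0n //; apply: mulr_ge0 => //; exact: exprn_ge0.
    by rewrite ler_wpM2l ?ler0n // ler_wpM2r // lerXn2r ?nnegrE.
  have -> : (CG + CH) * (n`!)%:R * sg ^+ n * r ^+ n *
     (n.+1%:R * (Y0 ^+ (k + d) * ((1 + x) ^+ n / (n`!)%:R))) =
     (CG + CH) * Y0 ^+ (k + d) * (n.+1%:R * (sg * (r + cabs z)) ^+ n).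
    have -> : r + cabs z = r * (1 + x) by rewrite /x; field; rewrite gt_eqF.
    by rewrite !exprMn; field; rewrite gt_eqF.
  rewrite [leRHS](_ : _ = (CG + CH) * Y0 ^+ (k + d) * (C1 * kap' ^+ n)); last by rewrite /C; ring.
  apply: ler_wpM2l; first by apply: mulr_ge0; [exact: addr_ge0|exact: exprn_ge0].
  have kap0' : 0 <= kap by case/andP: kap_01.
  have szk : 0 <= sg * (r + cabs z) by rewrite mulr_ge0 // addr_ge0 // ltW.
  apply: le_trans (HC1 n).
  apply: ler_pM; rewrite ?ler0n ?exprn_ge0 //.
    (* One factor n+1 is enlarged to its square to fit the majorant of [sq_succ_geom]. *)
    by rewrite -natrX ler_nat expnS leq_pmulr // expn_gt0.
  by rewrite lerXn2r ?nnegrE // kapP.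
have Mtest (T : nat -> R[i] -> R) z : K z -> (forall n, `|T n z| <= C * kap' ^+ n) ->
    forall N, `|\sum_(n < N) T n z - limn (fun N => \sum_(n < N) T n z)| <= C / (1 - kap') * kap' ^+ N.
  by move=> Kz HT; exact: (@geom_Mtest R (T^~ z) C kap').
have cabs_sum n z : cabs (\sum_(j < n.+1) Fterm k f Y v0 n j z) <= \sum_(j < n.+1) cabs (Fterm k f Y v0 n j z).
  elim/big_ind2 : _ => [|x1 a x2 b h1 h2|//]; first by rewrite (@cabs_real R 0) normr0.
  rewrite !cabs_normc in h1 h2 *; apply: le_trans (le_normcD _ _) _; exact: lerD.
have MRe z N : K z -> `|complex.Re (Fpartial k f Y v0 N z) - complex.Re (F z)| <= C / (1 - kap') * kap' ^+ N.
  move=> Kz; have E N' : complex.Re (Fpartial k f Y v0 N' z) =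
      \sum_(n < N') complex.Re (\sum_(j < n.+1) Fterm k f Y v0 n j z) by rewrite Re_sum.
  rewrite /F /= E (funext E); apply: (Mtest (fun n z => complex.Re (\sum_(j < n.+1) Fterm k f Y v0 n j z))) => // n.
  exact: le_trans (Re_le_cabs _) (le_trans (cabs_sum n z) (bound z n Kz)).
have MIm z N : K z -> `|complex.Im (Fpartial k f Y v0 N z) - complex.Im (F z)| <= C / (1 - kap') * kap' ^+ N.
  move=> Kz; have E N' : complex.Im (Fpartial k f Y v0 N' z) =
      \sum_(n < N') complex.Im (\sum_(j < n.+1) Fterm k f Y v0 n j z) by rewrite Im_sum.
  rewrite /F /= E (funext E); apply: (Mtest (fun n z => complex.Im (\sum_(j < n.+1) Fterm k f Y v0 n j z))) => // n.
  exact: le_trans (Im_le_cabs _) (le_trans (cabs_sum n z) (bound z n Kz)).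
split=> e e0.
  have e20 : 0 < e / 2 by rewrite divr_gt0.
  have [N HN] := unif_geom_bound (C / (1 - kap')) kap'01 e20.
  exists N => n Nn z Kz; apply: le_lt_trans (cabs_le _) _.
  rewrite !raddfB /=.
  have := MRe z n Kz; have := MIm z n Kz; have := HN n Nn; lra.
have [N HN] := unif_geom_bound (C / (1 - kap')) kap'01 e0.
exists N => n Nn z Kz; apply: le_lt_trans (HN n Nn).
apply: (Mtest (fun n z => \sum_(j < n.+1) cabs (Fterm k f Y v0 n j z))) => // m.
by rewrite ger0_norm; [exact: bound|apply: sumr_ge0 => j _; exact: cabs_ge0].
Qed.
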